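(* Consider a simple, non-degenerate, doubling and conductively uniform iterated graph system with limit space $(X,d,\mu)$, and let $p\in(1,\infty)$. The following hold. (1) (Poincaré inequality) There is a constant $C>0$ such that for all $n\in\mathbb{N}\cup\{0\}$, $e\in E_n$ and $f\in\mathscr{F}_p$, $$\frac{1}{\mu(X_e)}\int_{X_e}|f-f_{X_e}|^p\,d\mu\le C\,\mathscr{E}_p(f\circ F_e),\qquad f_{X_e}:=\frac1{\mu(X_e)}\int_{X_e}f\,d\mu.$$ In particular, $\mathscr{E}_p(f)=0$ if and only if $f$ is constant $\mu$-almost everywhere. (2) ($p$-Clarkson's inequality) For all $f,g\in\mathscr{F}_p$, $$\mathscr{E}_p(f+g)+\mathscr{E}_p(f-g)\ge2\bigl(\mathscr{E}_p(f)^{\frac1{p-1}}+\mathscr{E}_p(g)^{\frac1{p-1}}\bigr)^{p-1}\quad\text{if }p\in(1,2],$$ $$\mathscr{E}_p(f+g)+\mathscr{E}_p(f-g)\le2\bigl(\mathscr{E}_p(f)^{\frac1{p-1}}+\mathscr{E}_p(g)^{\frac1{p-1}}\bigr)^{p-1}\quad\text{if }p\in[2,\infty).$$ (3) (Strong locality) If $f,g\in\mathscr{F}_p$ satisfy $\operatorname{supp}_\mu(f-a)\cap\operatorname{supp}_\mu(g-b)=\emptyset$ for some $a,b\in\mathbb{R}$, then for all $h\in\mathscr{F}_p$, $$\mathscr{E}_p(f+g+h)+\mathscr{E}_p(h)=\mathscr{E}_p(f+h)+\mathscr{E}_p(g+h).$$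
   Context: Graphs. A graph $G=(V,E)$ has a finite nonempty vertex set $V$ and a finite multiset $E$ of unordered pairs $\{v,w\}$ of distinct vertices (parallel edges are counted separately). $\deg(v)$ is the number of edges containing $v$; $d_G$ is the shortest-path metric of a connected graph; a vertex set is independent if no edge joins two of its elements, and connected if any two of its points are joined by a path inside it. Iterated graph systems (IGS). An IGS consists of a connected graph $G_1=(V_1,E_1)$ (the generator), a nonempty finite set $I$, and for all $e\in E_1$, $v\in e$ an injective map $\phi_{v,e}:I\to V_1$ with independent image such that $\phi_{v,e}(I)\cap\phi_{w,e}(I)=\emptyset$ if $e=\{v,w\}$. It is simple if there are $\phi_+,\phi_-:I\to V_1$ with $\{\phi_{v,e},\phi_{w,e}\}=\{\phi_+,\phi_-\}$ for all $e=\{v,w\}\in E_1$; then $I_\pm:=\phi_\pm(I)$ and the ends of $e$ are named $e^+,e^-$ so that $\phi_{e^\pm,e}=\phi_\pm$. It is doubling if $\deg(v)=1$ for all $v\in I_+\cup I_-$ (then $\mathfrak{n}(v)$ is the unique neighbour of $v$), and non-degenerate if no edge joins $I_+$ to $I_-$. Put $L_*:=\operatorname{dist}(I_+,I_-,d_{G_1})\ge2$. Potentials and flows. Let $p\in(1,\infty)$, $q=p/(p-1)$. For $U:V\to\mathbb{R}$ on a graph $(V,E)$ and $e=\{v,w\}\in E$ put $\nabla U(v,w)=U(w)-U(v)$, $|\nabla U(e)|=|\nabla U(v,w)|$, $\mathcal{E}_p(U)=\sum_{e\in E}|\nabla U(e)|^p$. A unit flow from $A$ to $B$ (disjoint nonempty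 vertex sets) is $\mathcal{J}:V\times V\to\mathbb{R}$ antisymmetric, with $\mathcal{J}(v,w)=0$ unless $\{v,w\}\in E$, $\operatorname{div}(\mathcal{J})(v):=\sum_{\{v,w\}\in E}\mathcal{J}(v,w)=0$ for $v\notin A\cup B$, and $\sum_{v\in A}\operatorname{div}(\mathcal{J})(v)=1$; $|\mathcal{J}(e)|:=|\mathcal{J}(v,w)|$ and $\mathcal{E}_q(\mathcal{J})=\sum_{e\in E}|\mathcal{J}(e)|^q$. On $G_1$, $U_p$ is the unique minimizer of $\mathcal{E}_p$ among $U$ with $U|_{I_+}\equiv1$, $U|_{I_-}\equiv0$; $\mathcal{M}_p:=\mathcal{E}_p(U_p)$; $\mathcal{J}_p$ is the unique minimizer of $\mathcal{E}_q$ among unit flows from $I_+$ to $I_-$. The IGS is conductively uniform if for all $p\in(1,\infty)$ and $a\in I$, $\mathcal{J}_p(\phi_+(a),\mathfrak{n}(\phi_+(a)))=-\mathcal{J}_p(\phi_-(a),\mathfrak{n}(\phi_-(a)))$; this value is denoted $\mathcal{J}_p(a)$, and $a\mapsto\mathcal{J}_p(a)$ is a probability density on $I$. Replacement graphs. $G_0$ has vertices $v_+,v_-$ and one edge $e_0$ with $e_0^\pm=v_\pm$. Given $G_n=(V_n,E_n)$ whose edges have named ends $e^\pm$ (write $\phi_{v,e}=\phi_\pm$ if $v=e^\pm$), put $V_{n+1}=(V_1\times E_n)/\sim$, where $(\phi_{v,e}(a),e)\sim(\phi_{v,f}(a),f)$ for $e,f\in E_n$ sharing an end $v$ and $a\in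 I$; classes are written $[z,e]$. For each $e\in E_n$, $f\in E_1$ there is one edge $e\cdot f=\{[f^+,e],[f^-,e]\}\in E_{n+1}$ with $(e\cdot f)^\pm=[f^\pm,e]$. So $E_n$ is identified with words of length $n$ in $E_1$, and $e\cdot f$ denotes concatenation for $e\in E_n$, $f\in E_m$. For $e\in E_n$ define $\sigma_{e,m}:V_m\to V_{n+m}$ by $\sigma_{e,0}(v_\pm)=e^\pm$, $\sigma_{e,m+1}([z,f])=[z,e\cdot f]$, and $e\cdot G_m:=\sigma_{e,m}(V_m)$. For $v\in V_n$, $a\in I$ put $v\cdot a:=[\phi_{v,e}(a),e]\in V_{n+1}$ (any $e\in E_n$ containing $v$), and $v\cdot(a_1\cdots a_m):=(\cdots(v\cdot a_1)\cdots)\cdot a_m$. Write $|e|=n$ for $e\in E_n$. Limit space. $\Sigma$ is the set of sequences $(e_i)_{i\ge0}$, $e_i\in E_i$, with $e_i$ the length-$i$ prefix of $e_{i+1}$; $X:=\Sigma/\sim$ with $(e_i)\sim(f_i)$ iff $e_i\cap f_i\neq\emptyset$ for all $i$; $\chi:\Sigma\to X$ is the projection. For $e\in E_n$, $F_e:X\to X$ is given by $F_e(\chi((e_i)_i))=\chi((g_i)_i)$ with $g_{n+i}=e\cdot e_i$, and $X_e:=F_e(X)$. $\mu$ is the push-forward under $\chi$ of the uniform Bernoulli probability measure on $\Sigma\cong E_1^{\mathbb{N}}$. The metric is $d(\chi((e_i)),\chi((f_i))):=\lim_n\min_{v\in e_n,w\in f_n}d_n(v,w)$, where for $v\ne w$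 in $V_n$, $d_n(v,w)=\inf_\Omega\sum_{e\in\Omega}L_*^{-|e|}$ over $\Omega\subseteq\bigcup_{j=0}^nE_j$ such that $\bigcup_{e\in\Omega}e\cdot G_{n-|e|}$ is connected in $G_n$ and contains $v,w$; $d_n(v,v)=0$. Energy and Sobolev space. For $v\in e\in E_n$ let $T_{v,e}:I^{\mathbb{N}}\to\Sigma$ send $(a_i)$ to the sequence whose $n$-th term is $e$ and whose $i$-th term, $i>n$, is the unique edge of the form $e\cdot f$, $f\in E_{i-n}$, containing $v\cdot(a_1\cdots a_{i-n})$. $\operatorname{Fib}(v):=\chi(T_{v,e}(I^{\mathbb{N}}))$, and $\mathcal{J}_{p,v}$ is the push-forward by $\chi\circ T_{v,e}$ of the product probability measure on $I^{\mathbb{N}}$ with one-dimensional marginals $\mathcal{J}_p(\cdot)$ (both independent of $e$). For $f\in C(X)$ let $V_n[f](v):=\int_{\operatorname{Fib}(v)}f\,d\mathcal{J}_{p,v}$, $v\in V_n$, and $\mathsf{E}_p(f):=\lim_n\mathcal{M}_p^{-n}\mathcal{E}_p(V_n[f])\in[0,\infty]$ (a non-decreasing limit). Let $\mathscr{C}_p=\{f\in C(X):\mathsf{E}_p(f)<\infty\}$. For $f\in L^p(X,\mu)$, $\mathscr{E}_p(f):=\lim_i\mathsf{E}_p(f_i)$ for any sequence $f_i\in\mathscr{C}_p$ with $\mathsf{E}_p(f_i-f_j)\to0$ as $i,j\to\infty$ and $f_i\to f$ in $L^p(X,\mu)$ (independent of the sequence by closability of $\mathsf{E}_p$), and $\mathscr{E}_p(f):=\infty$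 if none exists. $\mathscr{F}_p:=\{f\in L^p(X,\mu):\mathscr{E}_p(f)<\infty\}$. $\operatorname{supp}_\mu(u)$ denotes the support of the measure $|u|\,d\mu$ (smallest closed set outside which $u=0$ $\mu$-a.e.). *)

(* Defs.v *)
From HB Require Import structures.
From Stdlib Require Import Relation_Operators.
From mathcomp Require Import all_boot all_order all_algebra.
From mathcomp Require Import all_classical all_reals all_analysis.

Set Implicit Arguments.
Unset Strict Implicit.
Unset Printing Implicit Defensive.

Import Order.TTheory GRing.Theory Num.Theory.
Import numFieldNormedType.Exports.

Local Open Scope classical_set_scope.
Local Open Scope ring_scope.

(* A finite loopless multigraph: parallel edges are distinct elements of [edge]
   with the same set of ends. *)
Record mgraph := MGraph {
  vert : finType;
  edge : finType;
  ends : edge -> {set vert};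
  ends_card : forall e, #|ends e| = 2%N;
  vert_nonempty : (0 < #|vert|)%N }.

Section EndSets.
Context (V E : finType) (ends : E -> {set V}).

Definition adj : rel V := [rel v w | [exists e, ends e == [set v; w]%SET]].

Definition deg (v : V) : nat := #|[set e | v \in ends e]%SET|.

Definition independent (A : {set V}) : bool :=
  [forall v in A, forall w in A, ~~ adj v w].

Definition path_inside (A : {set V}) : rel V :=
  [rel v w | [&& v \in A, w \in A & adj v w]].

Definition connected_set (A : {set V}) : bool :=
  [forall v in A, forall w in A, connect (path_inside A) v w].

(* Shortest-path distance; the infimum is over the lengths of all walks from
   [v] to [w], hence a minimum when the graph is connected. *)
Definition graph_dist (R : realType) (v w : V) : R :=
  inf [set (size s)%:R | s in [set s : seq V | path adj v s /\ last v s = w]].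

Definition graph_set_dist (R : realType) (A B : {set V}) : R :=
  inf [set graph_dist R v w | v in [set` A] & w in [set` B]].

(* [\sum_(w | ends e == [set v; w])] has exactly one term when [e] contains
   [v], and is empty otherwise. *)
Definition divergence (R : realType) (J : V -> V -> R) (v : V) : R :=
  \sum_(e : E) \sum_(w | ends e == [set v; w]%SET) J v w.

Definition unit_flow (R : realType) (A B : {set V}) (J : V -> V -> R) : Prop :=
  [/\ forall v w, J w v = - J v w,
      forall v w, ~~ adj v w -> J v w = 0,
      forall v, v \notin A :|: B -> divergence J v = 0
    & \sum_(v in A) divergence J v = 1].
End EndSets.

(* Energies of graphs whose edges have named ends: [pole true e] is e^+ and
   [pole false e] is e^-. *)
Section Energies.
Context (R : realType) (V E : finType) (pole : bool -> E -> V).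

Definition energy (p : R) (U : V -> R) : R :=
  \sum_(e : E) `|U (pole false e) - U (pole true e)| `^ p.

Definition flow_energy (q : R) (J : V -> V -> R) : R :=
  \sum_(e : E) `|J (pole true e) (pole false e)| `^ q.
End Energies.

(* [phi v e] is meaningful only for [v \in ends e]. *)
Record igs := IGS {
  gen : mgraph;
  label : finType;
  phi : vert gen -> edge gen -> {ffun label -> vert gen};
  gen_connected : connected_set (@ends gen) [set: vert gen];
  label_nonempty : (0 < #|label|)%N;
  phi_inj : forall e v, v \in ends e -> injective (phi v e);
  phi_indep : forall e v, v \in ends e ->
    independent (@ends gen) (phi v e @: label);
  phi_disj : forall e v w, ends e = [set v; w]%SET ->
    phi v e @: label :&: phi w e @: label = finset.set0 }.

(* [phipm true] is phi_+ and [phipm false] is phi_-. *)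
Record simple_igs := SimpleIGS {
  sigs :> igs;
  phipm : bool -> {ffun label sigs -> vert (gen sigs)};
  simpleP : forall (e : edge (gen sigs)) v w, ends e = [set v; w]%SET ->
    [set phi v e; phi w e]%SET = [set phipm true; phipm false]%SET }.

Definition Ipm (S : simple_igs) (s : bool) : {set vert (gen S)} :=
  phipm S s @: label S.

Record doubling_igs := DoublingIGS {
  dsigs :> simple_igs;
  doublingP : forall v, v \in Ipm dsigs true :|: Ipm dsigs false ->
    deg (@ends (gen dsigs)) v = 1%N }.

Lemma label_ex (S : igs) : exists a : label S, true.
Proof. by have /card_gt0P[a _] := label_nonempty S; exists a. Qed.

Lemma pole_subproof (S : simple_igs) (s : bool) (e : edge (gen S)) :
  exists v, (v \in ends e) && (phi v e == phipm S s).
Proof.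
have /eqP/cards2P[v [w [_ evw]]] := ends_card e.
have := simpleP evw => /setP/(_ (phipm S s)); rewrite !inE.
have -> : (phipm S s == phipm S true) || (phipm S s == phipm S false).
  by case: s; rewrite eqxx ?orbT.
by case/orP => /eqP ->; [exists v|exists w]; rewrite evw !inE eqxx ?orbT /=.
Qed.

(* [gpole true e] is e^+ and [gpole false e] is e^-. *)
Definition gpole (S : simple_igs) (s : bool) (e : edge (gen S)) :
  vert (gen S) := xchoose (pole_subproof s e).

Lemma gpole_phi (S : simple_igs) s (e : edge (gen S)) :
  phi (gpole s e) e = phipm S s.
Proof. by have /andP[_ /eqP] := xchooseP (pole_subproof s e). Qed.

Lemma gpole_ends (S : simple_igs) s (e : edge (gen S)) : gpole s e \in ends e.
Proof. by have /andP[] := xchooseP (pole_subproof s e). Qed.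

Lemma ends_gpole (S : simple_igs) (e : edge (gen S)) :
  ends e = [set gpole true e; gpole false e]%SET.
Proof.
apply/esym/eqP; rewrite eqEcard ends_card cards2.
have -> : gpole true e != gpole false e.
  apply/eqP => tf; have /eqP/cards2P[v [w [vw evw]]] := ends_card e.
  have := simpleP evw; rewrite -(gpole_phi true e) -(gpole_phi false e) tf => /setP h.
  have [a _] := label_ex S; have := phi_disj evw.
  have -> : phi v e = phi w e.
    have := h (phi v e); have := h (phi w e).
    by rewrite !inE !eqxx ?orbT => /esym/orP[]/eqP-> /esym/orP[]/eqP->.
  by rewrite finset.setIid => /setP/(_ (phi w e a)); rewrite imset_f // inE.
by rewrite leqnn andbT; apply/fintype.subsetP => v;
   rewrite !inE => /orP[]/eqP->; exact: gpole_ends.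
Qed.

Definition non_degenerate (S : simple_igs) : Prop :=
  forall v w, v \in Ipm S true -> w \in Ipm S false ->
    ~~ adj (@ends (gen S)) v w.

Lemma edge_nonempty (S : doubling_igs) : exists e : edge (gen S), true.
Proof.
have /card_gt0P[a _] := label_nonempty S.
have : phipm S true a \in Ipm S true :|: Ipm S false.
  by rewrite inE imset_f.
move/doublingP => d1; have : (0 < deg (@ends (gen S)) (phipm S true a))%N.
  by rewrite d1.
by move/card_gt0P => [e _]; exists e.
Qed.

(* E_1, resp. I, as a pointed finite type. *)
Definition letter (S : doubling_igs) : Type := edge (gen S).
HB.instance Definition _ (S : doubling_igs) :=
  Finite.copy (letter S) (edge (gen S)).
Definition letter0 (S : doubling_igs) : letter S := xchoose (edge_nonempty S).
HB.instance Definition _ (S : doubling_igs) :=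
  isPointed.Build (letter S) (letter0 S).

Definition lab (S : igs) : Type := label S.
HB.instance Definition _ (S : igs) := Finite.copy (lab S) (label S).
Definition lab0 (S : igs) : lab S := xchoose (label_ex S).
HB.instance Definition _ (S : igs) := isPointed.Build (lab S) (lab0 S).

Section Generator.
Context (R : realType) (S : simple_igs).
Local Notation V1 := (vert (gen S)).
Local Notation ends1 := (@ends (gen S)).
Local Notation Ip := (Ipm S true).
Local Notation Im := (Ipm S false).

Definition Lstar : R := graph_set_dist ends1 R Ip Im.

(* The unique neighbour of a vertex of degree 1. *)
Definition nbr (v : V1) : V1 := odflt v [pick w | adj ends1 v w].

Definition potential : set (V1 -> R) :=
  [set U | (forall v, v \in Ip -> U v = 1) /\ (forall v, v \in Im -> U v = 0)].

(* The unique minimizer U_p. *)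
Definition Up (p : R) : V1 -> R :=
  xget (fun=> 0) [set U | potential U /\ forall U', potential U' ->
    energy (@gpole S) p U <= energy (@gpole S) p U'].

Definition Mp (p : R) : R := energy (@gpole S) p (Up p).

(* The unique minimizer J_p; the conjugate exponent is p / (p - 1). *)
Definition Jp (p : R) : V1 -> V1 -> R :=
  xget (fun _ _ => 0) [set J | unit_flow ends1 Ip Im J /\
    forall J', unit_flow ends1 Ip Im J' ->
      flow_energy (@gpole S) (p / (p - 1)) J
        <= flow_energy (@gpole S) (p / (p - 1)) J'].

Definition conductively_uniform : Prop :=
  forall (p : R) (a : label S), 1 < p ->
    Jp p (phipm S true a) (nbr (phipm S true a)) =
    - Jp p (phipm S false a) (nbr (phipm S false a)).

Definition Jlab (p : R) (a : lab S) : R :=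
  Jp p (phipm S true a) (nbr (phipm S true a)).
End Generator.

Section Replacement.
Context (S : simple_igs) (V E : finType) (pole : bool -> E -> V).

(* (phi_{v,e}(a), e) ~ (phi_{v,f}(a), f) for v = e^s = f^t. *)
Definition glue_rel : rel (vert (gen S) * E) := [rel x y |
  [exists s : bool, exists t : bool, exists a : label S,
    [&& pole s x.2 == pole t y.2, x.1 == phipm S s a & y.1 == phipm S t a]]].

Lemma glue_sym : symmetric glue_rel.
Proof.
move=> x y; apply/idP/idP => /existsP[s /existsP[t /existsP[a /and3P[h1 h2 h3]]]];
  apply/existsP; exists t; apply/existsP; exists s; apply/existsP; exists a;
  by rewrite eq_sym h1 h2 h3.
Qed.

(* [connect glue_rel] is the equivalence relation generated by [glue_rel]. *)
Lemma connect_glue_sym : symmetric (connect glue_rel).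
Proof. exact: sym_connect_sym glue_sym. Qed.

Canonical glue_equiv :=
  EquivRel (connect glue_rel) (@connect0 _ glue_rel) connect_glue_sym
    (@connect_trans _ glue_rel).

Definition rvert : Type := {eq_quot glue_equiv}%qT.
HB.instance Definition _ :=
  Finite.copy rvert (can_type (@EquivQuot.ereprK _ _ _ _ _ glue_equiv)).
HB.instance Definition _ := EqQuotient.on rvert.

Definition rclass (x : vert (gen S) * E) : rvert := (\pi x)%qT.

Definition rpole (s : bool) (ef : E * edge (gen S)) : rvert :=
  rclass (gpole s ef.2, ef.1).
End Replacement.

Section Levels.
Context (S : doubling_igs).
Local Notation V1 := (vert (gen S)).

(* E_n, as words of length n in E_1; the last letter is the outermost second
   component. *)
Fixpoint word (n : nat) : finType :=
  if n is m.+1 then (word m * letter S)%type else unit.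

(* V_n together with the ends e^+, e^- of the edges e in E_n; v_+ is [true]
   and v_- is [false] in V_0. *)
Fixpoint level (n : nat) : {V : finType & bool -> word n -> V} :=
  if n is m.+1 return {V : finType & bool -> word n -> V}
  then existT (fun V : finType => bool -> word m.+1 -> V)
         (rvert S (projT2 (level m))) (@rpole S _ _ (projT2 (level m)))
  else existT (fun V : finType => bool -> word 0 -> V)
         (bool : finType) (fun s _ => s).

Definition lvert (n : nat) : finType := projT1 (level n).

Definition lpole (n : nat) : bool -> word n -> lvert n := projT2 (level n).

Definition lends (n : nat) (e : word n) : {set lvert n} :=
  [set lpole true e; lpole false e]%SET.

(* [z, e] *)
Definition vclass (n : nat) (z : V1) (e : word n) : lvert n.+1 :=
  rclass (lpole (n := n)) (z, e).

(* A representative of a vertex of G_{n+1}. *)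
Definition vrepr (n : nat) (u : lvert n.+1) : V1 * word n :=
  repr (u : rvert S (lpole (n := n))).

(* e . f *)
Fixpoint wcat (n : nat) (e : word n) (m : nat) : word m -> word (m + n) :=
  if m is k.+1 return word m -> word (m + n)
  then fun f => (wcat e f.1, f.2) else fun=> e.

(* sigma_{e,m} *)
Definition sigma (n : nat) (e : word n) (m : nat) : lvert m -> lvert (m + n) :=
  if m is k.+1 return lvert m -> lvert (m + n)
  then fun u => vclass (vrepr u).1 (wcat e (vrepr u).2)
  else fun s => lpole s e.

Fixpoint word0 (n : nat) : word n :=
  if n is m.+1 then (word0 m, point : letter S) else tt.

(* v . a *)
Definition vdot (n : nat) (v : lvert n) (a : label S) : lvert n.+1 :=
  xget (vclass (gpole true (point : letter S)) (word0 n))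
    [set u | exists s (e : word n),
       lpole s e = v /\ u = vclass (phipm S s a) e].

(* v . (a_0 ... a_{m-1}) *)
Fixpoint vdots (n : nat) (v : lvert n) (a : nat -> lab S) (m : nat) :
    lvert (m + n) :=
  if m is k.+1 then vdot (vdots v a k) (a k) else v.

(* e . G_{n-|e|} for e in E_j, j <= n; the types [lvert (n - j + j)] and
   [lvert n] are compared through their common sigma-type. *)
Definition cell (n : nat) (t : {j : 'I_n.+1 & word j}) : {set lvert n} :=
  [set v | [exists u : lvert (n - tag t),
    (existT (fun k => lvert k : Type) (n - tag t + tag t)%N
       (sigma (tagged t) u)) == existT (fun k => lvert k : Type) n v]]%SET.

Definition ldist (R : realType) (n : nat) (v w : lvert n) : R :=
  if v == w then 0 else
  inf [set \sum_(t in Omega) (Lstar R S) ^- (tag t) |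
    Omega in [set Omega : {set {j : 'I_n.+1 & word j}} |
      let C := (\bigcup_(t in Omega) cell t)%SET in
      [/\ connected_set (lends (n := n)) C, v \in C & w \in C]]].
End Levels.

(* Sequences are carried by [nat -> T] with the product sigma-algebra, which
   is generated by the cylinders. *)
Definition cylinder (T : Type) (n : nat) (u : nat -> T) : set (nat -> T) :=
  [set x | forall i, (i < n)%N -> x i = u i].

Definition cylinders (T : Type) : set (set (nat -> T)) :=
  [set A | exists n u, A = cylinder n u].

Definition seqspace (T : pointedType) := g_sigma_algebraType (@cylinders T).

(* The product probability measure with one-dimensional marginals [w], i.e. the
   unique probability measure with the prescribed values on cylinders; it
   exists whenever [w] is a probability density on a finite [T]. *)
Definition product_measure (R : realType) (T : pointedType) (w : T -> R) :
    probability (seqspace T) R :=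
  get
    [set P : probability (seqspace T) R | forall n u,
       P (cylinder n u) = (\prod_(i < n) w (u i))%:E].

Section Symbolic.
Context (S : doubling_igs).

(* Sigma is identified with E_1^N: the sequence (e_n) is recovered from
   [w : nat -> E_1] as the sequence of its prefixes. *)
Definition symb : Type := nat -> letter S.
HB.instance Definition _ := Choice.copy symb (nat -> letter S).
HB.instance Definition _ := Pointed.copy symb (nat -> letter S).

Fixpoint prefix_word (n : nat) (w : symb) : word S n :=
  if n is m.+1 then (prefix_word m w, w m) else tt.

Definition scons (x : letter S) (w : symb) : symb :=
  fun k => if k is j.+1 then w j else x.

(* e w *)
Fixpoint prepend (n : nat) : word S n -> symb -> symb :=
  if n is m.+1 return word S n -> symb -> symb
  then fun e w => prepend e.1 (scons e.2 w) else fun _ w => w.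

Lemma prependE (n : nat) (e : word S n) (w : symb) (i : nat) :
  prepend e w (i + n)%N = w i.
Proof.
elim: n e w i => [|n IH] e w i /=; first by rewrite addn0.
by rewrite -addSnnS IH.
Qed.

Lemma prefix_prepend (n : nat) (e : word S n) (w : symb) (i : nat) :
  prefix_word (i + n) (prepend e w) = wcat e (prefix_word i w).
Proof.
elim: i => [|i IH] /=; last by rewrite IH prependE.
elim: n e w => [[]|n IH] //= [e x] w /=.
by rewrite IH; congr pair; rewrite -[X in prepend _ _ X]add0n prependE.
Qed.

Definition symb_rel (u w : symb) : Prop :=
  forall n, lends (prefix_word n u) :&: lends (prefix_word n w) != finset.set0.

(* The equivalence relation generated by [symb_rel]; for a non-degenerate
   system [symb_rel] is already transitive. *)
Definition symb_eq (u w : symb) : bool :=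
  `[< clos_refl_sym_trans _ symb_rel u w >].

Lemma symb_eq_refl : reflexive symb_eq.
Proof. by move=> u; apply/asboolP/rst_refl. Qed.

Lemma symb_eq_sym : symmetric symb_eq.
Proof. by move=> u w; apply/idP/idP => /asboolP h; apply/asboolP/rst_sym. Qed.

Lemma symb_eq_trans : transitive symb_eq.
Proof.
by move=> v u w /asboolP h1 /asboolP h2; apply/asboolP; exact: rst_trans h1 h2.
Qed.

Canonical symb_equiv :=
  EquivRel symb_eq symb_eq_refl symb_eq_sym symb_eq_trans.
End Symbolic.

(* The limit space X; the parameter [R] only serves to attach the topology of
   the [R]-valued metric [limdist] to the type. *)
Definition limspace (R : realType) (S : doubling_igs) : Type :=
  {eq_quot (symb_equiv S)}%qT.
HB.instance Definition _ R S := Choice.on (limspace R S).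
HB.instance Definition _ R S := EqQuotient.on (limspace R S).

Section LimitSpace.
Context (R : realType) (S : doubling_igs).
Local Notation X := (limspace R S).

Definition chi (w : symb S) : X := (\pi w)%qT.

HB.instance Definition _ := isPointed.Build X (chi point).

Definition limdist (x y : X) : R :=
  limn (fun n => inf [set ldist R v w |
    v in [set` lends (prefix_word n (repr x))] &
    w in [set` lends (prefix_word n (repr y))]]).

Definition limopen (A : set X) : Prop :=
  forall x, A x -> exists2 r : R, 0 < r & [set y | limdist x y < r] `<=` A.

Lemma limopenT : limopen setT.
Proof. by move=> x _; exists 1. Qed.

Lemma limopenI : setI_closed limopen.
Proof.
move=> A B oA oB x [/oA[r r0 rA] /oB[s s0 sB]].
exists (Num.min r s); first by rewrite lt_min r0.
by move=> y /=; rewrite lt_min => /andP[yr ys]; split; [exact: rA|exact: sB].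
Qed.

Lemma limopen_bigU (J : Type) (f : J -> set X) :
  (forall i, limopen (f i)) -> limopen (\bigcup_i f i).
Proof.
move=> of_ x [i _ /of_[r r0 rf]]; exists r => // y /rf; by exists i.
Qed.

(* The metric topology of [limdist], and its Borel sigma-algebra. *)
HB.instance Definition _ :=
  isOpenTopological.Build X limopenT limopenI limopen_bigU.

HB.instance Definition _ :=
  Measurable.copy X (g_sigma_algebraType (@open X)).

(* F_e *)
Definition Fmap (n : nat) (e : word S n) (x : X) : X :=
  chi (prepend e (repr x)).

(* X_e *)
Definition Xcell (n : nat) (e : word S n) : set X := range (Fmap e).

Definition mu : set X -> \bar R :=
  pushforward (product_measure (fun _ : letter S => (#|{: letter S}|%:R^-1 : R)))
    (chi : seqspace (letter S) -> X).

(* T_{v,e} *)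
Definition Tfib (n : nat) (v : lvert S n) (e : word S n) (a : nat -> lab S) :
    symb S :=
  xget point [set w : symb S | prefix_word n w = e /\
    forall m, vdots v a m \in lends (prefix_word (m + n) w)].

(* An edge containing [v]; [Fib] and [Jfib] do not depend on its choice. *)
Definition edge_at (n : nat) (v : lvert S n) : word S n :=
  xget (word0 S n) [set e | v \in lends e].

Definition Fib (n : nat) (v : lvert S n) : set X :=
  range (chi \o Tfib v (edge_at v)).

Definition Jfib (p : R) (n : nat) (v : lvert S n) : set X -> \bar R :=
  pushforward (product_measure (@Jlab R S p))
    (chi \o Tfib v (edge_at v) : seqspace (lab S) -> X).

(* V_n[f] *)
Definition Vavg (p : R) (n : nat) (f : X -> R) (v : lvert S n) : R :=
  fine (\int[Jfib p v]_(x in Fib v) (f x)%:E).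

(* The energy E_p on C(X). *)
Definition Ects (p : R) (f : X -> R) : \bar R :=
  limn (fun n => (Mp S p ^- n * energy (lpole (n := n)) p (Vavg p f))%:E).

Definition Ccts (p : R) : set (X -> R) :=
  [set f | continuous f /\ (Ects p f < +oo)%E].

Definition Lp (p : R) : set (X -> R) :=
  [set f : X -> R | measurable_fun [set: X] (f : X -> R) /\
           (\int[mu]_x (`|f x| `^ p)%:E < +oo)%E].

Definition approximates (p : R) (fs : nat -> X -> R) (f : X -> R) : Prop :=
  [/\ forall i, Ccts p (fs i),
      Ects p (fs ij.1 \- fs ij.2) @[ij --> (\oo, \oo)] --> 0%E
    & (\int[mu]_x (`|fs i x - f x| `^ p)%:E)%E @[i --> \oo] --> 0%E].

(* The energy on L^p(X, mu). *)
Definition Esob (p : R) (f : X -> R) : \bar R :=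
  xget +oo%E [set l | exists2 fs, approximates p fs f &
                        Ects p (fs i) @[i --> \oo] --> l].

Definition Fsob (p : R) : set (X -> R) :=
  [set f | Lp p f /\ (Esob p f < +oo)%E].

(* f_{X_e} *)
Definition cell_avg (n : nat) (e : word S n) (f : X -> R) : R :=
  (fine (mu (Xcell e)))^-1 * fine (\int[mu]_(x in Xcell e) (f x)%:E).

Definition supp_mu (u : X -> R) : set X :=
  \bigcap_(A in [set A | closed A /\ {ae mu, forall x, ~ A x -> u x = 0}]) A.
End LimitSpace.

Arguments Fmap R {S n} e x.
Arguments Xcell R {S n} e.
Arguments mu R S : clear implicits.

(* Main.v *)
(**
The edges of G_n are words, so X is a quotient of the symbolic space. By non-degeneracy, cells which
meet or are joined by an edge at every level come from identified sequences, and chains of cells at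
level n+1 project to chains at level n with an error O(L_*^-n). Hence d is a limit and induces the
quotient topology.

Let tau_s f be the integral of f over the fibre of v_s. Then V_n[f] at the end s of e is
tau_s (f o F_e), so that the level-n energy is M_p^-n sum_e |tau_+ (f o F_e) - tau_- (f o F_e)|^p.
Testing against the flow J_p = psi(c grad U_p), whose energy is M_p^(1-q), shows that it increases
with n, and the limit is self-similar: E(f) = M_p^-n sum_{|e|=n} E(f o F_e).

Poincare: writing f - tau_+ f on X_x as (f - tau_+ (f o F_x)) + (tau_+ (f o F_x) - tau_+ f) and using
self-similarity, the L^p oscillation at scale N+1 is at most 2^(p-1) times the mean of those at
scale N plus C E(f). Since sum_x E(f o F_x) = M_p E(f) and M_p <= 2^-p |E_1|, the factor of the
iteration is at most 1/2. The same decomposition gives |tau_s f|^p <= A |f|_p^p + eps E(f) for all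
eps > 0, hence closability, and the inequality passes to the closure.

Clarkson's inequalities hold edge by edge for the level energies, up to Minkowski's inequality for
the exponents p - 1 or 1 / (p - 1), and pass to the limit. For strong locality, compactness gives an
n such that on every cell of level n one of f and g is almost everywhere constant; there the
identity is trivial, and self-similarity sums it up.
*)

From HB Require Import structures.
From Stdlib Require Import Relation_Operators.
From Stdlib Require Eqdep_dec PeanoNat.
Require Import Defs.
From mathcomp Require Import all_boot all_order all_algebra.
From mathcomp Require Import all_classical all_reals all_analysis.
From mathcomp Require Import measurable_realfun.
From mathcomp Require Import ring lra zify.
Import Order.TTheory GRing.Theory Num.Theory.
Import numFieldNormedType.Exports.
Local Open Scope classical_set_scope.
Local Open Scope ring_scope.

Set Implicit Arguments.
Unset Strict Implicit.
Unset Printing Implicit Defensive.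

(** * Inequalities for powers *)

Section PowerInequalities.
Context {R : realType}.
Implicit Types (p q r s t x y a b : R).

(** The topology of X is given by the sets where [limdist x] is small, and [limdist] is evaluated on
    chosen representatives. Two estimates carry it over to sequences: a common prefix of length n
    keeps the distance at most 3 L^-n, and representatives whose n-th edges have no common end are
    at distance at least L^-n / 2. After that only cylinders occur, and compactness is Koenig's
    lemma on words.

    Functions in F_p have no values on fibres, so Poincare and Clarkson are proved for continuous
    functions of finite energy and carried along approximating sequences. For this the energy must
    be closable, and a trace estimate with a fixed constant is too weak: summed over the cells of
    level n, its L^p part is multiplied by (|E_1| / M_p)^n, while its energy part keeps its
    coefficient. Smallness can only come from that coefficient. It comes from the flow: a label a is
    seen on two distinct edges, at phi_+(a) and phi_-(a), both carrying J_p(a), so one side has at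
    most half of the flow energy. Passing to the boundary cells thus multiplies the energy
    coefficient by 2^(1-p) < 1, and iterating makes it as small as desired. *)

Lemma powR_convex p t x y : 1 <= p -> 0 <= t <= 1 -> 0 <= x -> 0 <= y ->
  (t * x + (1 - t) * y) `^ p <= t * x `^ p + (1 - t) * y `^ p.
Proof.
move=> p1 /andP[t0 t1] x0 y0.
have := @convex_powR R p p1 (Itv01 t0 t1) x y.
rewrite !inE /= !in_itv /= !andbT => /(_ x0 y0).
by rewrite !convRE.
Qed.

Lemma normD_powR p x y : 1 <= p ->
  `|x + y| `^ p <= 2 `^ (p - 1) * (`|x| `^ p + `|y| `^ p).
Proof.
move=> p1; have h01 : 0 <= (2^-1 : R) <= 1 by lra.
have := powR_convex p1 h01 (normr_ge0 x) (normr_ge0 y).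
have -> : 1 - 2^-1 = 2^-1 :> R by lra.
rewrite -!mulrDr powRM ?invr_ge0 ?addr_ge0// => h; have : `|x + y| `^ p <= (`|x| + `|y|) `^ p.
  by apply: ge0_ler_powR; rewrite ?nnegrE ?addr_ge0 ?ler_normD// (le_trans _ p1).
move/le_trans; apply.
have e : 2 `^ (p - 1) = 2 `^ p / 2 :> R by rewrite powRB ?powRr1 ?pnatr_eq0 ?implybT.
have h2 : 0 < 2 `^ p :> R by rewrite powR_gt0.
have : (2^-1)`^p = (2 `^ p)^-1 :> R.
  by rewrite -powR_inv1// powRAC powR_inv1 ?powR_ge0.
move=> e2; rewrite e2 in h; rewrite e -mulrA -ler_pdivrMl//.
Qed.

Lemma powR_root A p : 0 < A -> 0 < p ->
  exists al : R, [/\ 0 < al, al `^ p = A & A `^ p^-1 = al].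
Proof.
move=> A0 p0; exists (A `^ p^-1); split; [exact: powR_gt0| |exact: erefl].
by rewrite -powRrM mulVf ?gt_eqF// powRr1// ltW.
Qed.

(** Both sides are raised to the power [p], the form in which flows meet energies: no root of the
    energy appears. Young's inequality is summed after normalising [u] and [v]; a vanishing norm is
    treated apart. *)
Lemma hoelder_sum (I : finType) p (u v : I -> R) : 1 < p ->
  `|\sum_i u i * v i| `^ p <=
  (\sum_i `|u i| `^ (p / (p - 1))) `^ (p - 1) * \sum_i `|v i| `^ p.
Proof.
move=> p1; set q := p / (p - 1); set A := \sum_i `|u i| `^ q.
set B := \sum_i `|v i| `^ p.
have p0 : 0 < p by lra.
have pm0 : 0 < p - 1 by lra.
have q0 : 0 < q by rewrite divr_gt0.
have pq : q^-1 + p^-1 = 1 by rewrite /q invf_div; field; lra.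
have A0 : 0 <= A by apply: sumr_ge0 => i _; rewrite powR_ge0.
have B0 : 0 <= B by apply: sumr_ge0 => i _; rewrite powR_ge0.
have [A00|A00] := eqVneq A 0.
  rewrite big1 ?normr0 ?powR0 ?gt_eqF// ?mulr_ge0 ?powR_ge0// => i _.
  have /eqP := A00; rewrite psumr_eq0 => [|j _]; last exact: powR_ge0.
  by move=> /allP/(_ i); rewrite mem_index_enum /= powR_eq0 normr_eq0 => /(_ isT)/andP[/eqP-> _]; rewrite mul0r.
have [B00|B00] := eqVneq B 0.
  rewrite big1 ?normr0 ?powR0 ?gt_eqF// ?mulr_ge0 ?powR_ge0// => i _.
  have /eqP := B00; rewrite psumr_eq0 => [|j _]; last exact: powR_ge0.
  by move=> /allP/(_ i); rewrite mem_index_enum /= powR_eq0 normr_eq0 => /(_ isT)/andP[/eqP-> _]; rewrite mulr0.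
have {A00}A1 : 0 < A by rewrite lt_def A00.
have {B00}B1 : 0 < B by rewrite lt_def B00.
have [al [al0 alq alE]] := powR_root A1 q0.
have [be [be0 beq beE]] := powR_root B1 p0.
have key : \sum_i `|u i| * `|v i| <= al * be.
  rewrite -[leRHS]mulr1 -ler_pdivrMl ?mulr_gt0// mulr_sumr -pq.
  have -> : q^-1 + p^-1 = \sum_i ((`|u i| / al) `^ q / q + (`|v i| / be) `^ p / p).
    rewrite big_split /= -!mulr_suml; congr (_ + _).
      under eq_bigr => i _ do rewrite powRM ?invr_ge0 ?(ltW al0)// -powR_inv1 ?(ltW al0)// powRAC powR_inv1 ?powR_ge0// alq.
      by rewrite -mulr_suml mulfV ?gt_eqF// mul1r.
    under eq_bigr => i _ do rewrite powRM ?invr_ge0 ?(ltW be0)// -powR_inv1 ?(ltW be0)// powRAC powR_inv1 ?powR_ge0// beq.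
    by rewrite -mulr_suml mulfV ?gt_eqF// mul1r.
  apply: ler_sum => i _.
  have -> : (al * be)^-1 * (`|u i| * `|v i|) = (`|u i| / al) * (`|v i| / be).
    by rewrite invfM; ring.
  by apply: conjugate_powR; rewrite ?divr_ge0 ?(ltW al0) ?(ltW be0).
have /le_trans h : `|\sum_i u i * v i| <= al * be.
  apply: le_trans (ler_norm_sum _ _ _) _.
  by under eq_bigr => i _ do rewrite normrM.
apply: (@le_trans _ _ ((al * be) `^ p)).
  by apply: ge0_ler_powR; rewrite ?nnegrE ?mulr_ge0 ?(ltW al0) ?(ltW be0) ?(ltW p0)//; exact: h.
rewrite powRM ?(ltW al0) ?(ltW be0)// beq -alE -powRrM /q invf_div.
by rewrite divfK ?(gt_eqF p0).
Qed.

Lemma minkowski_sum (I : finType) p (u v : I -> R) : 1 <= p ->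
  (forall i, 0 <= u i) -> (forall i, 0 <= v i) ->
  \sum_i (u i + v i) `^ p <=
  ((\sum_i u i `^ p) `^ p^-1 + (\sum_i v i `^ p) `^ p^-1) `^ p.
Proof.
move=> p1 u0 v0; have p0 : 0 < p by lra.
set A := \sum_i u i `^ p; set B := \sum_i v i `^ p.
have A0 : 0 <= A by apply: sumr_ge0 => i _; rewrite powR_ge0.
have B0 : 0 <= B by apply: sumr_ge0 => i _; rewrite powR_ge0.
have zero (w : I -> R) : \sum_i w i `^ p = 0 -> forall i, w i = 0.
  move=> /eqP; rewrite psumr_eq0 => [|j _]; last exact: powR_ge0.
  by move=> /allP h i; have := h i; rewrite mem_index_enum powR_eq0 => /(_ isT)/andP[/eqP].
have [A00|A00] := eqVneq A 0.
  rewrite A00 powR0 ?invr_neq0 ?gt_eqF// add0r -powRrM mulVf ?gt_eqF// powRr1//.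
  by under eq_bigr => i _ do rewrite (zero _ A00) add0r.
have [B00|B00] := eqVneq B 0.
  rewrite B00 powR0 ?invr_neq0 ?gt_eqF// addr0 -powRrM mulVf ?gt_eqF// powRr1//.
  by under eq_bigr => i _ do rewrite (zero _ B00) addr0.
have A1 : 0 < A by rewrite lt_def A00 A0.
have B1 : 0 < B by rewrite lt_def B00 B0.
have [al [al0 alp alE]] := powR_root A1 p0.
have [be [be0 bep beE]] := powR_root B1 p0.
rewrite alE beE.
have s0 : 0 < al + be by rewrite addr_gt0.
(* With these weights the convex combination of [u i / al] and [v i / be] is
   [(u i + v i) / (al + be)]. *)
pose t := al / (al + be).
have t01 : 0 <= t <= 1.
  by rewrite /t divr_ge0 ?(ltW al0) ?(ltW s0)//= ler_pdivrMr// mul1r lerDl (ltW be0).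
have t1 : 1 - t = be / (al + be).
  by rewrite /t -[X in X - _](mulfV (lt0r_neq0 s0)) -mulrBl addrAC subrr add0r.
have div (x c : R) : 0 < c -> 0 <= x -> (x / c) `^ p = x `^ p / c `^ p.
  move=> c0 x0; rewrite powRM ?invr_ge0 ?(ltW c0)//.
  by rewrite -[c^-1]powR_inv1 ?(ltW c0)// powRAC powR_inv1 ?powR_ge0.
have h i : (u i + v i) `^ p <= (al + be) `^ p * (t * (u i / al) `^ p + (1 - t) * (v i / be) `^ p).
  have := powR_convex p1 t01 (divr_ge0 (u0 i) (ltW al0)) (divr_ge0 (v0 i) (ltW be0)).
  have -> : t * (u i / al) + (1 - t) * (v i / be) = (u i + v i) / (al + be).
    by rewrite t1 /t; field; rewrite !lt0r_neq0.
  rewrite (div (u i + v i)) ?addr_ge0// => h.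
  by rewrite mulrC -ler_pdivrMr// powR_gt0.
apply: le_trans (ler_sum _ (fun i _ => h i)) _.
rewrite -mulr_sumr big_split /= -!mulr_sumr.
under eq_bigr => i _ do rewrite div//.
under [X in _ * (_ + _ * X)]eq_bigr => i _ do rewrite div//.
rewrite -!mulr_suml alp bep !mulfV// !mulr1.
by rewrite addrCA subrr addr0 mulr1.
Qed.

(** The function interpolates between the two sides of the scalar inequality: it is (1 + y)^p + (1 -
    y)^p at a = 1, and at a = y^(1/(p-1)), where a^(1-p) y = 1, it is the Clarkson bound. The
    derivative is factored so that its sign can be read off. *)
Lemma clarkson_derive p y : 1 < p -> 0 < y < 1 ->
  forall a, 0 < a -> a <= 1 -> is_derive a 1
  (fun a => (1 + a `^ (1 - p) * y) * (1 + a * y) `^ (p - 1)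
          + (1 - a `^ (1 - p) * y) * (1 - a * y) `^ (p - 1))
  ((p - 1) * y * (1 - a `^ (- p)) *
     ((1 + a * y) `^ (p - 1 - 1) - (1 - a * y) `^ (p - 1 - 1))).
Proof.
move=> p1 /andP[y0 y1] a a0 a1.
have pos1 : 0 < 1 + a * y by rewrite addr_gt0// mulr_gt0.
have pos2 : 0 < 1 - a * y by rewrite subr_gt0 (le_lt_trans _ y1)// ler_piMl// ltW.
have dl (c : R) : 0 < 1 + c * a ->
  is_derive a 1 (fun a => (1 + c * a) `^ (p - 1)) ((p - 1) * (1 + c * a) `^ (p - 1 - 1) * c).
  move=> ca.
  have h1 : is_derive a 1 (fun a : R => 1 + c * a) c.
    have hc : is_derive a 1 (fun a : R => c *: a) (c *: 1) by exact: is_deriveZ.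
    have := is_deriveD (is_derive_cst (1 : R) a (1 : R)) hc.
    by rewrite add0r /GRing.scale /= mulr1.
  have := @is_derive1_comp R (fun b => b `^ (p - 1)) (fun a => 1 + c * a) a _ _ (is_derive1_powR (p - 1) ca) h1.
  by rewrite /comp /= /GRing.scale /= [c * _]mulrC.
have da (c : R) : is_derive a 1 (fun a => 1 + c * a `^ (1 - p)) (c * ((1 - p) * a `^ (1 - p - 1))).
  have h2 := @is_derive1_powR R (1 - p) a a0.
  have hc : is_derive a 1 (fun a : R => c *: a `^ (1 - p)) (c *: ((1 - p) * a `^ (1 - p - 1))) by exact: is_deriveZ.
  have := is_deriveD (is_derive_cst (1 : R) a (1 : R)) hc.
  by rewrite add0r.
have pos1' : 0 < 1 + y * a by rewrite mulrC.
have pos2' : 0 < 1 + (- y) * a by rewrite mulNr mulrC.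
have H := is_deriveD (is_deriveM (da y) (dl y pos1')) (is_deriveM (da (- y)) (dl (- y) pos2')).
have e1 : a `^ (1 - p - 1) = a `^ (- p) by congr (_ `^ _); lra.
have e2 : a `^ (1 - p) = a * a `^ (- p).
  by rewrite powRD ?powRr1 ?(ltW a0)// (gt_eqF a0) implybT.
have e3 : (1 + y * a) `^ (p - 1) = (1 + y * a) * (1 + y * a) `^ (p - 1 - 1).
  by rewrite mulr_powRB1//; [exact: ltW|lra].
have e4 : (1 + - y * a) `^ (p - 1) = (1 + - y * a) * (1 + - y * a) `^ (p - 1 - 1).
  by rewrite mulr_powRB1//; [exact: ltW|lra].
apply: is_derive_eq.
  have -> : (fun a0 : R => (1 + a0 `^ (1 - p) * y) * (1 + a0 * y) `^ (p - 1) + (1 - a0 `^ (1 - p) * y) * (1 - a0 * y) `^ (p - 1))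
    = ((fun a => 1 + y * a `^ (1 - p)) * (fun a => (1 + y * a) `^ (p - 1)) + (fun a => 1 + - y * a `^ (1 - p)) * (fun a => (1 + - y * a) `^ (p - 1)))%R.
    by apply/funext => b; rewrite !fctE (mulrC (b `^ _) y) (mulrC b y) !mulNr.
  exact: H.
rewrite /GRing.scale /= e1 e2 e3 e4.
have -> : 1 - a * y = 1 + - y * a by ring.
have -> : 1 + a * y = 1 + y * a by ring.
ring.
Qed.

(** On [[a0, 1]] the factor 1 - a^(-p) is nonpositive, and the difference of the powers p - 2 of 1 +
    a y and 1 - a y has the sign of p - 2. So the interpolating function is monotone, in a direction
    decided by the sign of p - 2. *)
Lemma clarkson_scalar_lt1 p y : 1 < p -> 0 < y < 1 ->
  (p <= 2 -> 2 * (1 + y `^ (p / (p - 1))) `^ (p - 1) <= (1 + y) `^ p + (1 - y) `^ p) /\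
  (2 <= p -> (1 + y) `^ p + (1 - y) `^ p <= 2 * (1 + y `^ (p / (p - 1))) `^ (p - 1)).
Proof.
move=> p1 y01; case/andP: (y01) => y0 y1.
have p0 : 0 < p by lra.
have pm0 : 0 < p - 1 by lra.
pose F a := (1 + a `^ (1 - p) * y) * (1 + a * y) `^ (p - 1)
          + (1 - a `^ (1 - p) * y) * (1 - a * y) `^ (p - 1).
pose a0 := y `^ (p - 1)^-1.
have a00 : 0 < a0 by exact: powR_gt0.
have a01 : a0 <= 1.
  rewrite /a0 -[leRHS](powRr0 y); apply: ger_powR; first by rewrite y0 ltW.
  by rewrite invr_ge0 ltW.
have Fa0 : F a0 = 2 * (1 + y `^ (p / (p - 1))) `^ (p - 1).
  have e1 : a0 `^ (1 - p) * y = 1.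
    rewrite /a0 -powRrM.
    have -> : (p - 1)^-1 * (1 - p) = - 1 by field; lra.
    by rewrite powR_inv1 ?(ltW y0)// mulVf// gt_eqF.
  have e2 : a0 * y = y `^ (p / (p - 1)).
    have -> : p / (p - 1) = (p - 1)^-1 + 1 by field; lra.
    by rewrite powRD ?powRr1 ?(ltW y0)// (gt_eqF y0) implybT.
  by rewrite /F e1 e2 subrr mul0r addr0.
have F1 : F 1 = (1 + y) `^ p + (1 - y) `^ p.
  rewrite /F powR1 !mul1r !mulr_powRB1//; lra.
have dF a : 0 < a -> a <= 1 -> is_derive a 1 F ((p - 1) * y * (1 - a `^ (- p)) *
     ((1 + a * y) `^ (p - 1 - 1) - (1 - a * y) `^ (p - 1 - 1))).
  by move=> ha h1; exact: clarkson_derive.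
have cF : {within `[a0, 1], continuous F}.
  apply: derivable_within_continuous => a; rewrite in_itv/= => /andP[h1 h2].
  by have [] := dF a (lt_le_trans a00 h1) h2.
have itvP a : a \in `]a0, 1[ -> 0 < a < 1.
  by rewrite in_itv/= => /andP[h1 ->]; rewrite (lt_trans a00 h1).
have drv a : a \in `]a0, 1[ -> derivable F a 1.
  by move=> /itvP/andP[h1 h2]; have [] := dF a h1 (ltW h2).
have aNp a : 0 < a < 1 -> 1 - a `^ (- p) <= 0.
  move=> /andP[h1 h2]; rewrite subr_le0 powRN invf_ge1 ?powR_gt0//.
  by rewrite -(powRr0 a); apply: ger_powR; rewrite ?h1 ltW.
have pos a : 0 < a < 1 -> (0 < 1 - a * y) && (1 - a * y <= 1 + a * y).
  move=> /andP[h1 h2]; have : 0 < a * y by rewrite mulr_gt0.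
  have : a * y < 1 by rewrite (lt_le_trans _ (ltW y1)) ?gtr_pMl.
  lra.
split=> p2.
  rewrite -Fa0 -F1; apply: (ger0_derive1_ndecr drv _ cF) => // a /itvP a01'.
  have /andP[h1 h2] := a01'.
  rewrite derive1E (@derive_val _ _ _ _ _ _ _ (dF a h1 (ltW h2))).
  rewrite -mulrA mulr_ge0 ?(mulr_ge0 (ltW pm0) (ltW y0))//.
  rewrite mulr_le0 ?aNp// subr_le0.
  have /andP[h3 h4] := pos a a01'.
  have e : p - 1 - 1 = - (2 - p) by lra.
  rewrite e !powRN lef_pV2 ?posrE ?powR_gt0 ?(lt_le_trans h3)//.
  by apply: ge0_ler_powR; rewrite ?nnegrE ?(ltW h3) ?(le_trans (ltW h3) h4)//; lra.
rewrite -Fa0 -F1; apply: (ler0_derive1_nincr drv _ cF) => // a /itvP a01'.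
have /andP[h1 h2] := a01'.
rewrite derive1E (@derive_val _ _ _ _ _ _ _ (dF a h1 (ltW h2))).
rewrite -mulrA mulr_ge0_le0 ?(mulr_ge0 (ltW pm0) (ltW y0))//.
rewrite mulr_le0_ge0 ?aNp// subr_ge0.
have /andP[h3 h4] := pos a a01'.
by apply: ge0_ler_powR; rewrite ?nnegrE ?(ltW h3) ?(le_trans (ltW h3) h4)//; lra.
Qed.

(** Both sides are homogeneous of degree [p] and invariant under exchanging [a] and [b] and under
    changing the sign of [b], which reduces the claim to ratios [b / a] in [0, 1]. At the ratios 0
    and 1 equality holds. *)
Lemma clarkson_scalar p a b : 1 < p ->
  (p <= 2 -> 2 * (`|a| `^ (p / (p - 1)) + `|b| `^ (p / (p - 1))) `^ (p - 1)
     <= `|a + b| `^ p + `|a - b| `^ p) /\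
  (2 <= p -> `|a + b| `^ p + `|a - b| `^ p
     <= 2 * (`|a| `^ (p / (p - 1)) + `|b| `^ (p / (p - 1))) `^ (p - 1)).
Proof.
move=> p1.
have p0 : 0 < p by lra.
have pm0 : 0 < p - 1 by lra.
have q0 : 0 < p / (p - 1) by rewrite divr_gt0.
have qp : p / (p - 1) * (p - 1) = p by rewrite divfK// gt_eqF.
wlog ab : a b / `|b| <= `|a|.
  move=> h; have [ab|/ltW ab] := leP `|b| `|a|; first exact: h.
  have := h b a ab; rewrite (addrC b a) (distrC b a).
  by rewrite (addrC (`|b| `^ (p / (p - 1)))).
have [a0|a0] := eqVneq a 0.
  move: ab; rewrite a0 normr0 normr_le0 => /eqP ->.
  by rewrite addr0 subr0 normr0 !powR0 ?gt_eqF// addr0 powR0 ?gt_eqF// mulr0 addr0; split.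
have na : 0 < `|a| by rewrite normr_gt0.
wlog ab0 : b ab / 0 <= b / a.
  move=> h; have [ba|/ltW ba] := leP 0 (b / a); first exact: h.
  have := h (- b); rewrite normrN opprK [X in _ -> _ -> (_ -> _ <= X) /\ _]addrC.
  rewrite [`|a - b| `^ p + _]addrC; apply => //.
  by rewrite mulNr oppr_ge0.
pose y := b / a.
have yE : y = `|b| / `|a| by rewrite -normf_div ger0_norm.
have y1 : y <= 1 by rewrite yE ler_pdivrMr// mul1r.
have e1 : `|a + b| = `|a| * (1 + y).
  rewrite -[1 + y]ger0_norm ?addr_ge0// -normrM; congr `| _ |; rewrite /y; field; exact: a0.
have e2 : `|a - b| = `|a| * (1 - y).
  rewrite -[1 - y]ger0_norm ?subr_ge0// -normrM; congr `| _ |; rewrite /y; field; exact: a0.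
have e3 : `|b| = `|a| * y by rewrite yE mulrC divfK// gt_eqF.
have e4 : (`|a| `^ (p / (p - 1)) + `|b| `^ (p / (p - 1))) `^ (p - 1) = `|a| `^ p * (1 + y `^ (p / (p - 1))) `^ (p - 1).
  rewrite e3 powRM// -[X in X + _]mulr1 -mulrDr powRM ?powR_ge0 ?addr_ge0 ?powR_ge0//.
  by rewrite -powRrM qp.
have e5 : `|a + b| `^ p = `|a| `^ p * (1 + y) `^ p by rewrite e1 powRM ?addr_ge0.
have e6 : `|a - b| `^ p = `|a| `^ p * (1 - y) `^ p by rewrite e2 powRM ?subr_ge0.
rewrite e4 e5 e6 -mulrDr mulrCA !ler_pM2l ?powR_gt0//.
have [y00|y00] := eqVneq y 0.
  rewrite y00 addr0 subr0 (powR0 (lt0r_neq0 q0)) addr0 !powR1 mulr1.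
  by clear; split; lra.
have [y11|y11] := eqVneq y 1.
  rewrite y11 subrr !powR1 (powR0 (lt0r_neq0 p0)) addr0.
  rewrite -[1 + 1]/(2%:R).
  by rewrite mulr_powRB1//; split.
apply: clarkson_scalar_lt1 => //.
by rewrite !lt_def y00 ab0 eq_sym y11 y1.
Qed.

Lemma clarkson_sum_le2 (I : finType) p (u v : I -> R) : 1 < p -> p <= 2 ->
  2 * ((\sum_i `|u i| `^ p) `^ (p - 1)^-1 + (\sum_i `|v i| `^ p) `^ (p - 1)^-1) `^ (p - 1)
  <= \sum_i `|u i + v i| `^ p + \sum_i `|u i - v i| `^ p.
Proof.
move=> p1 p2; have pm0 : 0 < p - 1 by lra.
set s := p - 1; have r1 : 1 <= s^-1 by rewrite invf_ge1 /s//; lra.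
pose A := \sum_i `|u i| `^ p; pose B := \sum_i `|v i| `^ p.
have mink (J : finType) (x y : J -> R) : (forall i, 0 <= x i) -> (forall i, 0 <= y i) ->
  ((\sum_i x i) `^ s^-1 + (\sum_i y i) `^ s^-1) `^ s <= \sum_i (x i `^ s^-1 + y i `^ s^-1) `^ s.
  move=> x0 y0.
  have s0 : s != 0 by rewrite gt_eqF.
  (* Triangle inequality in the plane for the norm of exponent [s^-1 >= 1], applied to the vectors
     (a, b) and (c, d). *)
  have tri (a b c d : R) : 0 <= a -> 0 <= b -> 0 <= c -> 0 <= d ->
      ((a + c) `^ s^-1 + (b + d) `^ s^-1) `^ s
      <= (a `^ s^-1 + b `^ s^-1) `^ s + (c `^ s^-1 + d `^ s^-1) `^ s.
    move=> a0 b0 c0 d0.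
    have := @minkowski_sum bool s^-1 (fun i => if i then a else b) (fun i => if i then c else d) r1.
    rewrite !big_bool invrK => h; have {}h := h (ltac:(by case)) (ltac:(by case)).
    have := ge0_ler_powR (ltW pm0) _ _ h; rewrite !nnegrE !addr_ge0 ?powR_ge0//.
    by rewrite -[X in _ <= X]powRrM mulVf// powRr1 ?addr_ge0 ?powR_ge0//; apply.
  suff [] : [/\ ((\sum_i x i) `^ s^-1 + (\sum_i y i) `^ s^-1) `^ s <= \sum_i (x i `^ s^-1 + y i `^ s^-1) `^ s,
     0 <= \sum_i x i & 0 <= \sum_i y i] by [].
  elim: (index_enum J) => [|j l [IH xl yl]].
    by rewrite !big_nil !powR0 ?invr_eq0// addr0 powR0.
  rewrite !big_cons; split; rewrite ?addr_ge0//.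
  by apply: le_trans (tri _ _ _ _ _ _ _ _) _; rewrite ?lerD2l.
rewrite -big_split /=.
apply: le_trans (ler_sum _ (fun i _ => (clarkson_scalar (u i) (v i) p1).1 p2)).
rewrite -mulr_sumr ler_pM2l//.
have e z : z `^ (p / (p - 1)) = (z `^ p) `^ s^-1 by exact: powRrM.
under [leRHS]eq_bigr => i _ do rewrite !e.
by apply: (mink I (fun i => `|u i| `^ p) (fun i => `|v i| `^ p)) => i; exact: powR_ge0.
Qed.

Lemma clarkson_sum_ge2 (I : finType) p (u v : I -> R) : 2 <= p ->
  \sum_i `|u i + v i| `^ p + \sum_i `|u i - v i| `^ p <=
  2 * ((\sum_i `|u i| `^ p) `^ (p - 1)^-1 + (\sum_i `|v i| `^ p) `^ (p - 1)^-1) `^ (p - 1).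
Proof.
move=> p2; have p1 : 1 < p by lra.
have s1 : 1 <= p - 1 by lra.
rewrite -big_split /=.
apply: le_trans (ler_sum _ (fun i _ => (clarkson_scalar (u i) (v i) p1).2 p2)) _.
rewrite -mulr_sumr ler_pM2l//.
have e (x : R) : (x `^ (p / (p - 1))) `^ (p - 1) = x `^ p.
  by rewrite -powRrM divfK//; lra.
under [X in _ <= (X `^ _ + _) `^ _]eq_bigr => i _ do rewrite -e.
under [X in _ <= (_ + X `^ _) `^ _]eq_bigr => i _ do rewrite -e.
by apply: minkowski_sum => // i; exact: powR_ge0.
Qed.
End PowerInequalities.

(** * Signed powers, tangent inequalities and minimizers on boxes *)

Section ContinuityOfPowers.
Context {R : realType}.

Lemma continuous_norm_powR (r : R) : 0 < r -> continuous (fun x : R => `|x| `^ r).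
Proof.
move=> r0 x; have [->|x0] := eqVneq x 0.
  apply/cvgrPdist_lt => e e0; rewrite normr0 powR0 ?gt_eqF//.
  have d0 : 0 < e `^ r^-1 by rewrite powR_gt0.
  have : \forall y \near (0 : R), `|y| < e `^ r^-1.
    by exists (e `^ r^-1) => // y; rewrite /ball_ /= sub0r normrN.
  apply: filterS => y hy; rewrite sub0r normrN ger0_norm ?powR_ge0//.
  have -> : e = (e `^ r^-1) `^ r by rewrite -powRrM mulVf ?gt_eqF// powRr1// ltW.
  by apply: gt0_ltr_powR => //; rewrite ?nnegrE ?powR_ge0.
have nx : 0 < `|x| by rewrite normr_gt0.
apply: (@continuous_comp _ _ _ (fun x : R => `|x|) (fun y => y `^ r)).
  exact: norm_continuous.
apply: differentiable_continuous; apply/derivable1_diffP.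
by apply: derivable_powR; rewrite in_itv/= andbT.
Qed.

(** The odd power sgn(x) |x|^r. Written through the positive and negative parts it is a difference
    of continuous functions, and 0 needs no separate treatment. *)
Definition spow (r x : R) : R := `|Num.max x 0| `^ r - `|Num.max (- x) 0| `^ r.

Lemma spow_ge0 r x : 0 < r -> 0 <= x -> spow r x = x `^ r.
Proof.
move=> r0 x0; rewrite /spow max_l// max_r ?oppr_le0// normr0 powR0 ?gt_eqF// subr0.
by rewrite ger0_norm.
Qed.

Lemma spowN r x : spow r (- x) = - spow r x.
Proof. by rewrite /spow opprK opprB. Qed.

Lemma norm_spow r x : 0 < r -> `|spow r x| = `|x| `^ r.
Proof.
move=> r0; have [x0|x0] := leP 0 x; first by rewrite spow_ge0// ger0_norm ?powR_ge0// ger0_norm.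
rewrite -[x]opprK spowN !normrN spow_ge0// ?oppr_ge0 ?(ltW x0)//.
by rewrite ger0_norm ?powR_ge0// ltr0_norm.
Qed.

Lemma spow_mul r x : 0 < r -> spow r x * x = `|x| `^ (r + 1).
Proof.
move=> r0; have h (y : R) : 0 <= y -> spow r y * y = `|y| `^ (r + 1).
  move=> y0; rewrite spow_ge0// ger0_norm// [r + 1]addrC -{2}[y]powRr1//.
  have [->|y1] := eqVneq y 0.
    by rewrite powRr1// mulr0 powR0// gt_eqF// ltr_wpDl.
  by rewrite -powRD ?y1 ?implybT// addrC.
have [x0|x0] := leP 0 x; first exact: h.
by rewrite -[x]opprK spowN mulrNN normrN h// oppr_ge0 ltW.
Qed.

Lemma continuous_spow r : 0 < r -> continuous (spow r).
Proof.
move=> r0 x; apply: cvgB.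
  apply: (@continuous_comp _ _ _ (fun x : R => Num.max x 0) (fun y => `|y| `^ r)).
    by apply: continuous_max; [exact: cvg_id|exact: cvg_cst].
  exact: continuous_norm_powR.
apply: (@continuous_comp _ _ _ (fun x : R => Num.max (- x) 0) (fun y => `|y| `^ r)).
  by apply: continuous_max; [apply: cvgN; exact: cvg_id|exact: cvg_cst].
exact: continuous_norm_powR.
Qed.

Lemma spow_lt r x y : 0 < r -> x < y -> spow r x < spow r y.
Proof.
move=> r0 xy; have h (a b : R) : 0 <= a -> a < b -> spow r a < spow r b.
  move=> a0 ab; rewrite !spow_ge0// ?(le_trans a0 (ltW ab))//.
  by apply: gt0_ltr_powR; rewrite ?nnegrE// (le_trans a0 (ltW ab)).
have [x0|x0] := leP 0 x; first exact: h.
have [y0|y0] := ltP 0 y.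
  apply: (@lt_trans _ _ 0).
    by rewrite -[x]opprK spowN oppr_lt0 spow_ge0 ?powR_gt0 ?oppr_gt0 ?oppr_ge0// ltW.
  by rewrite spow_ge0 ?powR_gt0// ltW.
by rewrite -[x]opprK -[y]opprK !(spowN _ (- _)) ltrN2 h ?oppr_ge0// ltrN2.
Qed.

Lemma spowK r x : 0 < r -> spow r^-1 (spow r x) = x.
Proof.
move=> r0; have h (y : R) : 0 <= y -> spow r^-1 (spow r y) = y.
  move=> y0; rewrite (spow_ge0 r0 y0) spow_ge0 ?powR_ge0 ?invr_gt0//.
  by rewrite -powRrM mulfV ?gt_eqF// powRr1.
have [x0|x0] := leP 0 x; first exact: h.
by rewrite -[x]opprK !(spowN _ (- _)) spowN h// oppr_ge0 ltW.
Qed.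

(** The tangent of |.|^p at [x], with slope [p * spow (p - 1) x]. It is Young's inequality for |y|
    and |x|^(p-1), so nothing is differentiated. *)
Lemma powR_tangent (p x y : R) : 1 < p ->
  `|x| `^ p + p * spow (p - 1) x * (y - x) <= `|y| `^ p.
Proof.
move=> p1; have p0 : 0 < p by lra.
have pm0 : 0 < p - 1 by lra.
have := @conjugate_powR R `|y| (`|x| `^ (p - 1)) p (p / (p - 1)).
have -> : p^-1 + (p / (p - 1))^-1 = 1 by rewrite invf_div; field; lra.
rewrite -powRrM mulrCA mulfV ?gt_eqF// mulr1 => /(_ (normr_ge0 _) (powR_ge0 _ _) p0).
rewrite divr_gt0// => /(_ isT erefl) h.
have e : p * spow (p - 1) x * (y - x) = p * (spow (p - 1) x * y) - p * `|x| `^ p.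
  by rewrite mulrBr -!mulrA (spow_mul _ pm0) subrK.
have : spow (p - 1) x * y <= `|y| * `|x| `^ (p - 1).
  by rewrite (le_trans (ler_norm _))// normrM norm_spow// mulrC.
move/le_trans/(_ h); rewrite -(ler_pM2l p0) mulrDr [X in _ <= X + _]mulrCA mulfV ?gt_eqF// mulr1 => h2.
have e2 : p * (`|x| `^ p / (p / (p - 1))) = (p - 1) * `|x| `^ p.
  by field; rewrite !gt_eqF.
rewrite e2 in h2; rewrite e.
move: h2; set a := _ * (spow _ _ * _); set b := `|x| `^ p; set c := `|y| `^ p.
by clearbody a b c; clear => h2; lra.
Qed.

(** Two tangents are used, from [x] to the midpoint [m] and from [m] to [y]. Since [spow] is
    strictly increasing, the slope at [m] strictly improves on the slope at [x] in the second
    half. *)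
Lemma powR_tangent_lt (p x y : R) : 1 < p -> x != y ->
  `|x| `^ p + p * spow (p - 1) x * (y - x) < `|y| `^ p.
Proof.
move=> p1 xy; have p0 : 0 < p by lra.
have pm0 : 0 < p - 1 by lra.
pose m := (x + y) / 2.
apply: lt_le_trans (powR_tangent m y p1).
have := powR_tangent x m p1.
have -> : y - m = (y - x) / 2 by rewrite /m; field.
have -> : m - x = (y - x) / 2 by rewrite /m; field.
move=> h; apply: lt_le_trans (lerD h (lexx _)).
rewrite -addrA ltrD2l -subr_gt0.
have -> : p * spow (p - 1) x * ((y - x) / 2) + p * spow (p - 1) m * ((y - x) / 2)
          - p * spow (p - 1) x * (y - x)
        = p / 2 * ((spow (p - 1) m - spow (p - 1) x) * (y - x)) by field.
rewrite mulr_gt0 ?divr_gt0//.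
have [lxy|lyx|/eqP] := ltgtP x y; last by rewrite (negPf xy).
  rewrite mulr_gt0 ?subr_gt0// spow_lt// /m; lra.
rewrite nmulr_rgt0 ?subr_lt0// spow_lt// /m; lra.
Qed.

(** Boundary values are imposed by taking [lo v = hi v]. The box is compact by Tychonoff's theorem,
    which stands in for coercivity. *)
Lemma box_minimizer (V E : finType) (a b : E -> V) (lo hi : V -> R) (p : R) :
  0 < p -> (forall v, lo v <= hi v) ->
  exists U : V -> R, (forall v, lo v <= U v <= hi v) /\
    forall U', (forall v, lo v <= U' v <= hi v) ->
    \sum_e `|U (a e) - U (b e)| `^ p <= \sum_e `|U' (a e) - U' (b e)| `^ p.
Proof.
move=> p0 lohi.
pose T := prod_topology (fun _ : V => R : topologicalType).
pose A : set T := [set f | forall v, `[lo v, hi v]%classic (f v)].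
have cA : compact A 
  by apply: (@tychonoff V (fun=> R) (fun v => `[lo v, hi v]%classic)) => v; exact: segment_compact.
have A0 : A !=set0 by exists lo => v; rewrite /= in_itv/= lexx lohi.
pose F (f : T) : R := \sum_e `|f (a e) - f (b e)| `^ p.
have cp v : continuous (fun f : T => f v) by exact: (@proj_continuous V (fun=> R) v).
have cF : continuous F.
  apply: continuous_big => [|e _ f]; first by move=> x; exact: add_continuous.
  apply: (@continuous_comp _ _ _ (fun f : T => f (a e) - f (b e)) (fun y => `|y| `^ p)).
    exact: (@continuousB R R T (fun f => f (a e)) (fun f => f (b e)) f (cp (a e) f) (cp (b e) f)).
  exact: continuous_norm_powR.
have [U /[!inE] AU Umin] := compact_EVT_min A0 cA (continuous_subspaceT cF).
exists U; split => [v|U' hU']; first by have := AU v; rewrite /= in_itv.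
by apply: (Umin U'); rewrite inE => v /=; rewrite in_itv/=.
Qed.
End ContinuityOfPowers.

Lemma clamp_dist (R : realType) (x y : R) :
  `|Num.max 0 (Num.min 1 x) - Num.max 0 (Num.min 1 y)| <= `|x - y|.
Proof.
wlog xy : x y / x <= y.
  by move=> h; case: (leP x y) => [/h//|/ltW/h]; rewrite distrC [leRHS]distrC.
rewrite !(distrC _ y) (distrC (Num.max 0 (Num.min 1 x))).
have m1 : Num.max 0 (Num.min 1 x) <= Num.max 0 (Num.min 1 y).
  by rewrite le_max2 ?le_min2.
rewrite !ger0_norm ?subr_ge0//.
rewrite !minEle !maxEle; do !case: ifPn; rewrite -?ltNge; clear m1; lra.
Qed.

(** * The generator: potentials and flows *)

Section GeneratorCombinatorics.
Context (S : doubling_igs).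
Local Notation V1 := (vert (gen S)).
Local Notation E1 := (edge (gen S)).
Local Notation ends1 := (@ends (gen S)).

Lemma gpole_neq (e : E1) s : gpole (~~ s) e != gpole s e.
Proof.
have := ends_card e; rewrite ends_gpole cards2.
by case: s => /=; rewrite 1?eq_sym; case: eqP.
Qed.

Lemma gpole_inj (e : E1) s t : gpole s e = gpole t e -> s = t.
Proof.
move=> st; apply/eqP; apply: contraPT st => /negbTE.
by have /eqP := gpole_neq e t; case: s t => [] [] //= /nesym.
Qed.

Lemma ends_pole (e : E1) v : (v \in ends e) = [exists s, gpole s e == v].
Proof.
rewrite ends_gpole !inE; apply/idP/existsP => [/orP[]/eqP->|[[] /eqP<-]].
- by exists true.
- by exists false.
- by rewrite eqxx.
- by rewrite eqxx orbT.
Qed.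

Lemma gpole_endsE (e : E1) s : ends e = [set gpole s e; gpole (~~ s) e]%SET.
Proof. by rewrite ends_gpole; case: s => //=; rewrite finset.setUC. Qed.

Lemma adj_pole (e : E1) s : adj ends1 (gpole s e) (gpole (~~ s) e).
Proof. by apply/existsP; exists e; rewrite -gpole_endsE. Qed.

Lemma adj_poleP v w : adj ends1 v w -> exists e s, v = gpole s e /\ w = gpole (~~ s) e.
Proof.
move=> /existsP[e /eqP evw].
have : v \in ends e by rewrite evw !inE eqxx.
rewrite ends_pole => /existsP[s /eqP sv]; exists e, s; split => //.
have := gpole_ends (~~ s) e; rewrite evw !inE => /orP[|/eqP//].
by rewrite -sv (negPf (gpole_neq _ _)).
Qed.

Lemma phipm_inj s : injective (phipm S s).
Proof.
have [e _] := edge_nonempty S; rewrite -(gpole_phi s e); apply: phi_inj.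
exact: gpole_ends.
Qed.

Lemma phipm_eq s t a b : phipm S s a = phipm S t b -> s = t /\ a = b.
Proof.
have [e _] := edge_nonempty S.
have [<-/phipm_inj//|st] := eqVneq s t.
move=> ab; have := phi_disj (ends_gpole e); rewrite !gpole_phi => /setP.
move=> /(_ (phipm S s a)); rewrite !inE.
have im u c : phipm S u c \in phipm S u @: label S by rewrite imset_f.
have := im s a; have := im t b; rewrite -ab.
by case: s t st {ab} => [] [] //= _ -> ->.
Qed.

Hypothesis hnd : non_degenerate S.

Lemma boundary_not_adj s t a b : ~~ adj ends1 (phipm S s a) (phipm S t b).
Proof.
have sym v w : adj ends1 v w = adj ends1 w v.
  by apply/existsP/existsP => -[e]; rewrite finset.setUC; exists e.
have im u c : phipm S u c \in Ipm S u by rewrite imset_f.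
have [<-|] := eqVneq s t.
  have [e _] := edge_nonempty S.
  have := phi_indep (gpole_ends s e); rewrite gpole_phi.
  by move=> /forallP/(_ (phipm S s a))/implyP/(_ (im _ _))/forallP/(_ (phipm S s b))/implyP/(_ (im _ _)).
by case: s t => [] [] //= _; [|rewrite sym]; apply: hnd; exact: im.
Qed.

Lemma boundary_one_pole s t a b i (x : E1) :
  gpole i x = phipm S s a -> gpole (~~ i) x <> phipm S t b.
Proof.
move=> h1 h2; have := adj_pole x i; rewrite h1 h2.
by rewrite (negPf (boundary_not_adj _ _ _ _)).
Qed.

Lemma boundary_edge_ex s a : exists x : E1, [exists i, gpole i x == phipm S s a].
Proof.
have : phipm S s a \in Ipm S true :|: Ipm S false.
  by rewrite inE; case: s => //; rewrite imset_f ?orbT.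
move/doublingP => d1; have : (0 < deg ends1 (phipm S s a))%N by rewrite d1.
move/card_gt0P => [e]; rewrite inE ends_pole => /existsP[i h].
by exists e; apply/existsP; exists i.
Qed.

Lemma boundary_edge_uniq s a i j (x y : E1) :
  gpole i x = phipm S s a -> gpole j y = phipm S s a -> x = y /\ i = j.
Proof.
move=> hx hy.
have : phipm S s a \in Ipm S true :|: Ipm S false.
  by rewrite inE; case: (s) => //; rewrite imset_f ?orbT.
move/doublingP => /eqP/cards1P[z hz].
have xz : x = z.
  by apply/set1P; rewrite -hz inE -hx gpole_ends.
have yz : y = z.
  by apply/set1P; rewrite -hz inE -hy gpole_ends.
split; first by rewrite xz.
by apply: (@gpole_inj x); rewrite hx {1}xz -yz hy.
Qed.

(** Boundary vertices have degree 1, so [phipm S s a] lies on a single edge; [bsign] tells which of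
    its two ends it is. The addresses of fibres are sequences of such edges. *)
Definition bedge s (a : label S) : E1 := xchoose (boundary_edge_ex s a).

Lemma bsign_ex s a : exists i, gpole i (bedge s a) == phipm S s a.
Proof. exact/existsP/(xchooseP (boundary_edge_ex s a)). Qed.

Definition bsign s (a : label S) : bool := xchoose (bsign_ex s a).

Lemma bedgeP s a : gpole (bsign s a) (bedge s a) = phipm S s a.
Proof. by apply/eqP; exact: (xchooseP (bsign_ex s a)). Qed.

Lemma bedge_uniq s a i (x : E1) : gpole i x = phipm S s a -> x = bedge s a /\ i = bsign s a.
Proof. by move=> h; apply: (boundary_edge_uniq h); exact: bedgeP. Qed.

Lemma bedge_inj s t a b : bedge s a = bedge t b -> s = t /\ a = b.
Proof.
move=> ab; have hs := bedgeP s a; have ht := bedgeP t b.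
have [e|e] := eqVneq (bsign t b) (bsign s a).
  by apply: phipm_eq; rewrite -hs -ht ab e.
have e2 : bsign t b = ~~ bsign s a by case: (bsign t b) (bsign s a) e => [] [].
by have := boundary_one_pole (t := t) (b := b) hs; rewrite -ht -ab e2.
Qed.

(** This count is the source of the factor 1/2 that makes the set of boundary sequences null. *)
Lemma card_boundary_edges : (2 * #|label S| <= #|E1|)%N.
Proof.
rewrite -card_bool -card_prod -(card_imset (f := fun sa : bool * label S => bedge sa.1 sa.2)).
  exact: max_card.
by move=> [s a] [t b] /= /bedge_inj[-> ->].
Qed.

Lemma nbr_boundary s a : nbr (phipm S s a) = gpole (~~ bsign s a) (bedge s a).
Proof.
rewrite /nbr; case: pickP => [w /= /adj_poleP[e [i [h1 ->]]]|/(_ (gpole (~~ bsign s a) (bedge s a)))].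
  by have [-> ->] := bedge_uniq (esym h1).
by rewrite /= -bedgeP adj_pole.
Qed.

Section Flows.
Context {R : realType}.
Implicit Types (J : V1 -> V1 -> R) (g : V1 -> R).

Lemma divergenceE J v :
  divergence ends1 J v =
  \sum_(e : E1) \sum_(s : bool | gpole s e == v) J v (gpole (~~ s) e).
Proof.
apply: eq_bigr => e _.
have [vin|vout] := boolP [exists s, gpole s e == v].
  have /existsP[s /eqP sv] := vin.
  rewrite (big_pred1 (gpole (~~ s) e)); last first.
    move=> w; rewrite /= (gpole_endsE e s) sv; apply/eqP/eqP => [|->//].
    move=> /setP h; have := h (gpole (~~ s) e); rewrite !inE eqxx orbT.
    by rewrite -sv (negPf (gpole_neq _ _)) => /esym/eqP->.
  rewrite (big_pred1 s)//= => t; apply/eqP/eqP => [tv|->//].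
  by apply: (@gpole_inj e); rewrite tv.
rewrite !big_pred0// => [s|w].
  by apply/negbTE; apply: contra vout => h; apply/existsP; exists s.
apply/negbTE; apply: contra vout => /eqP ew; rewrite -ends_pole ew !inE eqxx//.
Qed.

Lemma sum_by_parts g J : (forall v w, J w v = - J v w) ->
  \sum_v g v * divergence ends1 J v =
  \sum_(e : E1) J (gpole true e) (gpole false e) * (g (gpole true e) - g (gpole false e)).
Proof.
move=> anti; under eq_bigr => v _ do rewrite divergenceE mulr_sumr.
rewrite exchange_big /=; apply: eq_bigr => e _.
under eq_bigr => v _ do rewrite mulr_sumr big_mkcond /=.
rewrite exchange_big /= big_bool /=.
rewrite (bigD1 (gpole true e))//= eqxx big1 ?addr0; last first.
  by move=> v; rewrite eq_sym => /negbTE->.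
rewrite (bigD1 (gpole false e))//= eqxx big1 ?addr0; last first.
  by move=> v; rewrite eq_sym => /negbTE->.
by rewrite (anti (gpole true e)); ring.
Qed.

Lemma divergence_boundary J s a :
  divergence ends1 J (phipm S s a) = J (phipm S s a) (nbr (phipm S s a)).
Proof.
rewrite divergenceE (bigD1 (bedge s a))//= [X in _ + X]big1 ?addr0; last first.
  move=> e ne; rewrite big_pred0// => i; apply/negP => /eqP/bedge_uniq[h _].
  by rewrite h eqxx in ne.
rewrite (big_pred1 (bsign s a)) ?nbr_boundary// => i /=.
by apply/eqP/eqP => [/bedge_uniq[]//|->]; rewrite bedgeP.
Qed.

Lemma sum_boundary (F : V1 -> R) s : \sum_(v in Ipm S s) F v = \sum_a F (phipm S s a).
Proof. by rewrite big_imset//= => a b _ _; exact: phipm_inj. Qed.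

Lemma unit_flow_div g J : unit_flow ends1 (Ipm S true) (Ipm S false) J ->
  \sum_v g v * divergence ends1 J v =
  \sum_a g (phipm S true a) * J (phipm S true a) (nbr (phipm S true a)) +
  \sum_a g (phipm S false a) * J (phipm S false a) (nbr (phipm S false a)).
Proof.
move=> [_ _ J0 _].
rewrite (bigID (fun v => v \in Ipm S true))/= sum_boundary.
congr (_ + _); first by apply: eq_bigr => a _; rewrite divergence_boundary.
rewrite (bigID (fun v => v \in Ipm S false))/= addrC big1 ?add0r.
  under [RHS]eq_bigr => a _ do rewrite -divergence_boundary.
  rewrite -(sum_boundary (fun v => g v * divergence ends1 J v)).
  apply: eq_bigl => v; rewrite andbC; case: imsetP => // -[a _ ->]/=.
  by apply/negP => /imsetP[b _ /phipm_eq[]].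
by move=> v /andP[h1 h2]; rewrite J0 ?mulr0// inE negb_or h1.
Qed.

(** Any two vertices are joined by a path without repetition, which has fewer than [#|V1|] edges. *)
Lemma generator_oscillation g (D : R) :
  (forall e : E1, `|g (gpole false e) - g (gpole true e)| <= D) ->
  forall v w, `|g v - g w| <= #|V1|%:R * D.
Proof.
move=> gD v w; have D0 : 0 <= D.
  by have [e _] := edge_nonempty S; exact: le_trans (gD e).
have /forallP/(_ v)/implyP := gen_connected S.
rewrite inE => /(_ isT)/forallP/(_ w)/implyP; rewrite inE => /(_ isT)/connectP[s].
case/shortenP => t pt ut _ ->.
have /(ler_wpM2r D0) : ((size t)%:R : R) <= #|V1|%:R.
  by rewrite ler_nat; apply: leq_trans (max_card (mem (v :: t))); rewrite (card_uniqP ut)/= leqnSn.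
apply: le_trans; elim: t v pt {ut} => [|u t IH] v /=; first by rewrite subrr normr0 mul0r.
case/andP => /and3P[_ _ /adj_poleP[e [s0 [-> ->]]]] /IH h.
rewrite -(subrKA (g (gpole (~~ s0) e))) -natr1 mulrDl mul1r addrC.
apply: le_trans (ler_normD _ _) _; rewrite lerD//.
by case: s0 {h} => /=; [rewrite distrC|]; exact: gD.
Qed.
End Flows.

Section Minimizers.
Context {R : realType} (p : R).
Hypothesis p1 : 1 < p.
Local Notation En := (energy (@gpole S)).
Local Notation pot := (@potential R S).
Let p0 : 0 < p. Proof. exact: lt_trans ltr01 p1. Qed.
Let pm0 : 0 < p - 1. Proof. by rewrite subr_gt0. Qed.
Let grad (U : V1 -> R) (e : E1) := U (gpole false e) - U (gpole true e).

Lemma potential_minimizer : exists U : V1 -> R, [/\ pot U,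
  forall v, 0 <= U v <= 1 & forall U', pot U' -> En p U <= En p U'].
Proof.
pose lo v : R := if v \in Ipm S true then 1 else 0.
pose hi v : R := if v \in Ipm S false then 0 else 1.
have disj v : v \in Ipm S true -> v \in Ipm S false = false.
  by move=> /imsetP[a _ ->]; apply/negP => /imsetP[b _ /phipm_eq[]].
have lohi v : lo v <= hi v.
  rewrite /lo /hi; case: ifP => [/disj ->//|_]; by case: ifP.
have [U [bU Umin]] := @box_minimizer R V1 E1 (gpole false) (gpole true) lo hi p (lt_trans ltr01 p1) lohi.
have U01 v : 0 <= U v <= 1.
  have /andP[h1 h2] := bU v; apply/andP; split.
    by apply: le_trans h1; rewrite /lo; case: ifP.
  by apply: (le_trans h2); rewrite /hi; case: ifP.
exists U; split => //.
  split=> v vI; have := bU v; have /andP[h1 h2] := U01 v.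
    by rewrite /lo vI => /andP[h3 _]; apply/eqP; rewrite eq_le h2.
  by rewrite /hi vI => /andP[_ h3]; apply/eqP; rewrite eq_le h1 h3.
move=> U' [U'1 U'0].
(* Truncation to [0, 1] does not increase the energy and leads into the box, so the minimizer on the
   box is a minimizer among all potentials. *)
pose C (x : R) := Num.max 0 (Num.min 1 x).
have CL x y : `|C x - C y| <= `|x - y| by exact: clamp_dist.
have : En p (fun v => C (U' v)) <= En p U'.
  by apply: ler_sum => e _; apply: ge0_ler_powR; rewrite ?nnegrE// ltW ?p0.
apply: le_trans; apply: Umin => v; rewrite /lo /hi /C; case: ifPn => vI.
  by rewrite U'1// minxx max_r// disj// lexx.
rewrite le_max lexx/=; case: ifPn => vJ; first by rewrite U'0// min_r// maxxx.
by rewrite ge_max ler01/= ge_min lexx.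
Qed.

(** [Up] is picked by [xget]; this computes [Mp] through whichever minimizer is at hand. *)
Lemma MpE U : pot U -> (forall U', pot U' -> En p U <= En p U') -> Mp S p = En p U.
Proof.
move=> potU minU; rewrite /Mp /Up.
have [] := @xgetPex _ (fun=> 0) [set U | pot U /\ forall U', pot U' -> En p U <= En p U'].
  by exists U.
by move=> pU' minU'; apply/eqP; rewrite eq_le minU//= minU'.
Qed.

Lemma Mp_gt0 : 0 < Mp S p.
Proof.
have [U [potU _ Umin]] := potential_minimizer.
have E0 : 0 <= En p U by apply: sumr_ge0 => e _; exact: powR_ge0.
rewrite (MpE potU Umin) lt_def E0 andbT; apply/negP => /eqP/eqP.
rewrite psumr_eq0 => [/allP h|e _]; last exact: powR_ge0.
have gU e : `|grad U e| <= 0.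
  by have := h e; rewrite mem_index_enum powR_eq0 => /(_ isT)/andP[/eqP -> _].
have [a _] := label_ex S.
have := generator_oscillation gU (phipm S true a) (phipm S false a).
case: potU => -> => [->|]; rewrite ?imset_f//.
by rewrite subr0 mulr0 normr1 ler10.
Qed.

(** The competitor is 1 on I_+, 0 on I_- and 1/2 elsewhere. No edge joins two boundary vertices, so
    no gradient exceeds 1/2. *)
Lemma Mp_le : Mp S p <= #|E1|%:R * 2 `^ (- p).
Proof.
have [U [potU _ Umin]] := potential_minimizer; rewrite (MpE potU Umin).
pose H v : R := if v \in Ipm S true then 1 else if v \in Ipm S false then 0 else 2^-1.
have potH : pot H.
  split => v vI; first by rewrite /H vI.
  rewrite /H vI; case: ifPn => // /imsetP[a _ va].
  by move: vI => /imsetP[b _]; rewrite va => /phipm_eq[].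
apply: le_trans (Umin _ potH) _.
rewrite mulr_natl -sumr_const; apply: ler_sum => e _.
rewrite powRN -powR_inv1 ?powR_ge0// powRAC powR_inv1//.
apply: ge0_ler_powR; rewrite ?nnegrE ?invr_ge0 ?(ltW p0)//.
have hv : 0 <= (2^-1 : R) <= 1 by rewrite invr_ge0 ler0n invf_le1 ?ler1n.
have hh : `|1 - 2^-1| <= (2^-1 : R) by rewrite ger0_norm; lra.
have nv : `|2^-1 : R| <= 2^-1 by rewrite ger0_norm; lra.
have nb s : gpole s e \in Ipm S true -> (gpole (~~ s) e \in Ipm S false) = false.
  by move=> /imsetP[a _ h1]; apply/negP => /imsetP[b _]; exact: boundary_one_pole h1.
have n1 := nb true; have n2 := nb false; rewrite /= in n1 n2.
rewrite /H; case h1: (gpole false e \in Ipm S true); case h2: (gpole true e \in Ipm S true).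
- by rewrite subrr normr0 invr_ge0.
- by rewrite (n2 h1).
- by rewrite (n1 h2) distrC.
by case: ifPn => h3; case: ifPn => h4; rewrite ?subr0 ?sub0r ?normrN ?subrr ?normr0.
Qed.

(** Instead of differentiating, the tangent inequality at [U + t h] is compared with the minimality
    of [U]: this gives [G t >= 0] for [t > 0], and then [t] tends to 0. Equality follows on
    replacing [h] by [- h]. The scale [c] is carried along because the flow is a power of
    [c * grad U]. *)
Lemma euler_lagrange U (c : R) h : 0 < c -> pot U ->
  (forall U', pot U' -> En p U <= En p U') ->
  (forall s a, h (phipm S s a) = 0) ->
  \sum_e spow (p - 1) (c * grad U e) * grad h e = 0.
Proof.
move=> c0 potU Umin.
wlog suff ge : h / (forall s a, h (phipm S s a) = 0) ->
    0 <= \sum_e spow (p - 1) (c * grad U e) * grad h e.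
  move=> h0; apply/eqP; rewrite eq_le (ge h h0) andbT.
  have hN s a : - h (phipm S s a) = 0 by rewrite h0 oppr0.
  have := ge (fun v => - h v) hN.
  rewrite -oppr_le0 -sumrN; congr (_ <= _); apply: eq_bigr => e _.
  by rewrite /grad -opprD mulrN opprK.
move=> h0.
pose G (t : R) := \sum_e spow (p - 1) (c * (grad U e + t * grad h e)) * grad h e.
have cG : continuous G.
  apply: continuous_big => [|e _ t]; first by move=> x; exact: add_continuous.
  apply: (@cvgM R R); last exact: cvg_cst.
  apply: (@continuous_comp R R R (fun t => c * (grad U e + t * grad h e)) (spow (p - 1))).
    apply: (@cvgM R R); first exact: cvg_cst.
    by apply: (@cvgD R R); [exact: cvg_cst|apply: (@cvgM R R); [exact: cvg_id|exact: cvg_cst]].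
  exact: continuous_spow.
have -> : \sum_e spow (p - 1) (c * grad U e) * grad h e = G 0.
  by apply: eq_bigr => e _; rewrite mul0r addr0.
apply: (@closed_cvg _ _ (0 : R)^'+ _ G (fun x => 0 <= x)) => /=.
- exact: closed_ge.
- near=> t; have t0 : 0 < t by near: t; exact: nbhs_right_gt.
  have pot' : pot (fun v => U v + t * h v).
    have hI s v : v \in Ipm S s -> h v = 0 by case/imsetP => a _ ->; exact: h0.
    by case: potU => U1 U0; split=> v vI /=; rewrite (hI _ _ vI) mulr0 addr0; [exact: U1|exact: U0].
  have := Umin _ pot'.
  have -> : En p (fun v => U v + t * h v) = \sum_e `|grad U e + t * grad h e| `^ p.
    by apply: eq_bigr => e _; congr (`| _ | `^ _); rewrite /grad; ring.
  rewrite -(ler_pM2l (powR_gt0 p c0)) !mulr_sumr.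
  have sc (x : R) : c `^ p * `|x| `^ p = `|c * x| `^ p.
    by rewrite normrM (gtr0_norm c0) powRM// ltW.
  under eq_bigr => e _ do rewrite sc.
  under [X in _ <= X]eq_bigr => e _ do rewrite sc.
  move=> H1.
  have : \sum_e (`|c * (grad U e + t * grad h e)| `^ p + p * spow (p - 1) (c * (grad U e + t * grad h e)) * (c * grad U e - c * (grad U e + t * grad h e))) <= \sum_e `|c * grad U e| `^ p.
    by apply: ler_sum => e _; exact: powR_tangent.
  move=> /le_trans/(_ H1); rewrite big_split /= -lerBrDl subrr.
  have -> : \sum_e p * spow (p - 1) (c * (grad U e + t * grad h e)) * (c * grad U e - c * (grad U e + t * grad h e)) = - (p * c * t) * G t.
    by rewrite /G mulr_sumr; apply: eq_bigr => e _; ring.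
  by rewrite mulNr oppr_le0 pmulr_rge0// !mulr_gt0.
- by apply: cvg_at_right_filter; exact: cG.
Unshelve. all: by end_near. Qed.

Local Notation q := (p / (p - 1)).
Local Notation FE := (flow_energy (@gpole S) q).
Local Notation uflow := (unit_flow ends1 (Ipm S true) (Ipm S false)).
Local Notation M := (Mp S p).
Local Notation Jf := (@Jp R S p).

(* The minimal flow is [psi(c grad U)] with [psi = spow (p - 1)], [U] a minimal potential
   and [c ^ (p - 1) = 1 / M]. *)
Lemma minimal_flow : exists J0 (c : R) (U : V1 -> R), [/\ uflow J0, 0 < c /\ c `^ (p - 1) * M = 1,
   FE J0 = M `^ (1 - q),
   (forall e : E1, J0 (gpole true e) (gpole false e) = - spow (p - 1) (c * grad U e)) &
   (forall v, 0 <= U v <= 1) /\ pot U].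
Proof.
have [U [potU U01 Umin]] := potential_minimizer.
have ME := MpE potU Umin; have M0 := Mp_gt0.
pose c : R := M `^ (- (p - 1)^-1).
have c0 : 0 < c by exact: powR_gt0.
have cM : c `^ (p - 1) * M = 1.
  by rewrite -powRrM mulNr mulVf ?gt_eqF// powR_inv1 ?(ltW M0)// mulVf// gt_eqF.
pose J0 (v w : V1) := if adj ends1 v w then spow (p - 1) (c * (U v - U w)) else 0.
have J0e (e : E1) : J0 (gpole true e) (gpole false e) = - spow (p - 1) (c * grad U e).
  by rewrite /J0 (adj_pole e true) -spowN -mulrN opprB.
have adjC v w : adj ends1 w v = adj ends1 v w.
  by apply/existsP/existsP => -[e he]; exists e; rewrite finset.setUC.
have anti v w : J0 w v = - J0 v w.
  rewrite /J0 adjC; case: ifP => _; last by rewrite oppr0.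
  by rewrite -spowN -mulrN opprB.
have gradM : \sum_e spow (p - 1) (c * grad U e) * grad U e = 1.
  have e1 e : spow (p - 1) (c * grad U e) * grad U e = c `^ (p - 1) * `|grad U e| `^ p.
    apply: (mulfI (lt0r_neq0 c0)); rewrite mulrCA (spow_mul _ pm0) subrK normrM (gtr0_norm c0).
    by rewrite powRM ?(ltW c0)// mulrA mulr_powRB1// ltW.
  under eq_bigr => e _ do rewrite e1.
  by rewrite -mulr_sumr -[RHS]cM ME /energy /grad.
exists J0, c, U; split => //.
  split => //; first by move=> v w /negbTE h; rewrite /J0 h.
    (* The divergence at [v] is the pairing with the indicator of [v], to which the Euler-Lagrange
       equation applies off the boundary. *)
    move=> v vI; pose dl (w : V1) : R := (w == v)%:R.
    have : \sum_w dl w * divergence ends1 J0 w = divergence ends1 J0 v.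
      rewrite (bigD1 v)//= big1 ?addr0 /dl ?eqxx ?mul1r// => w /negbTE->.
      by rewrite mul0r.
    rewrite sum_by_parts// => <-.
    rewrite -[RHS](@euler_lagrange U c dl)//; last first.
      move=> s a; rewrite /dl; case: eqP => // av; case/negP: vI; rewrite inE -av.
      by case: s {av}; rewrite imset_f ?orbT.
    by apply: eq_bigr => e _; rewrite J0e /grad mulNr -mulrN opprB.
  have := sum_by_parts U anti.
  rewrite (bigID (fun v => v \in Ipm S true))/= [X in _ + X = _]big1 ?addr0; last first.
    move=> v vI; have [vI'|vI'] := boolP (v \in Ipm S false).
      by case: potU => _ ->; rewrite ?mul0r.
    rewrite [divergence _ _ _](_ : _ = 0) ?mulr0//.
    pose dl (w : V1) : R := (w == v)%:R.
    have : \sum_w dl w * divergence ends1 J0 w = divergence ends1 J0 v.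
      rewrite (bigD1 v)//= big1 ?addr0 /dl ?eqxx ?mul1r// => w /negbTE->.
      by rewrite mul0r.
    rewrite sum_by_parts// => <-.
    rewrite -[RHS](@euler_lagrange U c dl)//; last first.
      move=> s a; rewrite /dl; case: eqP => // av.
      by case: s av => av; [case/negP: vI|case/negP: vI']; rewrite -av imset_f.
    by apply: eq_bigr => e _; rewrite J0e /grad mulNr -mulrN opprB.
  case: (potU) => U1 _.
  under eq_bigr => v vI do rewrite U1// mul1r.
  move=> ->; rewrite -gradM; apply: eq_bigr => e _.
  by rewrite J0e /grad mulNr -mulrN opprB.
have e2 e : `|J0 (gpole true e) (gpole false e)| `^ q = c `^ p * `|grad U e| `^ p.
  rewrite J0e normrN norm_spow// -powRrM mulrCA mulfV ?gt_eqF// mulr1.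
  by rewrite normrM (gtr0_norm c0) powRM// ltW.
rewrite /flow_energy; under eq_bigr => e _ do rewrite e2.
rewrite -mulr_sumr -[X in _ * X]ME /c -powRrM -{2}[M]powRr1 ?(ltW M0)// -powRD; last first.
  by rewrite (gt_eqF M0) implybT.
by congr (_ `^ _); field; rewrite gt_eqF.
Qed.

(** [Jp] is whatever minimizer [xget] picks. As [spow (q - 1)] inverts [spow (p - 1)], the linear
    term of the tangent at the flow of [minimal_flow] is a multiple of the pairing with the gradient
    of [U], which takes the same value on all unit flows. Tangency then gives minimality, and strict
    tangency shows that [Jp] agrees with that flow on every edge. *)
Lemma Jp_minimal : [/\ uflow Jf, FE (Jf) = M `^ (1 - q) & 
  exists (c : R) (U : V1 -> R), [/\ 0 < c, forall v : V1, 0 <= U v <= 1, pot U &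
  forall e : E1, Jf (gpole true e) (gpole false e) = - spow (p - 1) (c * grad U e)]].
Proof.
have [J0 [c [U [uJ0 [c0 cM] EJ0 J0e [U01 potU]]]]] := minimal_flow.
have M0 := Mp_gt0.
have q1 : 1 < q by rewrite ltr_pdivlMr// mul1r gtrBl.
have qm : q - 1 = (p - 1)^-1 by field; rewrite gt_eqF.
have flowU J : uflow J -> \sum_(e : E1) J (gpole true e) (gpole false e) * - grad U e = 1.
  move=> uJ; have [anti _ _ sumJ] := uJ.
  under eq_bigr => e _ do rewrite /grad opprB.
  rewrite -(sum_by_parts U anti) (unit_flow_div U uJ).
  case: potU => U1 U0; rewrite [X in _ + X]big1 ?addr0; last first.
    by move=> a _; rewrite U0 ?mul0r ?imset_f.
  rewrite -sumJ sum_boundary; apply: eq_bigr => a _.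
  by rewrite U1 ?mul1r ?imset_f// divergence_boundary.
have tang J : uflow J -> \sum_(e : E1) (q * spow (q - 1) (J0 (gpole true e) (gpole false e)) *
      (J (gpole true e) (gpole false e) - J0 (gpole true e) (gpole false e))) = 0.
  move=> uJ; transitivity (q * c * (\sum_(e : E1) J (gpole true e) (gpole false e) * - grad U e - \sum_(e : E1) J0 (gpole true e) (gpole false e) * - grad U e)).
    rewrite -sumrB mulr_sumr; apply: eq_bigr => e _.
    by rewrite {1}J0e spowN qm spowK//; ring.
  by rewrite !flowU// subrr mulr0.
have J0min J : uflow J -> FE J0 <= FE J.
  move=> uJ.
  have : \sum_(f : E1) (`|J0 (gpole true f) (gpole false f)| `^ q +
      q * spow (q - 1) (J0 (gpole true f) (gpole false f)) *
      (J (gpole true f) (gpole false f) - J0 (gpole true f) (gpole false f))) <= FE J.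
    by apply: ler_sum => f _; exact: powR_tangent.
  by rewrite big_split /= tang// addr0.
have [uJ Jmin] : uflow (Jf) /\ forall J', uflow J' -> FE (Jf) <= FE J'.
  rewrite /Jp; apply: (@xgetPex _ (fun _ _ => 0) [set J | unit_flow ends1 (Ipm S true) (Ipm S false) J /\
    forall J', unit_flow ends1 (Ipm S true) (Ipm S false) J' -> FE J <= FE J']).
  by exists J0.
have EE : FE (Jf) = FE J0 by apply/eqP; rewrite eq_le Jmin// J0min.
split; rewrite ?EE//; exists c, U; split => // e; rewrite -J0e; apply/eqP.
apply: contraT => ne; rewrite eq_sym in ne.
have : \sum_(f : E1) (`|J0 (gpole true f) (gpole false f)| `^ q +
     q * spow (q - 1) (J0 (gpole true f) (gpole false f)) *
      (Jf (gpole true f) (gpole false f) - J0 (gpole true f) (gpole false f))) < FE Jf.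
  rewrite /flow_energy (bigD1 e)//= [X in _ < X](bigD1 e)//=; apply: ltr_leD.
    exact: powR_tangent_lt.
  by apply: ler_sum => f _; exact: powR_tangent.
by rewrite big_split /= tang// addr0 EE ltxx.
Qed.

Hypothesis hcu : conductively_uniform R S.
Local Notation Jl := (@Jlab R S p : label S -> R).

(** By conductive uniformity what enters the graph at [phipm S true a] is what leaves it at
    [phipm S false a], so the boundary terms of the summation by parts pair up label by label. *)
Lemma Jlab_flow g : \sum_(a : label S) Jl a * (g (phipm S true a) - g (phipm S false a)) =
  \sum_(e : E1) Jf (gpole true e) (gpole false e) * (g (gpole true e) - g (gpole false e)).
Proof.
have [uJ _ _] := Jp_minimal; have [anti _ _ _] := uJ.
rewrite -(sum_by_parts g anti) (unit_flow_div g uJ) -big_split /=; apply: eq_bigr => a _.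
by rewrite -[Jf (phipm S false a) _]opprK -hcu// /Jlab; ring.
Qed.

Lemma Jlab_sum : \sum_(a : label S) Jl a = 1.
Proof.
have [uJ _ _] := Jp_minimal; have [_ _ _ <-] := uJ.
by rewrite sum_boundary; apply: eq_bigr => a _; rewrite divergence_boundary.
Qed.

Lemma Jlab_bedge s (a : label S) : `|Jf (gpole true (bedge s a)) (gpole false (bedge s a))| = `|Jl a|.
Proof.
have [[anti _ _ _] _ _] := Jp_minimal.
have -> : `|Jl a| = `|Jf (phipm S s a) (nbr (phipm S s a))|.
  by case: s => //; rewrite /Jlab hcu// normrN.
rewrite nbr_boundary -bedgeP; case: (bsign s a) => //=.
by rewrite anti normrN.
Qed.

(** The flow runs down the potential [U], which has its maximum 1 on I_+. *)
Lemma Jlab_ge0 (a : label S) : 0 <= Jl a.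
Proof.
have [[anti _ _ _] _ [c [U [c0 U01 [U1 _] Je]]]] := Jp_minimal.
have -> : Jl a = spow (p - 1) (c * (U (phipm S true a) - U (nbr (phipm S true a)))).
  rewrite /Jlab nbr_boundary -bedgeP; case: (bsign true a) => /=.
    by rewrite Je -spowN -mulrN /grad opprB.
  by rewrite anti Je opprK.
have -> : U (phipm S true a) = 1 by apply: U1; exact: imset_f.
rewrite spow_ge0 ?powR_ge0// mulr_ge0 ?(ltW c0)// subr_ge0.
by have /andP[] := U01 (nbr (phipm S true a)).
Qed.

Lemma flow_energy_conj : FE (Jf) `^ (p - 1) = M^-1.
Proof.
have [_ -> _] := Jp_minimal; rewrite -powRrM.
have -> : (1 - q) * (p - 1) = -1 by field; rewrite gt_eqF.
by rewrite powR_inv1 // ltW// Mp_gt0.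
Qed.

(** Hoelder against the flow, whose energy to the power [p - 1] is [M^-1]. Applied to the vertex
    averages of level 1, it is the step from level 0 to level 1 in the monotonicity of the
    energies. *)
Lemma Jlab_energy g :
  `|\sum_(a : label S) Jl a * (g (phipm S true a) - g (phipm S false a))| `^ p <= M^-1 * En p g.
Proof.
rewrite Jlab_flow -flow_energy_conj.
apply: le_trans (hoelder_sum _ _ p1) _; rewrite /flow_energy /energy.
by under [X in _ * X <= _]eq_bigr => e _ do rewrite distrC.
Qed.

(** Every label sits on two distinct edges, one at I_+ and one at I_-, which carry the same amount
    of flow. So the sum is at most half of the flow energy, and the power [p - 1] turns 1/2 into
    2^(1-p). *)
Lemma Jlab_sum_powR : (\sum_(a : label S) `|Jl a| `^ q) `^ (p - 1) <= 2 `^ (1 - p) * M^-1.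
Proof.
have q0 : 0 < q by rewrite divr_gt0.
have S0 : 0 <= \sum_(a : label S) `|Jl a| `^ q by apply: sumr_ge0 => a _; exact: powR_ge0.
have F0 : 0 <= FE (Jf) by apply: sumr_ge0 => a _; exact: powR_ge0.
rewrite -flow_energy_conj.
have -> : 1 - p = - (p - 1) by rewrite opprB.
rewrite powRN ler_pdivlMl ?powR_gt0// -powRM//.
apply: ge0_ler_powR; rewrite ?nnegrE ?(ltW pm0) ?mulr_ge0//.
have -> : 2 * (\sum_(a : label S) `|Jl a| `^ q) = \sum_(sa : bool * label S)
    `|Jf (gpole true (bedge sa.1 sa.2)) (gpole false (bedge sa.1 sa.2))| `^ q.
  rewrite -(pair_bigA _ (fun s a => `|Jf (gpole true (bedge s a)) (gpole false (bedge s a))| `^ q)) /=.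
  rewrite big_bool /=; under [X in _ = X + _]eq_bigr => a _ do rewrite Jlab_bedge.
  under [X in _ = _ + X]eq_bigr => a _ do rewrite Jlab_bedge.
  by rewrite mulr2n mulrDl mul1r.
pose h e := `|Jf (gpole true e) (gpole false e)| `^ q.
rewrite -(big_imset h (A := predT) (h := fun sa : bool * label S => bedge sa.1 sa.2)) /=; last first.
  by move=> [s a] [t b] _ _ /= /bedge_inj[-> ->].
rewrite /flow_energy [leRHS](bigID (fun e => e \in [set bedge sa.1 sa.2 | sa in {: bool * label S}]%SET))/=.
by rewrite lerDl sumr_ge0// => e _; exact: powR_ge0.
Qed.
End Minimizers.
End GeneratorCombinatorics.

(** * Identification of vertices in a replacement step *)

Section Gluing.
Context (S : doubling_igs) (V E : finType) (pole : bool -> E -> V).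

(** A boundary vertex determines its sign and its label, so two gluings with a common middle compose
    into one. Hence the generated equivalence adds nothing but the diagonal. *)
Lemma glue_trans : transitive (glue_rel (S := S) pole).
Proof.
move=> y x z /existsP[s /existsP[t /existsP[a /and3P[/eqP h1 /eqP h2 /eqP h3]]]].
move=> /existsP[s' /existsP[t' /existsP[b /and3P[/eqP k1 /eqP k2 /eqP k3]]]].
have [e1 e2] : t = s' /\ a = b by apply: phipm_eq; rewrite -h3 -k2.
subst; apply/existsP; exists s; apply/existsP; exists t'; apply/existsP; exists b.
by rewrite h1 k1 h2 k3 !eqxx.
Qed.

Lemma rclass_eq x y : rclass (S := S) pole x = rclass pole y <->
  x = y \/ glue_rel pole x y.
Proof.
have -> : (rclass (S := S) pole x = rclass pole y) <-> connect (glue_rel (S := S) pole) x y.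
  by split => h; apply/(@eqmodP _ (glue_equiv S pole)).
split => [/connectP[s]|[->|/connect1//]]; last exact: connect0.
elim: s x => [|z s IH] x /=; first by move=> _ ->; left.
by move=> /andP[xz /IH/[apply] -[<-|zy]]; right => //; exact: glue_trans xz zy.
Qed.
End Gluing.

(** * Words, gluing and addresses of boundary points *)

Section Words.
Context (S : doubling_igs).
Local Notation V1 := (vert (gen S)).
Local Notation E1 := (letter S).
Local Notation word := (word S).

Lemma vclass_eq n (z z' : V1) (e f : word n) :
  vclass z e = vclass z' f <-> (z = z' /\ e = f) \/
  exists s t a, [/\ lpole s e = lpole t f, z = phipm S s a & z' = phipm S t a].
Proof.
rewrite /vclass rclass_eq; split => [[[-> ->]|]|[[-> ->]|]]; [by left| |by left|].
  move=> /existsP[s /existsP[t /existsP[a /and3P[/eqP h1 /eqP h2 /eqP h3]]]].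
  by right; exists s, t, a.
move=> [s [t [a [h1 h2 h3]]]]; right; apply/existsP; exists s; apply/existsP; exists t.
by apply/existsP; exists a; apply/and3P; split; apply/eqP.
Qed.

Lemma lpoleS n s (e : word n) (x : E1) : lpole (n := n.+1) s (e, x) = vclass (gpole s x) e.
Proof. by []. Qed.

Lemma lpole_eq n i j (e f : word n) (x y : E1) :
  lpole (n := n.+1) i (e, x) = lpole (n := n.+1) j (f, y) <->
  (e = f /\ gpole i x = gpole j y) \/
  exists s t a, [/\ lpole s e = lpole t f, gpole i x = phipm S s a & gpole j y = phipm S t a].
Proof.
rewrite !lpoleS vclass_eq; split => -[[-> ->]|h]; by [left|right].
Qed.

Lemma lpole_inj n i j (e : word n) : lpole i e = lpole j e -> i = j.
Proof.
elim: n i j e => [|n IH] i j; first by [].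
case=> e x /lpole_eq[[_ /gpole_inj//]|[s [t [a [/IH <- h1 h2]]]]].
by apply: (@gpole_inj _ x); rewrite h1 h2.
Qed.

Definition touch n (e f : word n) := exists i j, lpole i e = lpole j f.

Lemma lends_touch n (e f : word n) :
  (lends e :&: lends f != finset.set0)%SET <-> touch e f.
Proof.
have inl (v : lvert S n) (g : word n) : v \in lends g <-> exists i, v = lpole i g.
  rewrite !inE; split => [/orP[]/eqP->|[[] ->]]; rewrite ?eqxx ?orbT//.
    by exists true.
  by exists false.
split => [/set0Pn[v /[!inE]/andP[]]|[i [j ij]]].
  rewrite -!in_set2 => /inl[i ->] /inl[j h]; by exists i, j.
apply/set0Pn; exists (lpole i e); rewrite inE; apply/andP; split; apply/inl.
  by exists i.
by exists j.
Qed.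

Lemma touch_refl n (e : word n) : touch e e.
Proof. by exists true, true. Qed.

Lemma touch_sym n (e f : word n) : touch e f -> touch f e.
Proof. by move=> [i [j h]]; exists j, i. Qed.

Lemma touchS n (e f : word n) x y : touch (n := n.+1) (e, x) (f, y) -> touch e f.
Proof.
move=> [i [j /lpole_eq[[-> _]|[s [t [a [h _ _]]]]]]]; first exact: touch_refl.
by exists s, t.
Qed.

Lemma touch_prefix m n (u w : symb S) : (m <= n)%N ->
  touch (prefix_word n u) (prefix_word n w) -> touch (prefix_word m u) (prefix_word m w).
Proof.
move=> mn; rewrite -(subnKC mn) addnC; elim: (n - m)%N => // k IH.
by move=> /touchS; exact: IH.
Qed.

Hypothesis hnd : non_degenerate S.

(* Non-degeneracy enters here. *)
Lemma touch_trans n (e f g : word n) x y z :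
  touch (n := n.+1) (e, x) (g, z) -> touch (n := n.+1) (g, z) (f, y) -> touch e f.
Proof.
move=> [i [j /lpole_eq[[-> _]|h1]]]; first exact: touchS.
move=> [k [l /lpole_eq[[<- _]|h2]]].
  by case: h1 => s [t [a [h _ _]]]; exists s, t.
case: h1 => s [t [a [h _ ha]]]; case: h2 => s' [t' [b [h' hb _]]].
have [e1|e1] := eqVneq s' t; first by exists s, t'; rewrite h -e1.
have [e2|e2] := eqVneq k j.
  have [ts _] : t = s' /\ a = b by apply: phipm_eq; rewrite -ha -hb e2.
  by rewrite ts eqxx in e1.
have := boundary_one_pole hnd (t := s') (b := b) ha; rewrite -hb.
by case: (k) (j) e2 => [] [].
Qed.

(** [touch_trans] loses a level, which is harmless because touching is known at all levels. *)
Lemma symb_eqP (u w : symb S) :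
  symb_eq u w <-> forall n, touch (prefix_word n u) (prefix_word n w).
Proof.
split=> [/asboolP|h]; last first.
  by apply/asboolP/rst_step => n; apply/lends_touch.
elim=> {u w} [u w h n|u n|u w _ IH n|u v w _ IH1 _ IH2 n].
- exact/lends_touch.
- exact: touch_refl.
- exact/touch_sym.
- exact: touch_trans (IH1 n.+1) (IH2 n.+1).
Qed.

(** In [word] the last letter is outermost. Adding a first letter is what corresponds to the maps
    F_x with x in E_1. *)
Fixpoint consw (x : E1) n : word n -> word n.+1 :=
  if n is m.+1 return word n -> word n.+1 then fun e => (consw x e.1, e.2) else fun e => (e, x).

Lemma consw_inj n x y (e f : word n) : consw x e = consw y f -> x = y /\ e = f.
Proof.
elim: n e f => [|n IH]; first by case=> -[] [<-].
by case=> e z [f w] /= [/IH[-> ->] ->].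
Qed.

Lemma prefix_scons n x (w : symb S) : prefix_word n.+1 (scons x w) = consw x (prefix_word n w).
Proof. by elim: n => [//|n IH]; rewrite [LHS]/= -[(prefix_word n _, _)]/(prefix_word n.+1 (scons x w)) IH. Qed.

(* [bdry s i e a]: the end [i] of [e] is the vertex v_s . (a read backwards). *)
Fixpoint bdry (s : bool) n (i : bool) : word n -> seq (label S) -> Prop :=
  if n is m.+1 return word n -> seq (label S) -> Prop then
    fun e a => if a is b :: a' then
      exists j, bdry s j e.1 a' /\ gpole i e.2 = phipm S j b else False
  else fun _ a => i = s /\ a = [::].

Lemma bdry_uniq s n i j (e f : word n) a : bdry s i e a -> bdry s j f a -> e = f /\ i = j.
Proof.
elim: n i j e f a => [|n IH] i j.
  by move=> e f a; case: e f => [] [] [-> _] [-> _].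
move=> [e x] [f y] [//|b a] [k [h1 h2]] [l [h3 h4]].
have [ef kl] : e = f /\ k = l := IH _ _ _ _ _ h1 h3.
rewrite -kl in h4.
have [h5 h6] := bedge_uniq h2; have [h7 h8] := bedge_uniq h4.
by rewrite /= in h5 h7; rewrite ef h5 h7 h6 h8.
Qed.

Lemma lpole_consw n i j x (e f : word n) : lpole i e = lpole j f ->
  lpole i (consw x e) = lpole j (consw x f).
Proof.
elim: n i j e f => [|n IH] i j; first by move=> [] [] ij; have -> : i = j := ij.
move=> [e z] [f w] /lpole_eq[[-> h]|[s [t [a [h1 h2 h3]]]]]; apply/lpole_eq.
  by left.
by right; exists s, t, a; split => //; exact: IH.
Qed.

(** An end shared by the words [x e] and [y f] is either shared inside a single copy, or it descends
    from a common vertex of [x] and [y]. In the second case both words reach it by the same labels,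
    since gluing preserves labels. *)
Lemma lpole_consw_inv n i j x y (e f : word n) :
  lpole i (consw x e) = lpole j (consw y f) ->
  (x = y /\ lpole i e = lpole j f) \/
  exists s t a, [/\ gpole s x = gpole t y, bdry s i e a & bdry t j f a].
Proof.
elim: n i j e f => [|n IH] i j.
  move=> [] [] /lpole_eq[[_ h]|[s [t [a [h1 h2 h3]]]]]; right.
    by exists i, j, [::].
  have st : s = t := h1.
  by exists i, j, [::]; split => //; rewrite h2 h3 st.
move=> [e z] [f w] /lpole_eq[[ef h]|[s [t [a [/IH h1 h2 h3]]]]].
  have [-> {}ef] : x = y /\ e = f := consw_inj ef; rewrite ef.
  by left; split => //; apply/lpole_eq; left.
case: h1 => [[-> h1]|[s' [t' [c [k1 k2 k3]]]]].
  by left; split => //; apply/lpole_eq; right; exists s, t, a.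
right; exists s', t', (a :: c); split => //.
  by exists s.
by exists t.
Qed.

Lemma touch_consw n x (e f : word n) : touch (consw x e) (consw x f) <-> touch e f.
Proof.
split=> [[i [j /lpole_consw_inv]]|[i [j h]]]; last first.
  by exists i, j; exact: lpole_consw.
move=> [[_ h]|[s [t [a [/gpole_inj <- h1 h2]]]]]; first by exists i, j.
by have [-> _] := bdry_uniq h1 h2; exact: touch_refl.
Qed.

Lemma symb_eq_scons x (u w : symb S) : symb_eq (scons x u) (scons x w) <-> symb_eq u w.
Proof.
rewrite !symb_eqP; split=> h n.
  by have := h n.+1; rewrite !prefix_scons => /touch_consw.
by case: n => [|n]; [exact: touch_refl|rewrite !prefix_scons; apply/touch_consw].
Qed.

(** This makes F_e well defined on classes, and injective. *)
Lemma symb_eq_prepend n (e : word n) (u w : symb S) :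
  symb_eq (prepend e u) (prepend e w) <-> symb_eq u w.
Proof.
elim: n e u w => [|n IH] e u w //=.
by rewrite IH symb_eq_scons.
Qed.

Definition on_bdry s n (w : symb S) := exists i a, bdry s i (prefix_word n w) a.

Lemma on_bdryS s n w : on_bdry s n.+1 w -> on_bdry s n w.
Proof. by move=> [i [[//|b a] [j [h _]]]]; exists j, a. Qed.

Lemma on_bdry_le s m n w : (m <= n)%N -> on_bdry s n w -> on_bdry s m w.
Proof.
move=> mn; rewrite -(subnKC mn) addnC; elim: (n - m)%N => // k IH /on_bdryS; exact: IH.
Qed.

Lemma bdry_consw s n i x (e : word n) c : bdry s i (consw x e) c ->
  exists b a, x = bedge s b /\ bdry (bsign s b) i e a.
Proof.
elim: n i e c => [|n IH] i e [//|b a] [j [h1 h2]].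
  case: h1 => js _; move: h2; rewrite js => /bedge_uniq[h3 h4].
  by exists b, [::]; split.
have [b' [a' [h3 h4]]] := IH _ _ _ h1.
by exists b', (b :: a'); split => //; exists j.
Qed.

Lemma on_bdry_scons s n x w : on_bdry s n.+1 (scons x w) ->
  exists b, x = bedge s b /\ on_bdry (bsign s b) n w.
Proof.
move=> [i [a]]; rewrite prefix_scons => /bdry_consw[b [a' [h1 h2]]].
by exists b; split => //; exists i, a'.
Qed.

Lemma on_bdry_disj s t n w : (0 < n)%N -> on_bdry s n w -> on_bdry t n w -> s = t.
Proof.
move=> n0 /(on_bdry_le n0)[i [[//|b a] [j [h1 h2]]]] /(on_bdry_le n0)[i' [[//|b' a'] [j' [h1' h2']]]].
case: h1 => js _; case: h1' => js' _; move: h2 h2'; rewrite js js' => /bedge_uniq[h _] /bedge_uniq[h' _].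
by have [] : s = t /\ b = b' by apply: (bedge_inj hnd); rewrite -h -h'.
Qed.

(** Different copies meet only in descendants of common vertices, so [u] runs along a fibre. The
    sign found at level 1 is valid at all levels, because the edges at I_+ and at I_- are
    different. *)
Lemma symb_eq_scons_neq x y (u w : symb S) : x <> y -> symb_eq (scons x u) (scons y w) ->
  exists s, forall n, on_bdry s n u.
Proof.
move=> xy /symb_eqP h.
have H n : exists s, on_bdry s n u.
  have [i [j]] := h n.+1; rewrite !prefix_scons => /lpole_consw_inv[[]//|].
  by move=> [s [t [a [_ h1 _]]]]; exists s, i, a.
have [s Hs] := H 1%N; exists s => -[|n]; first by exists s, [::].
have [t Ht] := H n.+1.
by rewrite (on_bdry_disj (ltn0Sn 0) Hs (on_bdry_le (ltn0Sn n) Ht)).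
Qed.

Lemma symb_eq_prepend_neq n (e f : word n) (u w : symb S) : e <> f ->
  symb_eq (prepend e u) (prepend f w) -> exists s, forall k, on_bdry s k u.
Proof.
elim: n e f u w => [|n IH] e f u w; first by case: e f => [] [].
case: e f => [e x] [f y] ef /= h.
have [efE|efE] := eqVneq e f.
  move: h; rewrite -efE symb_eq_prepend; apply: symb_eq_scons_neq => xy.
  by apply: ef; rewrite efE xy.
have [s hs] := IH _ _ _ _ (elimN eqP efE) h.
have [b [xb _]] := on_bdry_scons (hs 1%N); exists (bsign s b) => k.
have [c [xc hc]] := on_bdry_scons (hs k.+1).
by have [_ <-] : s = s /\ c = b by apply: (bedge_inj hnd); rewrite -xb -xc.
Qed.

(* [theta s a] is the sequence T_{v_s, e_0}(a), and [thsign s a n] names the end v_s . (a_0 ... a_(n-1))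
   of its n-th edge. *)
Fixpoint thsign s (a : nat -> lab S) n : bool :=
  if n is m.+1 then bsign (thsign s a m) (a m) else s.

Definition theta s (a : nat -> lab S) : symb S := fun n => bedge (thsign s a n) (a n).

Lemma thsign_shift s a n : thsign s a n.+1 = thsign (bsign s (a 0%N)) (fun k => a k.+1) n.
Proof. by elim: n => //= n ->. Qed.

Lemma theta_shift s a : theta s a = scons (bedge s (a 0%N)) (theta (bsign s (a 0%N)) (fun k => a k.+1)).
Proof. by apply/funext => -[|n] //; rewrite /theta thsign_shift. Qed.

Lemma vdotE n s (e : word n) a : vdot (lpole s e) a = vclass (phipm S s a) e.
Proof.
rewrite /vdot.
have [t [f [h ->]]] := @xgetPex _ (vclass (gpole true (point : letter S)) (word0 S n))
  [set u | exists t (f : word n), lpole t f = lpole s e /\ u = vclass (phipm S t a) f]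
  (ex_intro _ _ (ex_intro _ s (ex_intro _ e (conj erefl erefl)))).
by apply/vclass_eq; right; exists t, s, a.
Qed.

Lemma vdotsE n s (e : word n) a m :
  vdots (lpole s e) a m = lpole (thsign s a m) (wcat e (prefix_word m (theta s a))).
Proof.
elim: m => [//|m IH]; rewrite [LHS]/= IH vdotE.
by rewrite [RHS]lpoleS /= bedgeP.
Qed.

Lemma lendsP n (v : lvert S n) (e : word n) : reflect (exists i, v = lpole i e) (v \in lends e).
Proof.
apply: (iffP idP) => [|[[] ->]]; rewrite !inE ?eqxx ?orbT// => /orP[]/eqP->.
  by exists true.
by exists false.
Qed.

(** [Tfib] is picked by [xget] from its defining property. That property determines the sequence
    letter by letter, because a boundary vertex lies on only one edge. *)
Lemma TfibE n s (e : word n) a : Tfib (lpole s e) e a = prepend e (theta s a).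
Proof.
have P : [set w : symb S | prefix_word n w = e /\
    forall m, vdots (lpole s e) a m \in lends (prefix_word (m + n) w)] (prepend e (theta s a)).
  split => [|m]; first exact: (prefix_prepend e (theta s a) 0).
  by rewrite prefix_prepend vdotsE; apply/lendsP; exists (thsign s a m).
rewrite /Tfib; have [pe H] := @xgetPex _ point _ (ex_intro _ _ P).
set w := xget _ _ in pe H *.
have K m : prefix_word (m + n) w = wcat e (prefix_word m (theta s a)).
  elim: m => [//|m IH]; rewrite [LHS]/= IH [RHS]/=; congr pair.
  have /lendsP[i] := H m.+1; rewrite vdotsE [prefix_word (m.+1 + n) w]/= IH.
  move=> /lpole_eq[[_]|[s' [t' [b [/lpole_inj <- h1 h2]]]]].
    by rewrite bedgeP => /esym/bedge_uniq[].
  by move: h2; rewrite -h1 bedgeP => /bedge_uniq[].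
apply/funext => k.
have L (u v : symb S) : (forall m, prefix_word (m + n) u = prefix_word (m + n) v) -> u k = v k.
  move=> uv; have : prefix_word k.+1 u = prefix_word k.+1 v; last by case.
  have := uv k.+1; elim: n {e K H P pe w uv} => [|n' IH]; first by rewrite addn0.
  by rewrite addnS => /(congr1 fst)/IH.
by apply: L => m; rewrite K prefix_prepend.
Qed.

Lemma symb_eq_theta n s t (e f : word n) a : lpole s e = lpole t f ->
  symb_eq (prepend e (theta s a)) (prepend f (theta t a)).
Proof.
move=> st; apply/symb_eqP => m; apply: (@touch_prefix m (m + n)); first exact: leq_addr.
by rewrite !prefix_prepend; exists (thsign s a m), (thsign t a m); rewrite -!vdotsE st.
Qed.
End Words.

(** * Distances in the generator *)

Lemma inf_natr (R : realType) (A : set nat) : A !=set0 ->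
  exists m, [/\ A m, forall n, A n -> (m <= n)%N & inf [set (n%:R : R) | n in A] = m%:R].
Proof.
move=> [n0 An0]; have ex : exists n, `[< A n >] by exists n0; apply/asboolP.
have /asboolP Am := xchooseP ex.
case: (ex_minnP ex) => m /asboolP mA mmin; exists m; split => // [n nA|].
  by apply: mmin; apply/asboolP.
have h n : A n -> (m%:R : R) <= n%:R by move=> nA; rewrite ler_nat mmin//; apply/asboolP.
apply/eqP; rewrite eq_le; apply/andP; split; last first.
  by apply: lb_le_inf => [|_ [n nA <-]]; [exists m%:R, m|exact: h].
by apply: ge_inf; [exists m%:R => _ [n nA <-]; exact: h|exists m].
Qed.

Section GeneratorDistance.
Context (R : realType) (S : doubling_igs).
Hypothesis hnd : non_degenerate S.
Local Notation V1 := (vert (gen S)).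
Local Notation ends1 := (@ends (gen S)).

Lemma generator_path (v w : V1) : exists s, path (adj ends1) v s /\ last v s = w.
Proof.
have /forallP/(_ v)/implyP := gen_connected S.
rewrite inE => /(_ isT)/forallP/(_ w)/implyP; rewrite inE => /(_ isT)/connectP[s ps ->].
exists s; split => //; apply: sub_path ps => x y /= /and3P[]//.
Qed.

Lemma graph_distE (v w : V1) : exists s, [/\ path (adj ends1) v s, last v s = w,
  graph_dist ends1 R v w = (size s)%:R &
  forall t, path (adj ends1) v t -> last v t = w -> (size s <= size t)%N].
Proof.
pose A := [set k | exists s, [/\ path (adj ends1) v s, last v s = w & size s = k]].
have A0 : A !=set0 by have [s [h1 h2]] := generator_path v w; exists (size s), s.
have [m [[s [h1 h2 h3]] mmin infE]] := inf_natr R A0.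
exists s; split => //; last by move=> t h4 h5; rewrite h3; apply: mmin; exists t.
rewrite h3 -infE /graph_dist; congr inf; apply/seteqP; split => x /=.
  by move=> [t [k1 k2] <-]; exists (size t) => //; exists t.
by move=> [k [t [k1 k2 <-]] <-]; exists t.
Qed.

(** Walk lengths are integers, so the infimum is attained and L_* is an integer; this integrality is
    used again when chains are projected. The lengths 0 and 1 are excluded by disjointness and
    non-degeneracy. *)
Lemma Lstar_nat : exists l : nat, [/\ Lstar R S = l%:R, (2 <= l)%N &
  forall a b t, path (adj ends1) (phipm S true a) t -> last (phipm S true a) t = phipm S false b ->
    (l <= size t)%N].
Proof.
pose A := [set k | exists v w, [/\ v \in Ipm S true, w \in Ipm S false & exists s,
   [/\ path (adj ends1) v s, last v s = w, size s = k & graph_dist ends1 R v w = (size s)%:R]]].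
have im s a : phipm S s a \in Ipm S s by rewrite imset_f.
have [a0 _] := label_ex S.
have A0 : A !=set0.
  have [s [h1 h2 h3 h4]] := graph_distE (phipm S true a0) (phipm S false a0).
  by exists (size s), (phipm S true a0), (phipm S false a0); split => //; exists s.
have [m [Am mmin infE]] := inf_natr R A0.
exists m; split.
- rewrite -infE /Lstar /graph_set_dist; congr inf; apply/seteqP; split => x /=.
    move=> [v vI [w wI <-]]; have [s [h1 h2 h3 h4]] := graph_distE v w.
    by exists (size s) => //; exists v, w; split => //; exists s.
  by move=> [k [v [w [h1 h2 [s [h3 h4 <- h5]]]]] <-]; exists v => //; exists w.
- case: Am => v [w [/imsetP[a _ ->] /imsetP[b _ ->] [s [h1 h2 <- _]]]].
  case: s h1 h2 => [_ /= /phipm_eq[]//|y [|//]] /=.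
  by rewrite andbT => h1 h2; move: h1; rewrite h2 (negPf (boundary_not_adj hnd _ _ _ _)).
- move=> a b t h1 h2; have [s [k1 k2 k3 k4]] := graph_distE (phipm S true a) (phipm S false b).
  apply: leq_trans (k4 _ h1 h2); apply: mmin.
  by exists (phipm S true a), (phipm S false b); split => //; exists s.
Qed.

Lemma Lstar_ge2 : 2 <= Lstar R S.
Proof. by have [l [-> l2 _]] := Lstar_nat; rewrite ler_nat. Qed.

(** The distance to I_+, truncated at L_* and divided by it. It is the profile by which functions on
    one level are extended to the next. *)
Lemma generator_potential : exists U : V1 -> R, [/\ forall v, 0 <= U v <= 1,
  forall a, U (phipm S true a) = 0, forall a, U (phipm S false a) = 1 &
  forall e : edge (gen S), `|U (gpole false e) - U (gpole true e)| <= (Lstar R S)^-1].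
Proof.
have [l [Ll l2 lmin]] := Lstar_nat.
have ex v : exists k, `[< exists a s, [/\ path (adj ends1) (phipm S true a) s, last (phipm S true a) s = v & size s = k] >].
  have [a0 _] := label_ex S; have [s [h1 h2]] := generator_path (phipm S true a0) v.
  by exists (size s); apply/asboolP; exists a0, s.
pose g v := ex_minn (ex v).
have gP v : exists a s, [/\ path (adj ends1) (phipm S true a) s, last (phipm S true a) s = v & size s = g v].
  by rewrite /g; case: ex_minnP => m /asboolP.
have gmin v a s : path (adj ends1) (phipm S true a) s -> last (phipm S true a) s = v -> (g v <= size s)%N.
  by move=> h1 h2; rewrite /g; case: ex_minnP => m _; apply; apply/asboolP; exists a, s.
have gadj v w : adj ends1 v w -> (g w <= (g v).+1)%N.
  move=> vw; have [a [s [h1 h2 h3]]] := gP v.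
  rewrite -h3 -(size_rcons s w); apply: (gmin _ a); last by rewrite last_rcons.
  by rewrite rcons_path h1 h2.
have l0 : 0 < (l%:R : R) by rewrite ltr0n; lia.
exists (fun v => (minn l (g v))%:R / l%:R); split => [v|a|a|e].
- by rewrite divr_ge0 ?ler0n//= ler_pdivrMr// mul1r ler_nat geq_minl.
- have : (g (phipm S true a) <= 0)%N by apply: (gmin _ a [::]).
  by rewrite leqn0 => /eqP->; rewrite minn0 mul0r.
- have [b [s [h1 h2 h3]]] := gP (phipm S false a).
  have := lmin _ _ _ h1 h2; rewrite h3 => /minn_idPl->; rewrite mulfV// gt_eqF//.
- rewrite -mulrBl normrM Ll normfV (gtr0_norm l0) ler_piMl ?invr_ge0 ?(ltW l0)//.
  have h1 := gadj _ _ (adj_pole e true); have h2 := gadj _ _ (adj_pole e false).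
  rewrite /= in h1 h2.
  have : (minn l (g (gpole false e)) <= (minn l (g (gpole true e))).+1)%N by lia.
  have : (minn l (g (gpole true e)) <= (minn l (g (gpole false e))).+1)%N by lia.
  rewrite -!(ler_nat R) -!natr1 ler_norml => h3 h4; apply/andP; split; lra.
Qed.
End GeneratorDistance.

(** * Chains of cells and the limit metric *)

Section Cells.
Context (S : doubling_igs).
Local Notation word := (word S).
Local Notation lvert := (lvert S).

Lemma vreprK n (v : lvert n.+1) : vclass (vrepr v).1 (vrepr v).2 = v.
Proof. by rewrite /vclass /vrepr -surjective_pairing; exact: reprK. Qed.

Lemma lpole_wcat n (e : word n) m i j (f g : word m) :
  lpole i f = lpole j g -> lpole i (wcat e f) = lpole j (wcat e g).
Proof.
elim: m i j f g => [|m IH] i j; first by move=> [] [] ij; have -> : i = j := ij.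
move=> [f x] [g y] /lpole_eq[[fg h]|[s [t [a [h1 h2 h3]]]]].
  by apply/(lpole_eq (n := (m + n)%N)); left; split => //; rewrite /= fg.
by apply/(lpole_eq (n := (m + n)%N)); right; exists s, t, a; split => //; exact: IH.
Qed.

Lemma sigma_vclass n (e : word n) m z (f : word m) :
  sigma (m := m.+1) e (vclass z f) = vclass z (wcat e f).
Proof.
rewrite /sigma; have := vreprK (vclass z f).
case: (vrepr (vclass z f)) => z' f' /= /vclass_eq[[-> ->]//|[s [t [a [h1 h2 h3]]]]].
by apply/vclass_eq; right; exists s, t, a; split => //; exact: lpole_wcat.
Qed.

Lemma sigma_lpole n (e : word n) m s (f : word m) :
  sigma e (lpole s f) = lpole s (wcat e f).
Proof. by case: m f => [[]//|m [f x]]; exact: sigma_vclass. Qed.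

(** Levels such as [m + j] and [n] may be equal without being convertible. Their vertices are
    compared in the common sigma-type, and [vtag_inj] recovers equality from the decidability of
    equality on [nat]. *)
Definition vtag n (v : lvert n) : {k : nat & (lvert k : Type)} := existT _ n v.

Lemma vtag_inj n (v w : lvert n) : vtag v = vtag w -> v = w.
Proof. exact: (Eqdep_dec.inj_pair2_eq_dec _ PeanoNat.Nat.eq_dec). Qed.

Definition incell j (e : word j) n (v : lvert n) :=
  exists m (u : lvert m), vtag (sigma e u) = vtag v.

Lemma incell_sigma j (e : word j) m (u : lvert m) : incell e (sigma e u).
Proof. by exists m, u. Qed.

(** Induction principle that replaces a vertex of a cell by some [sigma e u] without transport along
    an equality of levels. *)
Lemma incell_elim j (e : word j) (P : forall n, lvert n -> Prop) :
  (forall m (u : lvert m), P _ (sigma e u)) -> forall n (v : lvert n), incell e v -> P n v.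
Proof.
move=> h n v [m [u uv]].
have [Q HQ] : exists Q : {k : nat & (lvert k : Type)} -> Prop, forall k (x : lvert k), Q (vtag x) <-> P k x.
  by exists (fun x => P (projT1 x) (projT2 x)).
by apply/HQ; rewrite -uv; apply/HQ.
Qed.

Lemma cellE n (t : {j : 'I_n.+1 & word j}) v : (v \in cell t) <-> incell (tagged t) v.
Proof.
rewrite inE; split => [/existsP[u /eqP uv]|[m [u uv]]]; first by exists (n - tag t)%N, u.
have mn : (m = n - tag t)%N.
  have mtn : (m + tag t = n)%N := congr1 (@projT1 _ _) uv.
  by lia.
move: u uv; rewrite mn => u uv; apply/existsP; exists u; apply/eqP; exact: uv.
Qed.

Lemma incell_lpole j (e : word j) m i (f : word m) : incell e (lpole i (wcat e f)).
Proof. by rewrite -sigma_lpole; exact: incell_sigma. Qed.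

Lemma incell_self n (e : word n) v : incell e v <-> exists i, v = lpole i e.
Proof.
split=> [|[i ->]]; last by exists 0%N, i.
move=> [m [u uv]]; have m0 : m = 0%N.
  have : (m + n = n)%N := congr1 (@projT1 _ _) uv; lia.
move: u uv; rewrite m0 => u uv; exists u; by symmetry; exact: (vtag_inj uv).
Qed.

Lemma incell_prefix (u : symb S) j n i : (j <= n)%N -> incell (prefix_word j u) (lpole i (prefix_word n u)).
Proof.
move=> jn; rewrite -(subnK jn); set m := (n - j)%N.
pose w : symb S := fun k => u (k + j)%N.
have -> : prefix_word (m + j) u = wcat (prefix_word j u) (prefix_word m w).
  by elim: m => //= m ->.
exact: incell_lpole.
Qed.

Lemma incellS j (e : word j) n (v : lvert n.+1) : (j <= n)%N -> incell e v ->
  exists z f, v = vclass z f /\ forall i, incell e (lpole i f).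
Proof.
move=> jn iv; move: jn.
pose P k : lvert k -> Prop := match k return lvert k -> Prop with 0%N => fun _ => True
   | k'.+1 => fun v => (j <= k')%N -> exists z (f : word k'), v = vclass z f /\ forall i, incell e (lpole i f) end.
suff : P n.+1 v by [].
apply: incell_elim iv => -[|m] u.
  have H k (x : lvert k) : (k <= j)%N -> P k x by case: k x => [//|k] x kj; rewrite /P; lia.
  exact: H.
move=> _; exists (vrepr u).1, (wcat e (vrepr u).2); split => // i.
exact: incell_lpole.
Qed.

Lemma lends_pole n (e : word n) i : lends e = [set lpole i e; lpole (~~ i) e]%SET.
Proof. by case: i => //; rewrite /lends finset.setUC. Qed.

Lemma adj_lpole n (e : word n) i : adj (@lends S n) (lpole i e) (lpole (~~ i) e).
Proof. by apply/existsP; exists e; rewrite -lends_pole. Qed.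

Lemma adj_lpoleP n (v w : lvert n) : adj (@lends S n) v w ->
  exists e i, v = lpole i e /\ w = lpole (~~ i) e.
Proof.
move=> /existsP[e /eqP evw].
have /lendsP[i vi] : v \in lends e by rewrite evw !inE eqxx.
exists e, i; split => //.
have := esym evw; rewrite (lends_pole e i) vi => /setP/(_ (lpole (~~ i) e)).
rewrite !inE eqxx orbT => /orP[/eqP/lpole_inj|/eqP//].
by case: (i).
Qed.

Lemma connect_level n (v w : lvert n) : connect (adj (@lends S n)) v w.
Proof.
elim: n v w => [|n IH] v w.
  have h (i : bool) : connect (adj (@lends S 0)) i (~~ i).
    by apply: connect1; exact: (@adj_lpole 0 tt i).
  by case: v w => [] []; [exact: connect0|exact: (h true)|exact: (h false)|exact: connect0].
have one (e : word n) z z' : connect (adj (@lends S n.+1)) (vclass z e) (vclass z' e).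
  have [s [ps <-]] := generator_path z z'.
  elim: s z ps => [|y s IHs] z /=; first by rewrite connect0.
  case/andP => /adj_poleP[x [i [-> ->]]] /IHs; apply: connect_trans; apply: connect1.
  by rewrite -!lpoleS; exact: adj_lpole.
rewrite -(vreprK v) -(vreprK w).
move: (vrepr v) (vrepr w) => [z e] [z' f] /=.
have [s [ps ls]] : exists s, path (adj (@lends S n)) (lpole true e) s /\ last (lpole true e) s = lpole true f.
  by have /connectP[s ps ->] := IH (lpole true e) (lpole true f); exists s.
have [a _] := label_ex S.
have glue i k (g h : word n) : lpole i g = lpole k h -> vclass (phipm S i a) g = vclass (phipm S k a) h.
  by move=> gh; apply/vclass_eq; right; exists i, k, a.
suff H i g : path (adj (@lends S n)) (lpole i g) s -> last (lpole i g) s = lpole true f ->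
    connect (adj (@lends S n.+1)) (vclass z g) (vclass z' f) by exact: H ls.
move=> {ps ls}; elim: s g z i => [|y s IHs] g x i /=.
  by move=> _ h; apply: connect_trans (one g x (phipm S i a)) _; rewrite (glue _ _ _ _ h).
case/andP => /adj_lpoleP[g' [k [h1 ->]]] ps h.
apply: connect_trans (one g x (phipm S i a)) _; rewrite (glue _ _ _ _ h1).
exact: IHs ps h.
Qed.

Lemma incell_root n (v : lvert n) : incell (tt : word 0) v.
Proof.
suff H m (f : word m) : existT (fun k => word k : Type) (m + 0)%N (wcat (tt : word 0) f) = existT _ m f.
  case: n v => [|m] v; first by exists 0%N, v; case: v.
  exists m.+1, v; rewrite -[v]vreprK sigma_vclass.
  pose F z (x : {k & (word k : Type)}) := vtag (vclass z (projT2 x)).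
  exact: (congr1 (F (vrepr v).1) (H m (vrepr v).2)).
elim: m f => [[]//|m IH] [f x].
pose F (y : {k & (word k : Type)}) : {k & (word k : Type)} := existT (fun k => word k : Type) (projT1 y).+1 (projT2 y, x).
exact: (congr1 F (IH f)).
Qed.

Lemma incell_at j (e : word j) m (v : lvert (m + j)) : incell e v -> exists u, v = sigma e u.
Proof.
move=> [m' [u uv]]; have mm : m' = m.
  have : (m' + j = m + j)%N := congr1 (@projT1 _ _) uv; lia.
by move: u uv; rewrite mm => u /vtag_inj <-; exists u.
Qed.

Lemma connect_cell j (e : word j) n (v w : lvert n) (C : {set lvert n}) :
  (forall x, incell e x -> x \in C) -> incell e v -> incell e w ->
  connect (path_inside (@lends S n) C) v w.
Proof.
move=> eC iv iw; move: w iw C eC.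
apply: (incell_elim (P := fun n v => forall (w : lvert n), incell e w -> forall C : {set lvert n},
  (forall x, incell e x -> x \in C) -> connect (path_inside (@lends S n) C) v w)) iv => m u w iw C eC.
have [u' ->] := incell_at iw.
have /connectP[s ps ->] := connect_level u u'.
elim: s u ps => [|y s IH] u /=; first by rewrite connect0.
case/andP => uy /IH; apply: connect_trans; apply: connect1.
apply/and3P; split; [exact: eC (incell_sigma _ _)|exact: eC (incell_sigma _ _)|].
have [f [i [-> ->]]] := adj_lpoleP uy.
by rewrite !sigma_lpole; exact: adj_lpole.
Qed.

Definition cword := {j : nat & word j}.
(** Connectedness of a union of cells is tested along the edges of G_n, and such an edge need not
    belong to any of the cells; hence the second alternative. *)
Definition ctouch n (c d : cword) := exists v w : lvert n,
  [/\ incell (tagged c) v, incell (tagged d) w & v = w \/ adj (@lends S n) v w].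

Fixpoint chain n (c : cword) (s : seq cword) : Prop :=
  if s is d :: s' then ctouch n c d /\ chain n d s' else True.

Lemma chain_cat n c s t : chain n c (s ++ t) <-> chain n c s /\ chain n (last c s) t.
Proof. by elim: s c => [|d s IH] c /=; [tauto|rewrite IH; tauto]. Qed.

Lemma ler_sum_subset (R : numDomainType) (T : eqType) (F : T -> R) (r l : seq T) :
  (forall x, 0 <= F x) -> uniq r -> {subset r <= l} -> \sum_(x <- r) F x <= \sum_(x <- l) F x.
Proof.
move=> F0; elim: r l => [|x r IH] l; first by rewrite big_nil sumr_ge0.
move=> /andP[xr ur] sub; have xl : x \in l by apply: sub; rewrite inE eqxx.
rewrite big_cons (perm_big _ (perm_to_rem xl)) big_cons lerD2l IH// => y yr.
have : y \in l by apply: sub; rewrite inE yr orbT.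
rewrite (perm_mem (perm_to_rem xl)) inE => /orP[/eqP yx|//].
by move: xr; rewrite -yx yr.
Qed.

Section ChainDistance.
Context (R : realType).
Local Notation L := (Lstar R S).
Hypothesis L1 : 1 < L.

Let L0 : 0 < L. Proof. exact: lt_trans ltr01 L1. Qed.

Definition cost (s : seq cword) : R := \sum_(c <- s) L ^- (tag c).

Lemma cost_cons c s : cost (c :: s) = L ^- (tag c) + cost s.
Proof. exact: big_cons. Qed.

Definition Omega_ok n (v w : lvert n) (Omega : {set {j : 'I_n.+1 & word j}}) :=
  let C := (\bigcup_(t in Omega) cell t)%SET in
  [/\ connected_set (@lends S n) C, v \in C & w \in C].

Definition Omega_cost n (Omega : {set {j : 'I_n.+1 & word j}}) : R :=
  \sum_(t in Omega) L ^- (tag t).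

Lemma ldist_le n (v w : lvert n) Omega : Omega_ok v w Omega -> ldist R v w <= Omega_cost Omega.
Proof.
move=> ok; rewrite /ldist; case: eqP => _.
  by apply: sumr_ge0 => t _; rewrite invr_ge0 exprn_ge0// ltW.
apply: ge_inf; last by exists Omega.
by exists 0 => _ [Om _ <-]; apply: sumr_ge0 => t _; rewrite invr_ge0 exprn_ge0// ltW.
Qed.

Definition tocw n (t : {j : 'I_n.+1 & word j}) : cword := Tagged (fun j => word j : Type) (tagged t).

(** Together with [Omega_chain] this replaces connected families of cells by chains. A cell that the
    chain visits repeatedly is paid for only once in the family. *)
Lemma chain_Omega n c s (v w : lvert n) : all (fun d : cword => (tag d <= n)%N) (c :: s) ->
  chain n c s -> incell (tagged c) v -> incell (tagged (last c s)) w ->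
  exists2 Omega, Omega_ok v w Omega & Omega_cost Omega <= cost (c :: s).
Proof.
move=> small ch iv iw.
pose Omega := [set t : {j : 'I_n.+1 & word j} | tocw t \in c :: s]%SET.
pose C := (\bigcup_(t in Omega) cell t)%SET.
have inC d x : d \in c :: s -> incell (tagged d) x -> x \in C.
  move=> ds ix; have dn : (tag d < n.+1)%N by rewrite ltnS; move/allP: small => /(_ _ ds).
  apply/bigcupP; exists (Tagged (fun j : 'I_n.+1 => word j : Type) (i := Ordinal dn) (tagged d)).
    by rewrite inE /tocw /=; case: d ds {ix dn}.
  by apply/cellE.
have Cin x : x \in C -> exists2 d, d \in c :: s & incell (tagged d) x.
  by move=> /bigcupP[t]; rewrite inE => ts /cellE ix; exists (tocw t).
have conn : forall x y, x \in C -> y \in C -> connect (path_inside (@lends S n) C) x y.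
  have sym : connect_sym (path_inside (@lends S n) C).
    have asym x y : adj (@lends S n) x y -> adj (@lends S n) y x.
      by move=> /existsP[e h]; apply/existsP; exists e; rewrite finset.setUC.
    apply: sym_connect_sym => x y.
    by apply/idP/idP => /and3P[h1 h2 /asym h3]; apply/and3P.
  have vx' s' : forall (c' : cword) v', chain n c' s' -> incell (tagged c') v' ->
      {subset c' :: s' <= c :: s} -> forall (d : cword) x, d \in c' :: s' -> incell (tagged d) x ->
      connect (path_inside (@lends S n) C) v' x.
    elim: s' {v iv ch iw} => [|d' s' IH] c' y /= ch iv sub d x.
      rewrite inE => /eqP-> ix; apply: (connect_cell _ iv ix) => z; apply: inC.
      by apply: sub; rewrite inE.
    rewrite inE => /orP[/eqP->|ds] ix.
      by apply: (connect_cell _ iv ix) => z; apply: inC; apply: sub; rewrite inE eqxx.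
    case: ch => -[v1 [w1 [h1 h2 h3]]] ch.
    have c'in : c' \in c :: s by apply: sub; rewrite inE eqxx.
    have d'in : d' \in c :: s by apply: sub; rewrite !inE eqxx orbT.
    apply: connect_trans (_ : connect _ y v1) _.
      by apply: (connect_cell _ iv h1) => z; exact: inC.
    apply: connect_trans (_ : connect _ v1 w1) _.
      case: h3 => [->|h3]; first exact: connect0.
      by apply/connect1/and3P; split; [exact: inC h1|exact: inC h2|].
    apply: (IH d' w1 ch h2 _ d x ds ix) => z zs; apply: sub; by rewrite inE zs orbT.
  have vx x (d : cword) : d \in c :: s -> incell (tagged d) x -> connect (path_inside (@lends S n) C) v x.
    exact: (vx' s c v ch iv).
  move=> x y /Cin[d ds ix] /Cin[d' ds' iy].
  by apply: (@connect_trans _ _ v); [rewrite sym; exact: vx ix|exact: vx iy].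
exists Omega.
  split; [|exact: (inC c v (mem_head _ _) iv)|exact: (inC _ w (mem_last c s) iw)].
    apply/forallP => x; apply/implyP => xC; apply/forallP => y; apply/implyP => yC.
    exact: conn.
rewrite /Omega_cost /cost.
have inj : {in Omega &, injective (@tocw n)}.
  move=> [[j1 h1] e1] [[j2 h2] e2] _ _ /= h.
  have jj : j1 = j2 := congr1 (@projT1 _ _) h.
  move: h1 e1 h; rewrite jj => h1 e1 h; rewrite (bool_irrelevance h1 h2) in e1 h *.
  have -> : e1 = e2 by exact: (Eqdep_dec.inj_pair2_eq_dec _ PeanoNat.Nat.eq_dec _ _ _ _ h).
  by [].
rewrite -[leLHS]big_enum -(big_map (@tocw n) predT (fun c : cword => L ^- (tag c))).
apply: ler_sum_subset => [d||d].
- by rewrite invr_ge0 exprn_ge0// ltW.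
- by rewrite map_inj_in_uniq ?enum_uniq// => t t'; rewrite !mem_enum; exact: inj.
- by case/mapP => t; rewrite mem_enum inE => ts ->.
Qed.

Lemma Omega_chain n (v w : lvert n) Omega : Omega_ok v w Omega ->
  exists c s, [/\ all (fun d : cword => (tag d <= n)%N) (c :: s), chain n c s,
    incell (tagged c) v, incell (tagged (last c s)) w & cost (c :: s) <= Omega_cost Omega].
Proof.
move=> [conn vC wC]; set C := (\bigcup_(t in Omega) cell t)%SET in conn vC wC.
pose ct : rel {j : 'I_n.+1 & word j} := fun t t' => [&& t \in Omega, t' \in Omega &
  `[< ctouch n (tocw t) (tocw t') >]].
have /connectP[s ps ws] : connect (path_inside (@lends S n) C) v w.
  by move/forallP: conn => /(_ v)/implyP/(_ vC)/forallP/(_ w)/implyP/(_ wC).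
have cov x : x \in C -> exists2 t, t \in Omega & incell (tagged t) x.
  by move=> /bigcupP[t tO /cellE h]; exists t.
have [t0 t0O vt0] := cov _ vC.
have [t1 [t1O wt1 c01]] : exists t1, [/\ t1 \in Omega, incell (tagged t1) w & connect ct t0 t1].
  rewrite ws; elim: s v {vC} t0 t0O vt0 ps {ws} => [|y s IH] x t tO xt /=.
    by move=> _; exists t.
  move=> /andP[/and3P[_ yC xy] ps].
  have [t' t'O yt'] := cov _ yC.
  have [t1 [h1 h2 h3]] := IH _ _ t'O yt' ps.
  exists t1; split => //; apply: connect_trans h3; apply: connect1.
  by apply/and3P; split => //; apply/asboolP; exists x, y; split => //; right.
(* A path without repetitions uses each cell of [Omega] at most once, so its cost does not exceed
   that of [Omega]. *)
have /connectP[r pr rt1] := c01; case/shortenP: pr rt1 => r' pr' ur' _ t1E.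
exists (tocw t0), (map (@tocw n) r'); split.
- by apply/allP => d; rewrite -map_cons => /mapP[t _ ->]; rewrite /= -ltnS.
- elim: r' t0 pr' {ur' t1E t0O vt0 c01} => [//|t r' IH] t0 /= /andP[/and3P[_ _ /asboolP h] /IH h'].
  by split.
- by [].
- by rewrite last_map -t1E.
have sub : {subset t0 :: r' <= Omega}.
  move=> t; rewrite inE => /orP[/eqP->//|].
  elim: r' (t0) pr' {ur' t1E} => [//|t2 r' IH] t3 /= /andP[/and3P[_ h _] /IH h'].
  by rewrite inE => /orP[/eqP->//|].
rewrite /cost -map_cons big_map /Omega_cost -[leRHS]big_enum /=.
apply: (@ler_sum_subset _ _ (fun t : {j : 'I_n.+1 & word j} => L ^- (tag t))) => [t|//|t tr].
  by rewrite invr_ge0 exprn_ge0// ltW.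
by rewrite mem_enum; exact: sub.
Qed.

End ChainDistance.
End Cells.

(** * Cut-off functions, projection of chains and existence of the limit distance *)

Section Extension.
Context (R : realType) (S : doubling_igs).
Local Notation word := (word S).
Local Notation lvert := (lvert S).
Local Notation V1 := (vert (gen S)).
Local Notation L := (Lstar R S).
Context (u1 : V1 -> R).
Hypothesis u1_01 : forall v, 0 <= u1 v <= 1.
Hypothesis u1_plus : forall a, u1 (phipm S true a) = 0.
Hypothesis u1_minus : forall a, u1 (phipm S false a) = 1.
Hypothesis u1_grad : forall e : edge (gen S), `|u1 (gpole false e) - u1 (gpole true e)| <= L^-1.
Hypothesis L2 : 2 <= L.
Let L0 : 0 < L. Proof. exact: lt_le_trans L2. Qed.
Let L1 : 1 < L. Proof. by rewrite (lt_le_trans _ L2)// ltr1n. Qed.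

(** Inside each cell the end values are interpolated by [u1], which is 0 on I_+ and 1 on I_-. Hence
    the values match at glued vertices, and gradients shrink at least by the factor L. *)
Definition ext n (U : lvert n -> R) (v : lvert n.+1) : R :=
  U (lpole true (vrepr v).2) + (U (lpole false (vrepr v).2) - U (lpole true (vrepr v).2)) * u1 (vrepr v).1.

Lemma ext_vclass n (U : lvert n -> R) z e : ext U (vclass z e) =
  U (lpole true e) + (U (lpole false e) - U (lpole true e)) * u1 z.
Proof.
rewrite /ext; have := vreprK (vclass z e).
case: (vrepr (vclass z e)) => z' e' /= /vclass_eq[[-> ->]//|[s [t [a [h1 -> ->]]]]].
have u1E i (f : word n) : U (lpole true f) + (U (lpole false f) - U (lpole true f)) * u1 (phipm S i a) = U (lpole i f).
  case: i; first by rewrite u1_plus mulr0 addr0.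
  by rewrite u1_minus mulr1 addrC subrK.
by rewrite !u1E h1.
Qed.

Lemma ext_bounds n (U : lvert n -> R) z e a b : a <= U (lpole true e) <= b -> a <= U (lpole false e) <= b ->
  a <= ext U (vclass z e) <= b.
Proof.
rewrite ext_vclass => /andP[h1 h2] /andP[h3 h4]; have /andP[h5 h6] := u1_01 z.
have -> : U (lpole true e) + (U (lpole false e) - U (lpole true e)) * u1 z =
  (1 - u1 z) * U (lpole true e) + u1 z * U (lpole false e) by ring.
set t := u1 z in h5 h6 *.
have h7 : 0 <= 1 - t by rewrite subr_ge0.
apply/andP; split.
  have -> : a = (1 - t) * a + t * a by ring.
  by rewrite lerD// ler_wpM2l.
have -> : b = (1 - t) * b + t * b by ring.
by rewrite lerD// ler_wpM2l.
Qed.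

Lemma ext_grad n (U : lvert n -> R) (e : word n) x :
  `|ext U (lpole (n := n.+1) false (e, x)) - ext U (lpole (n := n.+1) true (e, x))|
  <= `|U (lpole false e) - U (lpole true e)| / L.
Proof.
rewrite !lpoleS !ext_vclass.
have -> : forall A B C D : R, A + (B - A) * C - (A + (B - A) * D) = (B - A) * (C - D) by move=> *; ring.
by rewrite normrM ler_wpM2l.
Qed.

Lemma ext_lip n (U : lvert n -> R) c (v w : lvert n.+1) :
  (forall e, `|U (lpole false e) - U (lpole true e)| <= c) -> adj (@lends S n.+1) v w ->
  `|ext U v - ext U w| <= c / L.
Proof.
move=> Uc /adj_lpoleP[[e x] [i [-> ->]]].
have h : `|ext U (lpole (n := n.+1) false (e, x)) - ext U (lpole (n := n.+1) true (e, x))| <= c / L.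
  by apply: le_trans (ext_grad U e x) _; rewrite ler_wpM2r ?invr_ge0 ?(ltW L0).
by case: i; [rewrite distrC|].
Qed.

Section Separation.
Context (u : symb S) (N : nat).

Definition ends_ind k (v : lvert k) : R := (v \in lends (prefix_word k u))%:R.

(** A cut-off around the cell of the prefix of length [N] of [u]: at level [N] the indicator of its
    two ends, afterwards the extension by [ext]. At a level k >= N its gradients are at most L^N /
    L^k. *)
Fixpoint Phi k : lvert k -> R :=
  if k is k'.+1 return lvert k -> R then
    if (k'.+1 <= N)%N then @ends_ind k'.+1 else ext (@Phi k')
  else @ends_ind 0.

Lemma Phi_le k : (k <= N)%N -> @Phi k = @ends_ind k.
Proof. by case: k => [//|k] kN; rewrite /= kN. Qed.

Lemma Phi_gt k : (N <= k)%N -> @Phi k.+1 = ext (@Phi k).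
Proof. by move=> Nk; rewrite /= ltnNge Nk. Qed.

Lemma Phi_01 k v : 0 <= @Phi k v <= 1.
Proof.
elim: k v => [|k IH] v; first by rewrite Phi_le// /ends_ind; case: (_ \in _); rewrite ?lexx ?ler01.
have [kN|Nk] := leqP k.+1 N.
  by rewrite Phi_le// /ends_ind; case: (_ \in _); rewrite ?lexx ?ler01.
by rewrite Phi_gt// -[v]vreprK; apply: ext_bounds.
Qed.

Lemma Phi_grad k (e : word k) : (N <= k)%N ->
  `|@Phi k (lpole false e) - @Phi k (lpole true e)| <= L ^+ N / L ^+ k.
Proof.
move=> Nk; move: e; rewrite -(subnK Nk); elim: (k - N)%N => [|m IH] e.
  have -> : L ^+ (0 + N) = L ^+ N by [].
  rewrite mulfV ?expf_neq0 ?gt_eqF//.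
  have /andP[h1 h2] := Phi_01 (lpole true e : lvert (0 + N)).
  have /andP[h3 h4] := Phi_01 (lpole false e : lvert (0 + N)).
  by rewrite ler_norml; apply/andP; split; lra.
case: e => e x; rewrite (Phi_gt (leq_addl m N)).
apply: le_trans (ext_grad _ e x) _; rewrite exprS invfM mulrCA mulrC.
by rewrite ler_wpM2l ?invr_ge0 ?(ltW L0).
Qed.

Lemma Phi_cell j (e : word j) m (v : lvert m) : (N <= j)%N ->
  exists2 t, 0 <= t <= 1 & Phi (sigma e v) =
   Phi (lpole true e) + (Phi (lpole false e) - Phi (lpole true e)) * t.
Proof.
move=> Nj; elim: m v => [|m IH] v.
  exists (~~ (v : bool))%:R; first by case: (v : bool); rewrite ?lexx ?ler01.
  by case: v => /=; rewrite ?mulr0 ?addr0 ?mulr1 1?addrC ?subrK.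
rewrite -[v]vreprK sigma_vclass Phi_gt; last by rewrite (leq_trans Nj)// leq_addl.
move: (vrepr v) => [z f] /=; rewrite ext_vclass -!sigma_lpole.
have [t1 /andP[h1 h2] ->] := IH (lpole true f); have [t2 /andP[h3 h4] ->] := IH (lpole false f).
have /andP[h5 h6] := u1_01 z.
exists (t1 + (t2 - t1) * u1 z); last by ring.
have -> : t1 + (t2 - t1) * u1 z = (1 - u1 z) * t1 + u1 z * t2 by ring.
set c := u1 z in h5 h6 *; have c0 : 0 <= 1 - c by rewrite subr_ge0.
rewrite addr_ge0 ?mulr_ge0//=.
rewrite -[leRHS](_ : (1 - c) * 1 + c * 1 = 1); last by ring.
by rewrite lerD// ler_wpM2l.
Qed.

Lemma Phi_osc j (e : word j) n (v w : lvert n) : (N <= n)%N -> incell e v -> incell e w ->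
  `|Phi v - Phi w| <= L ^+ N / L ^+ j.
Proof.
move=> Nn iv iw; have [Nj|jN] := leqP N j; last first.
  have /andP[h1 h2] := Phi_01 v; have /andP[h3 h4] := Phi_01 w.
  apply: (@le_trans _ _ 1); first by rewrite ler_norml; apply/andP; split; lra.
  by rewrite ler_pdivlMr ?exprn_gt0// mul1r ler_weXn2l ?(ltW L1) ?(ltnW jN).
move: w iw; apply: (incell_elim (P := fun n v => forall w : lvert n, incell e w -> `|Phi v - Phi w| <= L ^+ N / L ^+ j)) iv.
move=> m x w /incell_at[y ->].
have [t1 /andP[h1 h2] ->] := Phi_cell e x Nj; have [t2 /andP[h3 h4] ->] := Phi_cell e y Nj.
have -> : forall A B C D : R, A + (B - A) * C - (A + (B - A) * D) = (C - D) * (B - A) by move=> *; ring.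
rewrite normrM -[leRHS]mul1r ler_pM//; first by rewrite ler_norml; apply/andP; split; lra.
exact: Phi_grad.
Qed.

Lemma Phi_in n i : (N <= n)%N -> Phi (lpole i (prefix_word n u)) = 1.
Proof.
move=> Nn; rewrite -(subnK Nn); elim: (n - N)%N i => [|m IH] i.
  rewrite add0n Phi_le// /ends_ind; case: (lendsP _ _) => //; case.
  by exists i.
rewrite addSn Phi_gt ?leq_addl// lpoleS ext_vclass !IH subrr mul0r addr0//.
Qed.

Lemma Phi_out n i w : (N <= n)%N -> ~ touch (prefix_word N u) (prefix_word N w) ->
  Phi (lpole i (prefix_word n w)) = 0.
Proof.
move=> Nn uw; rewrite -(subnK Nn); elim: (n - N)%N i => [|m IH] i.
  rewrite add0n Phi_le// /ends_ind; case: (lendsP _ _) => // -[j ij]; case: uw.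
  by exists j, i.
rewrite addSn Phi_gt ?leq_addl// lpoleS ext_vclass !IH subrr mul0r addr0//.
Qed.

(** In a cell c the cut-off varies by at most L^N / L^|c|, and along an edge leading from it to the
    next cell by no more than that; hence the factor 2. *)
Lemma Phi_chain n c s (v w : lvert n) : (N <= n)%N ->
  all (fun d : cword S => (tag d <= n)%N) (c :: s) -> chain n c s ->
  incell (tagged c) v -> incell (tagged (last c s)) w ->
  `|Phi v - Phi w| <= 2 * L ^+ N * cost R (c :: s).
Proof.
move=> Nn; have LN : 0 <= L ^+ N by rewrite exprn_ge0// ltW.
elim: s c v => [|d s IH] c v /=.
  move=> _ _ iv iw; apply: le_trans (Phi_osc Nn iv iw) _.
  rewrite /cost big_seq1 -mulrA; apply: ler_peMl; last by rewrite ler1n.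
  by rewrite mulr_ge0// invr_ge0 exprn_ge0// ltW.
rewrite (cost_cons R c) => /andP[cn small] [[v1 [w1 [h1 h2 h3]]] ch] iv iw.
have := IH d w1 small ch h2 iw.
have := Phi_osc Nn iv h1.
have : `|Phi v1 - Phi w1| <= L ^+ N / L ^+ tag c.
  apply: (@le_trans _ _ (L ^+ N / L ^+ n)); last first.
    by rewrite ler_wpM2l// lef_pV2 ?posrE ?exprn_gt0// ler_weXn2l ?(ltW L1).
  case: h3 => [->|/adj_lpoleP[e [i [-> ->]]]].
    by rewrite subrr normr0 mulr_ge0// invr_ge0 exprn_ge0// ltW.
  by case: i; [rewrite distrC|]; exact: Phi_grad.
move=> k1 k2 k3.
rewrite -[Phi v - Phi w](subrKA (Phi v1)) -[Phi v1 - Phi w](subrKA (Phi w1)).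
apply: le_trans (ler_normD _ _) _; rewrite mulrDr.
have -> : 2 * L ^+ N * L ^- tag c = L ^+ N / L ^+ tag c + L ^+ N / L ^+ tag c by rewrite mulr2n !mulrDl !mul1r.
by apply: le_trans (lerD k2 (le_trans (ler_normD _ _) (lerD k1 k3))) _; rewrite addrA.
Qed.
End Separation.

Lemma Omega_root n (v w : lvert n) : exists2 Om, Omega_ok v w Om & Omega_cost R Om <= 1.
Proof.
pose c : cword S := Tagged (fun j => word j : Type) (tt : word 0).
have [Om h1 h2] := @chain_Omega S R L1 n c [::] v w isT I (incell_root v) (incell_root w).
by exists Om => //; apply: le_trans h2 _; rewrite /cost big_seq1 expr0 invr1.
Qed.

Lemma le_ldist n (v w : lvert n) c : v <> w ->
  (forall Om, Omega_ok v w Om -> c <= Omega_cost R Om) -> c <= ldist R v w.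
Proof.
move=> /eqP/negbTE vw h; rewrite /ldist vw; apply: lb_le_inf.
  by have [Om h1 _] := Omega_root v w; exists (Omega_cost R Om); exists Om.
by move=> _ [Om ok <-]; exact: h.
Qed.

(** The cut-off is 1 at the first vertex and 0 at the second, so every chain between them costs at
    least L^-N / 2. *)
Lemma ldist_disjoint (u w : symb S) N n i j : (N <= n)%N -> ~ touch (prefix_word N u) (prefix_word N w) ->
  L ^- N / 2 <= ldist R (lpole i (prefix_word n u)) (lpole j (prefix_word n w)).
Proof.
move=> Nn uw; have h1 := @Phi_in u N n i Nn; have h2 := @Phi_out u N n j w Nn uw.
apply: le_ldist => [e|Om ok]; first by move: h1; rewrite e h2 => /eqP; rewrite eq_sym oner_eq0.
have [c [s [small ch iv iw le]]] := Omega_chain L1 ok; apply: le_trans le.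
have := @Phi_chain u N n c s _ _ Nn small ch iv iw; rewrite h1 h2 subr0 normr1.
by rewrite -ler_pdivrMl ?mulr_gt0 ?exprn_gt0// mulr1 invfM mulrC.
Qed.

Definition adist (u w : symb S) n : R :=
  inf [set ldist R v v' | v in [set` lends (prefix_word n u)] & v' in [set` lends (prefix_word n w)]].

Lemma ldist_ge0 n (v w : lvert n) : 0 <= ldist R v w.
Proof.
have [->|/eqP vw] := eqVneq v w; first by rewrite /ldist eqxx.
by apply: le_ldist => // Om _; apply: sumr_ge0 => t _; rewrite invr_ge0 exprn_ge0// ltW.
Qed.

Lemma adist_le u w n i j : adist u w n <= ldist R (lpole i (prefix_word n u)) (lpole j (prefix_word n w)).
Proof.
apply: ge_inf; first by exists 0 => _ [v _ [v' _ <-]]; exact: ldist_ge0.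
exists (lpole i (prefix_word n u)); first by apply/lendsP; exists i.
by exists (lpole j (prefix_word n w)) => //; apply/lendsP; exists j.
Qed.

Lemma le_adist u w n c : (forall i j, c <= ldist R (lpole i (prefix_word n u)) (lpole j (prefix_word n w))) ->
  c <= adist u w n.
Proof.
move=> h; apply: lb_le_inf.
  exists (ldist R (lpole true (prefix_word n u)) (lpole true (prefix_word n w))).
  exists (lpole true (prefix_word n u)); first by apply/lendsP; exists true.
  by exists (lpole true (prefix_word n w)) => //; apply/lendsP; exists true.
by move=> _ [v /= /lendsP[i ->] [v' /= /lendsP[j ->] <-]].
Qed.

Lemma adist_chain u w n c s i j : all (fun d : cword S => (tag d <= n)%N) (c :: s) -> chain n c s ->
  incell (tagged c) (lpole i (prefix_word n u)) -> incell (tagged (last c s)) (lpole j (prefix_word n w)) ->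
  adist u w n <= cost R (c :: s).
Proof.
move=> small ch iv iw; have [Om ok le] := chain_Omega L1 small ch iv iw.
by apply: le_trans (adist_le u w n i j) _; apply: le_trans (ldist_le L1 ok) le.
Qed.

Section Projection.
Context (n : nat) (c : cword S).

Fixpoint reach m (k : nat) (v : lvert m) : Prop :=
  if k is k'.+1 then reach k' v \/ exists2 y, reach k' y & adj (@lends S m) y v
  else incell (tagged c) v.

(* Consecutive cells of a chain may be joined by an edge, so every second edge of a walk suffices. *)
Lemma reach_bridge m (y : lvert n) : reach m y ->
  exists s, [/\ all (fun d : cword S => (tag d == n)%N) s, chain n c s, (2 * size s <= m)%N &
    forall d : cword S, incell (tagged d) y -> ctouch n (last c s) d].
Proof.
elim/ltn_ind: m y => m IH y.
case: m IH => [|m] IH /=.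
  by move=> iy; exists [::]; split => // d id; exists y, y; split => //; left.
case=> [h|[x rx xy]].
  have [s [h1 h2 h3 h4]] := IH m (ltnSn m) y h; exists s; split => //; lia.
case: m IH rx => [|m] IH /= rx.
  by exists [::]; split => // d id; exists x, y; split => //; right.
case: rx => [rx|[w rw wx]].
  have [s [h1 h2 h3 h4]] := IH m.+1 (ltnSn _) y (or_intror (ex_intro2 _ _ x rx xy)).
  by exists s; split => //; lia.
have [s [h1 h2 h3 h4]] := IH m (ltnW (ltnSn m.+1)) w rw.
have [e [i [wE xE]]] := adj_lpoleP wx.
pose g : cword S := Tagged (fun j => Defs.word S j : Type) e.
have gi v : v = w \/ v = x -> incell (tagged g) v.
  by case=> ->; apply/incell_self; [exists i|exists (~~ i)].
exists (rcons s g); split.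
- by rewrite all_rcons h1 /= eqxx.
- by rewrite -cats1; apply/chain_cat; split => //=; split => //; apply: h4; apply: gi; left.
- rewrite size_rcons; lia.
- by move=> d id; rewrite last_rcons; exists x, y; split => //; [apply: gi; right|right].
Qed.
Hypothesis cn : (tag c <= n)%N.

Lemma reach_ex (v : lvert n) : exists k, reach k v.
Proof.
have inh : exists x : lvert n, incell (tagged c) x.
  rewrite -(subnK cn); exists (sigma (tagged c) (lpole true (word0 S _))); exact: incell_sigma.
have [x ix] := inh; have /connectP[s ps ->] := connect_level x v.
suff [k] : exists k, reach k (last x s) by exists k.
have : exists k, reach k x by exists 0%N.
elim: s x ps {ix} => [//|y s IH] x /= /andP[xy ps] [k hk].
by apply: IH => //; exists k.+1; right; exists x.
Qed.

Lemma reach_asbool (v : lvert n) : exists k, `[< reach k v >].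
Proof. by have [k hk] := reach_ex v; exists k; apply/asboolP. Qed.

Definition cdist (v : lvert n) : nat := ex_minn (reach_asbool v).

Lemma cdistP v : reach (cdist v) v.
Proof. by rewrite /cdist; case: ex_minnP => k /asboolP. Qed.

Lemma cdist_min k v : reach k v -> (cdist v <= k)%N.
Proof. by move=> h; rewrite /cdist; case: ex_minnP => m _; apply; apply/asboolP. Qed.

Lemma cdist_adj v w : adj (@lends S n) v w -> (cdist w <= (cdist v).+1)%N.
Proof. by move=> vw; apply: cdist_min; right; exists v => //; exact: cdistP. Qed.

Lemma cdist_grad (e : word n) : `|(cdist (lpole false e))%:R - (cdist (lpole true e))%:R| <= (1 : R).
Proof.
have := cdist_adj (adj_lpole e true); have := cdist_adj (adj_lpole e false) => /=.
rewrite -!(ler_nat R) -!natr1 ler_norml => h1 h2; apply/andP; split; lra.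
Qed.

(* The extension to level [n+1] of the distance at level [n] has slope at most [1 / L]. *)
Lemma reach_project k (d : cword S) (x : lvert n.+1) : (tag d <= n)%N ->
  reach k x -> incell (tagged d) x ->
  exists m y, [/\ incell (tagged d) y, @reach n m y & m%:R * L <= k%:R].
Proof.
move=> dn rx ix; pose U (v : lvert n) : R := (cdist v)%:R.
have bound m (v : lvert n.+1) : reach m v -> ext U v <= m%:R / L.
  elim: m v => [|m IH] v /=.
    move=> /(incellS cn)[z [f [-> h]]].
    have U0 i : U (lpole i f) = 0.
      by rewrite /U; have := cdist_min (h i : reach 0 (lpole i f)); rewrite leqn0 => /eqP->.
    by rewrite ext_vclass !U0 subrr mul0r addr0 mul0r.
  move=> [/IH h|[y /IH h yv]].
    by apply: le_trans h _; rewrite ler_wpM2r ?invr_ge0 ?(ltW L0)// ler_nat.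
  have := @ext_lip n U 1 y v cdist_grad yv; rewrite ler_norml => /andP[h1 _].
  by rewrite -natr1 mulrDl; move: h1 h; rewrite -/U; move: (ext U v) (ext U y) (m%:R / L) (1 / L) => a b c' d'; lra.
have := bound _ _ rx; have [z [f [xE h]]] := incellS dn ix.
have [i Hi] : exists i, U (lpole i f) <= ext U x.
  have [le|/ltW le] := leP (U (lpole true f)) (U (lpole false f)).
    exists true; rewrite xE; have := @ext_bounds n U z f (U (lpole true f)) (U (lpole false f)).
    by rewrite !lexx le /= => /(_ isT isT)/andP[].
  exists false; rewrite xE; have := @ext_bounds n U z f (U (lpole false f)) (U (lpole true f)).
  by rewrite !lexx le /= => /(_ isT isT)/andP[].
move/(le_trans Hi); rewrite ler_pdivlMr// => le.
by exists (cdist (lpole i f)), (lpole i f); split => //; exact: cdistP.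
Qed.

End Projection.

Context (l : nat).
Hypothesis Ll : L = l%:R.

Let cells_of (w : symb S) n : cword S := Tagged (fun j => Defs.word S j : Type) (prefix_word n w).

Lemma cost_cat (s t : seq (cword S)) : cost R (s ++ t) = cost R s + cost R t.
Proof. exact: big_cat. Qed.

Lemma cost_const n (s : seq (cword S)) : all (fun d => tag d == n) s -> cost R s = (size s)%:R * L ^- n.
Proof.
elim: s => [|d s IH] /=; first by rewrite /cost big_nil mul0r.
by case/andP => /eqP dn /IH h; rewrite cost_cons h dn -natr1 mulrDl mul1r addrC.
Qed.

(** The chain is prolonged to [d] across a run of [k] cells of level [n+1], that is, a walk of at
    most 2k + 1 edges: one for each cell and one for each link. The walk projects to one of m edges
    with m L <= 2k + 1, which is bridged by g cells of level [n] with 2g <= m. Since L is an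
    integer, parity yields g L <= k, so the bridge costs no more than the run. *)
Lemma extend_chain n (c d : cword S) (s : seq (cword S)) K (k : nat) (x : lvert n.+1) :
  (tag (last c s) <= n)%N -> (tag d <= n)%N ->
  all (fun e : cword S => (tag e <= n)%N) (c :: s) -> chain n c s ->
  cost R (c :: s) + k%:R * L ^- n.+1 <= K ->
  reach (last c s) (2 * k).+1 x -> incell (tagged d) x ->
  exists t, [/\ all (fun e : cword S => (tag e <= n)%N) (c :: rcons t d), chain n c (rcons t d) &
    cost R (c :: rcons t d) <= K + L ^- (tag d)].
Proof.
move=> ln dn small ch cK rx ix.
have [m [y [iy ry ml]]] := reach_project ln dn rx ix.
have [g [g1 g2 g3 g4]] := reach_bridge ry.
exists (s ++ g); rewrite rcons_cat; split.
- move: small => /=/andP[-> small]; rewrite all_cat small/= all_rcons dn/=.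
  by apply: sub_all g1 => e /= /eqP->.
- apply/chain_cat; split => //; rewrite -cats1; apply/chain_cat; split => //=; split => //.
  exact: g4.
rewrite -cat_cons cost_cat -cats1 cost_cat {3}/cost big_seq1 addrA lerD2r.
apply: le_trans cK; rewrite lerD2l (cost_const g1).
have : (size g * l <= k)%N.
  have : (m * l <= (2 * k).+1)%N by rewrite -(ler_nat R) natrM -Ll.
  by move: g3; set a := size g => h1 h2; have : (2 * a * l <= (2 * k).+1)%N; [apply: leq_trans h2; rewrite leq_mul2r h1 orbT|nia].
rewrite -(ler_nat R) natrM -Ll => h.
by rewrite exprS invfM mulrA ler_wpM2r ?invr_ge0 ?exprn_ge0 ?(ltW L0)// ler_pdivlMr.
Qed.

(* Cells of level at most [n] are kept; the runs of level-[n+1] edges between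
   two of them are replaced by level-[n] edges, at no larger cost. *)
Lemma adist_succ (u w : symb S) n : adist u w n <= adist u w n.+1 + 2 * L ^- n.
Proof.
have cu : adist u w n - 2 * L ^- n <= adist u w n.+1; last by rewrite -lerBlDr.
have Ln (m : nat) : 0 <= L ^- m by rewrite invr_ge0 exprn_ge0// ltW.
apply: le_adist => i j.
have [e|/eqP ne] := eqVneq (lpole i (prefix_word n.+1 u)) (lpole j (prefix_word n.+1 w)).
  have [i' [j' ij]] : touch (prefix_word n u) (prefix_word n w).
    by apply: (@touchS S n _ _ (u n) (w n)); exists i, j.
  rewrite lerBlDr; apply: le_trans (adist_le u w n i' j') _.
  by rewrite /ldist ij eqxx addr_ge0 ?ldist_ge0// mulr_ge0.
apply: le_ldist => // Om /(Omega_chain L1)[c [s [small ch iv iw /(le_trans _)]]]; apply.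
rewrite lerBlDr.
pose c0 := cells_of u n.
(* Invariant of the induction along the old chain: [t] is the part rebuilt from cells of level at
   most [n], [k] counts the cells of level [n+1] met since its last cell, and [K] bounds the cost so
   far. The cells added at the two ends, the prefixes of [u] and [w], account for 2 L^-n. *)
suff [t [K [k [h1 h2 h3 [h4 h5]]]]] : exists t K (k : nat),
    [/\ all (fun e : cword S => (tag e <= n)%N) (c0 :: t), chain n c0 t,
      cost R (c0 :: t) + k%:R * L ^- n.+1 <= K &
     (forall x, incell (tagged (last c s)) x -> reach (last c0 t) (2 * k) (x : lvert n.+1)) /\
      K <= L ^- n + cost R (c :: s)].
  have dn : (tag (cells_of w n) <= n)%N by [].
  have ln : (tag (last c0 t) <= n)%N by move/allP : h1 => /(_ _ (mem_last _ _)).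
  have rx : reach (last c0 t) (2 * k).+1 (lpole j (prefix_word n.+1 w)) by left; exact: h4.
  have ix : incell (tagged (cells_of w n)) (lpole j (prefix_word n.+1 w)) by exact: incell_prefix.
  have [t' [k1 k2 k3]] := extend_chain ln dn h1 h2 h3 rx ix.
  apply: (@le_trans _ _ (cost R (c0 :: rcons t' (cells_of w n)))).
    by apply: (@adist_chain u w n c0 _ true true) => //; rewrite ?last_rcons; apply/incell_self; exists true.
  apply: le_trans k3 _; rewrite /= mulr2n mulrDl mul1r.
  by move: h5; rewrite /=; move: (cost R _) (L ^- n) => a b; lra.
have step (t : seq (cword S)) K (k : nat) (d : cword S) (x y : lvert n.+1) :
    (tag d <= n.+1)%N ->
    all (fun e : cword S => (tag e <= n)%N) (c0 :: t) -> chain n c0 t ->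
    cost R (c0 :: t) + k%:R * L ^- n.+1 <= K ->
    reach (last c0 t) (2 * k) x -> x = y \/ adj (@lends S n.+1) x y -> incell (tagged d) y ->
    exists t' (k' : nat),
    [/\ all (fun e : cword S => (tag e <= n)%N) (c0 :: t'), chain n c0 t',
      cost R (c0 :: t') + k'%:R * L ^- n.+1 <= K + L ^- tag d &
      forall z : lvert n.+1, incell (tagged d) z -> reach (last c0 t') (2 * k') z].
  move=> dn h1 h2 h3 rx xy iy.
  have ry : reach (last c0 t) (2 * k).+1 y.
    by case: xy => [<-|xy]; [left|right; exists x].
  have [dn'|nd] := leqP (tag d) n.
    have ln : (tag (last c0 t) <= n)%N by move/allP : h1 => /(_ _ (mem_last _ _)).
    have [t' [k1 k2 k3]] := extend_chain ln dn' h1 h2 h3 ry iy.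
    exists (rcons t' d), 0%N; split => //; first by rewrite mul0r addr0.
    by move=> z iz; rewrite last_rcons.
  exists t, k.+1; split => //.
    have -> : tag d = n.+1 by apply/eqP; rewrite eqn_leq dn.
    by rewrite -natr1 mulrDl mul1r addrA lerD2r.
  (* A cell of level [n+1] is one edge: one step to get to it and one to cross it. *)
  move=> z iz; have -> : (2 * k.+1 = (2 * k).+2)%N by lia.
  case: d dn nd iy iz => m e /= dn nd iy iz.
  have mn : m = n.+1 by apply/eqP; rewrite eqn_leq dn.
  move: e iy iz; rewrite mn => e /incell_self[i1 ye] /incell_self[i2 ze].
  have [ii|ii] := eqVneq i1 i2; first by left; rewrite ze -ii -ye.
  right; exists y => //; rewrite ye ze.
  have -> : i2 = ~~ i1 by case: (i1) (i2) ii => [] [].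
  exact: adj_lpole.
have i0 : incell (tagged c0) (lpole i (prefix_word n.+1 u)) by exact: incell_prefix.
have h0 : cost R [:: c0] + 0%:R * L ^- n.+1 <= L ^- n by rewrite mul0r addr0 /cost big_seq1.
have small0 : all (fun e : cword S => (tag e <= n)%N) [:: c0] by rewrite /= leqnn.
have [c_small s_small] : (tag c <= n.+1)%N /\ all (fun d : cword S => (tag d <= n.+1)%N) s by move/andP: small.
have [t1 [k1 [a1 a2 a3 a4]]] := step [::] _ 0%N c _ _ c_small small0 I h0 i0 (or_introl erefl) iv.
move: {small iv i0 h0 small0 c_small iw} (L ^- n) a3 => b a3.
have : exists K, [/\ cost R (c0 :: t1) + k1%:R * L ^- n.+1 <= K & K = b + L ^- tag c].
  by exists (b + L ^- tag c).
rewrite (cost_cons R c s) addrA; case=> K [{}a3 <-].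
elim: s c t1 k1 K ch s_small a1 a2 a3 a4 => [|d s IH] c t1 k1 K /=.
  by move=> _ _ a1 a2 a3 a4; exists t1, K, k1; split => //; split => //; rewrite /cost big_nil addr0.
move=> [[x [y [ix iy xy]]] ch] /andP[dn s_small] a1 a2 a3 a4.
have [t2 [k2 [b1 b2 b3 b4]]] := step t1 K k1 d x y dn a1 a2 a3 (a4 _ ix) xy iy.
by rewrite (cost_cons R d s) addrA; exact: IH b4.
Qed.

Lemma adist_le1 (u w : symb S) n : adist u w n <= 1.
Proof.
have [Om ok le] := Omega_root (lpole true (prefix_word n u)) (lpole true (prefix_word n w)).
by apply: le_trans (adist_le u w n true true) _; apply: le_trans (ldist_le L1 ok) le.
Qed.

Lemma adist_cvg (u w : symb S) : cvgn (adist u w).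
Proof.
(* As L >= 2, the errors 2 L^-k with k >= n add up to at most 4 L^-n; subtracting this bound makes
   the sequence nondecreasing. *)
pose b n := adist u w n - 4 * L ^- n.
have Lc : 4 * L ^- n @[n --> \oo] --> (0 : R).
  have -> : (fun n => 4 * L ^- n) = geometric 4 L^-1 by apply/funext => n; rewrite /geometric /= exprVn.
  by apply: cvg_geometric; rewrite ger0_norm ?invr_ge0 ?(ltW L0)// invf_lt1.
have nb : nondecreasing_seq b.
  apply/nondecreasing_seqP => n; rewrite /b.
  have h := adist_succ u w n.
  have : 4 * L ^- n.+1 <= 2 * L ^- n.
    rewrite exprS invfM mulrA ler_wpM2r ?invr_ge0 ?exprn_ge0 ?(ltW L0)//.
    have -> : 4 = 2 * 2 :> R by rewrite -natrM.
    by rewrite ler_pdivrMr// ler_pM2l.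
  by move: h; move: (adist u w n) (adist u w n.+1) (L ^- n) (L ^- n.+1) => x y z t; lra.
have cb : cvgn b.
  apply: nondecreasing_is_cvgn => //; exists 1 => _ [n _ <-].
  by rewrite /b lerBlDr (le_trans (adist_le1 u w n))// lerDl mulr_ge0// invr_ge0 exprn_ge0// ltW.
have -> : adist u w = (fun n => b n + 4 * L ^- n) by apply/funext => n; rewrite /b subrK.
by apply: is_cvgD => //; apply/cvg_ex; exists 0.
Qed.

(** [limdist] is computed on representatives, which share only their classes with [u] and [w]. The
    three cells are the prefixes of [u'], of [w] (shared with [u]) and of [w']; consecutive ones
    meet because equivalent sequences touch at every level. *)
Lemma limdist_le (hnd : non_degenerate S) (u w : symb S) n : (forall i, (i < n)%N -> u i = w i) ->
  limdist (chi R u) (chi R w) <= 3 * L ^- n.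
Proof.
move=> uw; set u' := repr (chi R u); set w' := repr (chi R w).
have pE (a : symb S) : symb_eq (repr (chi R a)) a.
  by apply/(@eqmodP _ (symb_equiv S)); exact: reprK.
have uwE : prefix_word n u = prefix_word n w.
  by elim: n uw => //= n IH uw; rewrite uw// IH// => i iN; apply: uw; rewrite ltnW.
have -> : limdist (chi R u) (chi R w) = limn (adist u' w') by [].
apply: limr_le; first exact: adist_cvg.
exists n => // k /= nk.
have [i1 [j1 h1]] := (symb_eqP hnd _ _).1 (pE u) k.
have [i2 [j2 h2]] := (symb_eqP hnd _ _).1 (pE w) k.
pose c a : cword S := cells_of a n.
have -> : 3 * L ^- n = cost R [:: c u'; c w; c w'].
  by rewrite /cost !big_cons big_nil /= addr0 -{1}[3]/(1 + 1 + 1)%:R !natrD !mulrDl mul1r addrA.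
apply: (@adist_chain u' w' k (c u') _ true true); rewrite /= ?nk//; last 2 first.
- exact: incell_prefix.
- exact: incell_prefix.
split; last split => //.
  exists (lpole i1 (prefix_word k u')), (lpole i1 (prefix_word k u')); split; first exact: incell_prefix.
    rewrite h1 /= -uwE; exact: incell_prefix.
  by left.
exists (lpole i2 (prefix_word k w')), (lpole i2 (prefix_word k w')); split; last by left.
  by rewrite h2; exact: incell_prefix.
exact: incell_prefix.
Qed.

Lemma le_limdist (x y : limspace R S) n :
  ~ touch (prefix_word n (repr x)) (prefix_word n (repr y)) -> L ^- n / 2 <= limdist x y.
Proof.
move=> h; have -> : limdist x y = limn (adist (repr x) (repr y)) by [].
apply: limr_ge; first exact: adist_cvg.
by exists n => // k /= nk; apply: le_adist => i j; exact: ldist_disjoint.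
Qed.
End Extension.

Section LimitMetric.
Context (R : realType) (S : doubling_igs).
Hypothesis hnd : non_degenerate S.
Local Notation L := (Lstar R S).

Lemma limdist_cylinder (u w : symb S) n : cylinder n u w ->
  limdist (chi R u) (chi R w) <= 3 * L ^- n.
Proof.
move=> h; have [u1 [h1 h2 h3 h4]] := generator_potential R hnd.
have [l [Ll _ _]] := Lstar_nat R hnd.
by apply: (limdist_le h1 h2 h3 h4 (Lstar_ge2 R hnd) Ll hnd) => i iN; rewrite h.
Qed.

Lemma limdist_separated (x y : limspace R S) n :
  ~ touch (prefix_word n (repr x)) (prefix_word n (repr y)) -> L ^- n / 2 <= limdist x y.
Proof.
have [u1 [h1 h2 h3 h4]] := generator_potential R hnd.
have [l [Ll _ _]] := Lstar_nat R hnd.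
exact: (le_limdist h1 h2 h3 h4 (Lstar_ge2 R hnd) Ll).
Qed.
End LimitMetric.

(** * Topology and measure of the limit space *)

Section Koenig.
Context (T : choiceType) (ts : seq T).
Hypothesis tsP : forall t, t \in ts.

Lemma cylinderW m n (a b : nat -> T) : (m <= n)%N -> cylinder n a b -> cylinder m a b.
Proof. by move=> mn h i im; apply: h; exact: leq_trans mn. Qed.

Lemma cylinder_sym n (a b : nat -> T) : cylinder n a b -> cylinder n b a.
Proof. by move=> h i iN; rewrite h. Qed.

Lemma cylinder_trans n (a b c : nat -> T) : cylinder n a b -> cylinder n b c -> cylinder n a c.
Proof. by move=> h k i iN; rewrite k// h. Qed.

(** Compactness of the space of sequences, for a property decided by the first [n] letters and
    inherited by larger [n]. If no level works, a prefix whose continuations admit no common level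
    has a one-letter extension of the same kind, and the branch built in this way contradicts the
    third hypothesis. *)
Lemma koenig (G : nat -> (nat -> T) -> Prop) :
  (forall n a b, cylinder n a b -> G n a -> G n b) ->
  (forall n a, G n a -> G n.+1 a) ->
  (forall a, exists n, G n a) -> exists N, forall a, G N a.
Proof.
move=> Gcyl GS Gex; apply: contrapT => noN.
have GW m n a : (m <= n)%N -> G m a -> G n a.
  by move=> /subnK <-; elim: (n - m)%N => // k IH /IH; exact: GS.
have [a0 _] : exists a0 : nat -> T, True.
  by apply: contrapT => h; apply: noN; exists 0%N => a; exfalso; apply: h; exists a.
pose bad n a := forall N, exists b, cylinder n a b /\ ~ G N b.
have bad0 : bad 0%N a0.
  move=> N; apply: contrapT => h; apply: noN; exists N => a; apply: contrapT => Ga.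
  by apply: h; exists a.
have step n a : exists a', bad n a -> cylinder n a a' /\ bad n.+1 a'.
  have [ba|nb] := pselect (bad n a); last by exists a => /nb.
  apply: contrapT => h.
  pose ext t : nat -> T := fun k => if (k < n)%N then a k else t.
  have ce t : cylinder n a (ext t) by move=> i iN; rewrite /ext iN.
  have H t : exists N, forall b, cylinder n.+1 (ext t) b -> G N b.
    apply: contrapT => h2; apply: h; exists (ext t) => _; split => // N.
    apply: contrapT => h3; apply: h2; exists N => b cb; apply: contrapT => Gb.
    by apply: h3; exists b.
  have [f fP] := choice H.
  pose M := \max_(t <- ts) f t.
  have [b [cb nb]] := ba M; apply: nb; apply: (GW (f (b n))).
    by apply: (@leq_bigmax_seq _ _ predT f).
  apply: fP => i; rewrite ltnS leq_eqVlt => /orP[/eqP->|iN]; first by rewrite /ext ltnn.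
  by rewrite /ext iN cb.
have [f fP] := choice (fun x : nat * (nat -> T) => step x.1 x.2).
pose s := fix s n := if n is m.+1 then f (m, s m) else a0.
have bs n : bad n (s n) by elim: n => //= n IH; have [] := fP (n, s n) IH.
have cs n : cylinder n (s n) (s n.+1) by have [] := fP (n, s n) (bs n).
have cs' m n : (m <= n)%N -> cylinder m (s m) (s n).
  move=> /subnK <-; elim: (n - m)%N => [//|k IH].
  apply: cylinder_trans IH _; rewrite addSn; apply: cylinderW (cs _); exact: leq_addl.
pose b k := s k.+1 k.
have cb n : cylinder n (s n) b by move=> i iN; exact/esym/(cs' i.+1 n iN i (ltnSn i)).
have [m Gm] := Gex b; have [c [cc]] := bs m m; apply.
by apply: Gcyl Gm; apply: cylinder_trans (cylinder_sym (cb m)) cc.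
Qed.
End Koenig.

Section QuotientTopology.
Context (R : realType) (S : doubling_igs).
Hypothesis hnd : non_degenerate S.
Local Notation X := (limspace R S).
Local Notation chi := (chi R (S := S)).
Local Notation L := (Lstar R S).

Let L2 : 2 <= L := Lstar_ge2 R hnd.
Let L0 : 0 < L. Proof. exact: lt_le_trans L2. Qed.

Lemma chi_eq (u w : symb S) : chi u = chi w <-> symb_eq u w.
Proof. by split => h; apply/(@eqmodP _ (symb_equiv S)). Qed.

Lemma repr_chi (u : symb S) : symb_eq (repr (chi u)) u.
Proof. by apply/chi_eq; exact: reprK. Qed.

Lemma chi_repr (x : X) : chi (repr x) = x.
Proof. exact: reprK. Qed.

Lemma prefix_cylinder n (u w : symb S) : cylinder n u w <-> prefix_word n u = prefix_word n w.
Proof.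
elim: n => [|n IH]; first by split.
split => [h|/= [/IH h un] i].
  rewrite /= (h n)//; congr pair; apply/IH; exact: cylinderW h.
by rewrite ltnS leq_eqVlt => /orP[/eqP->//|]; exact: h.
Qed.

Lemma open_cylinder (A : set X) w : open A -> A (chi w) ->
  exists n, forall w', cylinder n w w' -> A (chi w').
Proof.
move=> oA Aw; have [r r0 rA] : exists2 r : R, 0 < r & [set y | limdist (chi w) y < r] `<=` A.
  exact: (oA _ Aw).
have [n nr] : exists n, 3 * L ^- n < r.
  have : 3 * L ^- n @[n --> \oo] --> (0 : R).
    have -> : (fun n => 3 * L ^- n) = geometric 3 L^-1 by apply/funext => n; rewrite /geometric /= exprVn.
    by apply: cvg_geometric; rewrite ger0_norm ?invr_ge0 ?(ltW L0)// invf_lt1// (lt_le_trans _ L2)// ltr1n.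
  move/cvgrPdist_lt => /(_ _ r0)[n _ /(_ n (leqnn n))]; rewrite sub0r normrN => h.
  by exists n; apply: le_lt_trans (ler_norm _) h.
by exists n => w' ww'; apply: rA; apply: le_lt_trans nr; exact: limdist_cylinder.
Qed.

(** Covers cells and fibres alike, through the choice of [g]. If [x] is not in the image, [koenig]
    provides a level at which no [g a] with [a] in [K] is two touches away from the representative
    of [x]. A point [y] close to [x] has a representative touching that of [x]; if [y] were
    [chi (g a)], this representative would also touch [g a]. *)
Lemma closed_chi_image (T : choiceType) (ts : seq T) (g : (nat -> T) -> symb S) (K : set (nat -> T)) :
  (forall t, t \in ts) ->
  (forall n a b, cylinder n a b -> cylinder n (g a) (g b)) ->
  (forall a, ~ K a -> exists n, forall b, cylinder n a b -> ~ K b) ->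
  closed [set chi (g a) | a in K].
Proof.
move=> tsP gc Kc; rewrite -openC.
suff : limopen (~` [set chi (g a) | a in K]) by [].
move=> x /= nx.
pose near2 n (u w : symb S) := exists e, touch (prefix_word n u) e /\ touch e (prefix_word n w).
have near2S n u w : near2 n.+1 u w -> touch (prefix_word n u) (prefix_word n w).
  by move=> [[e z] [h1 h2]]; exact: touch_trans h1 h2.
pose G n a := (forall b, cylinder n a b -> ~ K b) \/ ~ near2 n (repr x) (g a).
have [N HN] : exists N, forall a, G N a.
  apply: (koenig tsP) => [n a b ab|n a|a].
  - move=> [h|h]; [left => c bc; apply: h; exact: cylinder_trans ab bc|right].
    have -> // : near2 n (repr x) (g b) = near2 n (repr x) (g a).
    by rewrite /near2 ((prefix_cylinder _ _ _).1 (gc _ _ _ ab)).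
  - move=> [h|h]; [left => b ab; apply: h; exact: cylinderW ab|right => h2; apply: h].
    by exists (prefix_word n (repr x)); split; [exact: touch_refl|exact: near2S].
  have [Ka|/Kc[n h]] := pselect (K a); last by exists n; left.
  have : ~ symb_eq (repr x) (g a).
    by move=> /chi_eq h; apply: nx; exists a => //; rewrite -h chi_repr.
  move=> h; apply: contrapT => h2; apply: h; apply/(symb_eqP hnd) => n.
  by apply: near2S; apply: contrapT => h3; apply: h2; exists n.+1; right.
exists (L ^- N / 2); first by rewrite divr_gt0// invr_gt0 exprn_gt0.
move=> y /= xy [a Ka yE]; have [h|h] := HN a; first by exact: (h a).
apply: h; exists (prefix_word N (repr y)); split.
  apply: contrapT => h; have := limdist_separated hnd h.
  by rewrite leNgt xy.
have : symb_eq (repr y) (g a) by rewrite -yE; exact: repr_chi.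
by move/(symb_eqP hnd).
Qed.

Lemma letters_all : forall t : letter S, t \in index_enum (letter S).
Proof. exact: mem_index_enum. Qed.

Lemma open_quotient (A : set X) :
  (forall w, A (chi w) -> exists n, forall w', cylinder n w w' -> A (chi w')) -> open A.
Proof.
move=> h; rewrite -[A]setCK openC.
have -> : ~` A = [set chi (id a) | a in [set w | ~ A (chi w)]].
  apply/seteqP; split => [x nx|_ [w nw <-] //]; exists (repr x); rewrite /= chi_repr//.
apply: (closed_chi_image letters_all) => // a /contrapT/h[n hn]; exists n => b /hn Ab nb.
exact: nb.
Qed.

Lemma Fmap_chi n (e : word S n) w : Fmap R e (chi w) = chi (prepend e w).
Proof. by apply/chi_eq/(symb_eq_prepend hnd); exact: repr_chi. Qed.

Lemma FmapS n (e : word S n) x (z : X) :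
  Fmap R (n := n.+1) (e, x) z = Fmap R e (Fmap R (n := 1) (tt, x) z).
Proof. by rewrite -(chi_repr z) !Fmap_chi. Qed.

Lemma Fmap0 (e : word S 0) (z : X) : Fmap R e z = z.
Proof. by rewrite -{2}(chi_repr z). Qed.

Lemma cylinder_scons n x (u w : symb S) : cylinder n u w -> cylinder n.+1 (scons x u) (scons x w).
Proof. by move=> h [//|i] iN; exact: h. Qed.

Lemma cylinder_prepend m n (e : word S m) (u w : symb S) : cylinder n u w ->
  cylinder (n + m) (prepend e u) (prepend e w).
Proof.
elim: m n e u w => [|m IH] n e u w h; first by rewrite addn0.
by rewrite addnS -addSn; apply: IH; exact: cylinder_scons.
Qed.

Lemma continuous_Fmap n (e : word S n) (f : X -> R) : continuous f -> continuous (f \o Fmap R e).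
Proof.
move=> cf; apply/continuousP => A oA.
apply: open_quotient => w /= Aw.
have oB : open (f @^-1` A) by move/continuousP : cf; exact.
have [m hm] := open_cylinder oB (w := prepend e w) (ltac:(by rewrite -Fmap_chi)).
exists m => w' ww'; rewrite Fmap_chi; apply: hm.
by apply: cylinderW (cylinder_prepend e ww'); exact: leq_addr.
Qed.

Lemma continuous_cylinder (f : X -> R) w (eps : R) : continuous f -> 0 < eps ->
  exists n, forall w', cylinder n w w' -> `|f (chi w) - f (chi w')| < eps.
Proof.
move=> cf e0; have oB : open (f @^-1` ball (f (chi w)) eps).
  by move/continuousP : cf; apply; exact: ball_open.
have [n hn] := open_cylinder oB (w := w) (ballxx _ e0).
by exists n => w' /hn.
Qed.

Lemma continuous_uniform (f : X -> R) (eps : R) : continuous f -> 0 < eps ->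
  exists n, forall w w', cylinder n w w' -> `|f (chi w) - f (chi w')| < eps.
Proof.
move=> cf e0; have e20 : 0 < eps / 2 by rewrite divr_gt0.
pose G n (w : nat -> letter S) := forall w1 w2 : symb S, cylinder n w w1 -> cylinder n w w2 -> `|f (chi w1) - f (chi w2)| < eps.
have [N HN] : exists N, forall w, G N w.
  apply: (koenig letters_all) => [n a b ab Ga w1 w2 h1 h2|n a Ga w1 w2 h1 h2|a].
  - by apply: Ga; exact: cylinder_trans ab _.
  - by apply: Ga; [exact: cylinderW h1|exact: cylinderW h2].
  have [n hn] := continuous_cylinder a cf e20; exists n => w1 w2 /hn h1 /hn h2.
  rewrite -(subrKA (f (chi a))); apply: le_lt_trans (ler_normD _ _) _.
  by rewrite (splitr eps) distrC ltrD// .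
by exists N => w w'; exact: HN.
Qed.
End QuotientTopology.

Lemma image_probability d1 d2 (T1 : measurableType d1) (T2 : measurableType d2) (R : realType)
  (m : {measure set T1 -> \bar R}) (f : T1 -> T2) : measurable_fun setT f -> m setT = 1%E ->
  exists P : probability T2 R, forall A, P A = m (f @^-1` A).
Proof.
move=> mf m1.
pose M : {measure set T2 -> \bar R} :=
  measure_function_pushforward__canonical__measure_function_Measure m mf.
have M1 : M setT = 1%E by [].
pose P : probability T2 R := HB.pack (M : set T2 -> \bar R) (Measure.class M)
  (Measure_isProbability.Build _ _ _ M M1).
by exists P.
Qed.

(** * Product measures on spaces of sequences *)

Section SequenceSpace.
Context (R : realType) (T : pointedType) (ts : seq T) (w : T -> R).
Hypothesis uts : uniq ts.
Hypothesis tsP : forall t, t \in ts.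
Hypothesis w0 : forall t, 0 <= w t.
Hypothesis w1 : \sum_(t <- ts) w t = 1.

Definition cons_seq (t : T) (a : nat -> T) : nat -> T := fun k => if k is j.+1 then a j else t.
Definition shift_seq (a : nat -> T) : nat -> T := fun k => a k.+1.

(* One digit of the expansion of a point of [[0, 1[] in the partition into
   intervals of lengths [w t], and the rescaled remainder. *)
Fixpoint digit_step (l : seq T) (x : R) : T * R :=
  if l is t :: l' then if x < w t then (t, x / w t) else digit_step l' (x - w t)
  else (point, 0).

Fixpoint digits (x : R) (n : nat) : T :=
  if n is m.+1 then digits (digit_step ts x).2 m else (digit_step ts x).1.

Lemma digit_step_in l x : 0 <= x -> x < \sum_(t <- l) w t ->
  (digit_step l x).1 \in l /\ 0 <= (digit_step l x).2 < 1.
Proof.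
elim: l x => [|t l IH] x x0; first by rewrite big_nil ltNge x0.
rewrite big_cons /=; case: (ltP x (w t)) => xt xs /=.
  have wt0 : 0 < w t by exact: le_lt_trans xt.
  by rewrite inE eqxx divr_ge0//= ltr_pdivrMr// mul1r.
have [h1 h2] := IH (x - w t) (ltac:(by rewrite subr_ge0)) (ltac:(by rewrite ltrBlDl)).
by rewrite inE h1 orbT.
Qed.

(** [c] is the total weight of the letters listed before [t]. The condition [b <= 1] keeps the
    interval from reaching into that of the next letter. *)
Lemma digit_step_interval l t a b : uniq l -> t \in l -> 0 <= a -> b <= 1 ->
  exists c, [/\ 0 <= c, c + w t <= \sum_(u <- l) w u &
   forall x, 0 <= x -> x < \sum_(u <- l) w u ->
     ((digit_step l x).1 = t /\ a <= (digit_step l x).2 < b) <-> c + w t * a <= x < c + w t * b].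
Proof.
move=> + + a0 b1; elim: l => [//|u l IH] /= /andP[ul uql]; rewrite inE.
have [-> _|tu /= tl] := eqVneq t u.
  exists 0; split => // [|x x0].
    by rewrite add0r big_cons lerDl sumr_ge0.
  rewrite big_cons !add0r => xs; case: (ltP x (w u)) => xu /=.
    have wu0 : 0 < w u by exact: le_lt_trans xu.
    by rewrite ler_pdivlMr// ltr_pdivrMr// ![_ * w u]mulrC; split => [[]|].
  split=> [[h _]|/andP[_ h]].
    have [h1 _] := @digit_step_in l (x - w u) (ltac:(by rewrite subr_ge0)) (ltac:(by rewrite ltrBlDl)).
    by move: ul; rewrite -h h1.
  have : w u * b <= w u by rewrite ler_piMr.
  by move/(lt_le_trans h); rewrite ltNge xu.
have [c [c0 cw H]] := IH uql tl.
exists (w u + c); split; first by rewrite addr_ge0.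
  by rewrite big_cons -addrA lerD2l.
move=> x x0; rewrite big_cons => xs; case: (ltP x (w u)) => xu /=.
  split=> [[h _]|/andP[h _]]; first by rewrite h eqxx in tu.
  have : w u <= w u + c + w t * a by rewrite -addrA lerDl addr_ge0// mulr_ge0.
  by move/le_trans/(_ h); rewrite leNgt xu.
have xs' : x - w u < \sum_(t <- l) w t by rewrite ltrBlDl.
have x0' : 0 <= x - w u by rewrite subr_ge0.
by rewrite (H _ x0' xs') lerBrDl ltrBlDl !addrA.
Qed.

Lemma digits_cylinder n (u : nat -> T) : exists al : R, [/\ 0 <= al, al + \prod_(i < n) w (u i) <= 1 &
  forall x, 0 <= x < 1 -> cylinder n u (digits x) <-> al <= x < al + \prod_(i < n) w (u i)].
Proof.
elim: n u => [|n IH] u.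
  exists 0; split => //; first by rewrite big_ord0 add0r.
  by move=> x x01; rewrite big_ord0 add0r; split => // _ i.
have [al [al0 al1 H]] := IH (shift_seq u).
set pi := \prod_(i < n) w (shift_seq u i) in al1 H.
have pi0 : 0 <= pi by apply: prodr_ge0 => i _.
have [c [c0 cw K]] := digit_step_interval (a := al) (b := al + pi) uts (tsP (u 0%N)) al0 al1.
exists (c + w (u 0%N) * al); rewrite big_ord_recl /= -/pi.
have -> : c + w (u 0%N) * al + w (u 0%N) * \prod_(i < n) w (u (lift ord0 i)) = c + w (u 0%N) * (al + pi).
  rewrite mulrDr addrA; congr (_ + _ * _); exact: eq_bigr.
split; first by rewrite addr_ge0// mulr_ge0.
  apply: le_trans (_ : c + w (u 0%N) <= 1); last by rewrite -w1.
  by rewrite lerD2l ler_piMr.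
move=> x /andP[x0 x1].
have xs : x < \sum_(u <- ts) w u by rewrite w1.
have [_ y01] := digit_step_in x0 xs.
rewrite -(K _ x0 xs) -(H _ y01); split => [h|[h1 h2]].
  split; first exact: (h 0%N).
  by move=> i iN; exact: (h i.+1).
by case=> [_|i iN]; [exact: h1|exact: h2].
Qed.

Local Notation SS := (seqspace T).

Lemma cylinder_measurable n u : measurable (cylinder n u : set SS).
Proof. by apply: sub_sigma_algebra; exists n, u. Qed.

Definition digit_map (x : measurableTypeR R) : SS := if (0 <= x < 1) then digits x else (fun=> point).

Lemma digit_map_measurable : measurable_fun setT digit_map.
Proof.
apply: (@measurability _ _ (measurableTypeR R) SS setT digit_map (@cylinders T)) => //.
move=> _ [_ [n [u ->]] <-]; rewrite setTI.
have [al [al0 al1 H]] := digits_cylinder n u.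
set pi := \prod_(i < n) w (u i) in al1 H.
have -> : digit_map @^-1` cylinder n u =
   `[al, al + pi[ `|` (~` `[0, 1[ `&` [set x | cylinder n u (fun=> point)]).
  apply/seteqP; split => x /=; rewrite /digit_map !in_itv/=.
    by case: ifPn => x01; [move/(H _ x01) => h; left|move=> h; right].
  move=> [/andP[h1 h2]|[/negP/negbTE -> //]].
  have x01 : 0 <= x < 1 by rewrite (le_trans al0)// (lt_le_trans h2).
  by rewrite x01; apply/(H _ x01); rewrite h1.
apply: measurableU; first exact: measurable_itv.
apply: measurableI; first by apply: measurableC; exact: measurable_itv.
have [h|h] := pselect (cylinder n u (fun=> point)).
  by rewrite (_ : [set _ | _] = setT)//; apply/seteqP; split.
by rewrite (_ : [set _ | _] = set0)//; apply/seteqP; split.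
Qed.

(** [product_measure] is selected by [get], so a measure with the prescribed values must be
    exhibited: the image of Lebesgue measure on [0, 1[ under the digit expansion, which pulls
    cylinders back to intervals. *)
Lemma product_measure_cylinder n u :
  product_measure w (cylinder n u) = (\prod_(i < n) w (u i))%:E.
Proof.
rewrite /product_measure.
have ex : exists P : probability SS R, forall n u, P (cylinder n u) = (\prod_(i < n) w (u i))%:E.
  pose m01 : measurable (`[0%R, 1%R[%classic : set (measurableTypeR R)) := measurable_itv _.
  have [|P PE] := @image_probability _ _ _ _ R (mrestr (@lebesgue_measure R) m01) _ digit_map_measurable.
    change (@lebesgue_measure R (setT `&` `[0%R, 1%R[%classic) = 1%E).
    by rewrite setTI lebesgue_measure_itv/= lte01 oppr0 adde0.
  exists P => {n}{}n {}u.
  have [al [al0 al1 H]] := digits_cylinder n u.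
  have pi0 : 0 <= \prod_(i < n) w (u i) by apply: prodr_ge0 => i _.
  set pi := \prod_(i < n) w (u i) in al1 H pi0 *.
  rewrite PE; change (@lebesgue_measure R (digit_map @^-1` cylinder n u `&` `[0%R, 1%R[%classic) = pi%:E).
  have -> : (digit_map @^-1` cylinder n u) `&` `[0, 1[ = `[al, al + pi[%classic.
    apply/seteqP; split => x /=; rewrite /digit_map !in_itv/=.
      by move=> [+ x01]; rewrite x01 => /(H _ x01).
    move=> /andP[h1 h2]; have x01 : 0 <= x < 1 by rewrite (le_trans al0)// (lt_le_trans h2).
    by rewrite x01; split => //; apply/(H _ x01); rewrite h1.
  rewrite lebesgue_measure_itv/= lte_fin ltrDl.
  case: ltP => [_|pi00]; first by rewrite -EFinB addrAC subrr add0r.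
  by have -> : pi = 0 by apply/eqP; rewrite eq_le pi0 pi00.
exact: (getPex ex n u).
Qed.

(** There are only countably many cylinders, coded by lists of positions in [ts]. *)
Lemma measurable_cylinder_open (A : set SS) :
  (forall a, A a -> exists n, cylinder n a `<=` A) -> measurable A.
Proof.
move=> oA.
pose u (s : seq nat) : nat -> T := fun i => nth point ts (nth 0%N s i).
pose F (x : nat * seq nat) : set SS :=
  if `[< cylinder x.1 (u x.2) `<=` A >] then cylinder x.1 (u x.2) else set0.
have -> : A = \bigcup_x F x.
  apply/seteqP; split => [a Aa|a [x _]]; last by rewrite /F; case: asboolP => // h /h.
  have [n nA] := oA _ Aa.
  have cE i : (i < n)%N -> u (mkseq (fun i => index (a i) ts) n) i = a i.
    by move=> iN; rewrite /u nth_mkseq// nth_index.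
  exists (n, mkseq (fun i => index (a i) ts) n) => //; rewrite /F /=.
  case: asboolP => [_ i iN|[]]; first by rewrite cE.
  by move=> b cb; apply: nA => i iN; rewrite cb// cE.
apply: countable_bigcupT_measurable => // x.
by rewrite /F; case: asboolP => _; [exact: cylinder_measurable|exact: measurable0].
Qed.

Definition cylinder_continuous (h : (nat -> T) -> R) :=
  forall eps : R, 0 < eps -> exists n, forall a b, cylinder n a b -> `|h a - h b| < eps.

Lemma measurable_cylinder_continuous (h : SS -> R) :
  cylinder_continuous h -> measurable_fun setT h.
Proof.
move=> hc; apply: (measurability _ (RGenOInfty.measurableE R)).
move=> _ [_ [y ->] <-]; rewrite setTI; apply: measurable_cylinder_open => a /=.
rewrite in_itv/= andbT => ya.
have e0 : 0 < h a - y by rewrite subr_gt0.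
have [n hn] := hc _ e0; exists n => b /(@cylinder_sym T)/(hn b a)/=.
rewrite in_itv/= andbT ltr_norml => /andP[+ _].
by rewrite opprB ltrD2r.
Qed.

Lemma cons_seq_measurable t : measurable_fun setT (cons_seq t : SS -> SS).
Proof.
apply: (@measurability _ _ SS SS setT _ (@cylinders T)) => //.
move=> _ [_ [n [u ->]] <-]; rewrite setTI; apply: measurable_cylinder_open => a /= h.
exists n => b ab i iN; rewrite -(h i iN); case: i iN => // i iN /=.
by rewrite ab// ltnW.
Qed.

Local Notation P := (product_measure w).

(** The product measure is the weighted mixture of its images under adding a first letter: both
    agree on cylinders, which generate the sigma-algebra. *)
Lemma product_measure_shift (F : SS -> \bar R) : measurable_fun [set: SS] F -> (forall a, 0 <= F a)%E ->
  (\int[P]_a F a = \sum_(t <- ts) (w t)%:E * \int[P]_a F (cons_seq t a))%E.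
Proof.
move=> mF F0.
pose wn k : {nonneg R} := NngNum (w0 (nth point ts k)).
pose M k : {measure set SS -> \bar R} :=
  measure_function_pushforward__canonical__measure_function_Measure P (cons_seq_measurable (nth point ts k)).
pose Q : {measure set SS -> \bar R} := msum (fun k => mscale (wn k) (M k) : {measure set SS -> \bar R}) (size ts).
have QE A : Q A = (\sum_(t <- ts) (w t)%:E * P (cons_seq t @^-1` A))%E.
  by rewrite /Q /= /msum (big_nth point) big_mkord.
have PQ A : measurable A -> P A = Q A.
  (* The empty set is included to make the cylinders stable under intersection. *)
  move=> mA; apply: (@measure_unique _ R SS (fun A => @cylinders T A \/ A = set0) (fun=> setT) _ _ _ _ (P : {measure set SS -> \bar R}) Q) => // {A mA}.
  - apply/seteqP; split; apply: smallest_sub; do 1?exact: smallest_sigma_algebra.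
      by move=> A cA; apply: sub_sigma_algebra; left.
    by move=> A [cA|->]; [exact: sub_sigma_algebra|exact: measurable0].
  - move=> A B [[n [u AE]]|->]; last by right; rewrite set0I.
    move=> [[m [v BE]]|->]; last by right; rewrite setI0.
    have [[x [Ax Bx]]|nx] := pselect (exists x, A x /\ B x); last first.
      by right; apply/seteqP; split => // x [Ax Bx]; apply: nx; exists x.
    left; exists (maxn n m), x; rewrite AE BE in Ax Bx *.
    apply/seteqP; split => [y [Ay By] i|y xy]; last first.
      split; apply: cylinder_trans; do 1?eassumption.
        by apply: cylinderW xy; exact: leq_maxl.
      by apply: cylinderW xy; exact: leq_maxr.
    by rewrite leq_max => /orP[] iN; [rewrite Ay// Ax|rewrite By// Bx].
  - by move=> _; left; exists 0%N, (fun=> point); apply/seteqP; split.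
  - by apply/seteqP; split => // x _; exists 0%N.
  - move=> A [[n [u ->]]|->]; last by rewrite !measure0.
    apply: (etrans (product_measure_cylinder n u)).
    rewrite QE; case: n => [|n].
      rewrite big_ord0 -w1 -sumEFin; apply: eq_bigr => t _.
      rewrite (_ : _ @^-1` _ = setT) ?probability_setT ?mule1//.
      by apply/seteqP; split.
    rewrite big_ord_recl EFinM (bigD1_seq (u 0%N))//= [X in (_ + X)%E]big1 ?addr0.
      rewrite (_ : _ @^-1` _ = cylinder n (shift_seq u)).
        by rewrite product_measure_cylinder.
      apply/seteqP; split => a h => [i iN|]; first exact: (h i.+1).
      by move=> [//|i] iN; exact: h.
    move=> t tu; rewrite (_ : _ @^-1` _ = set0) ?measure0 ?mule0//.
    by apply/seteqP; split => // a /(_ 0%N isT)/= tE; rewrite tE eqxx in tu.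
  - by move=> _; change (P setT < +oo)%E; rewrite probability_setT ltry.
have -> : (\int[P]_a F a = \int[Q]_a F a)%E.
  by apply: eq_measure_integral => A mA _; exact: PQ.
rewrite ge0_integral_measure_sum// (big_nth point) big_mkord; apply: eq_bigr => i _.
rewrite ge0_integral_mscale//; congr (_ * _)%E.
by rewrite [LHS]ge0_integral_pushforward// ?preimage_setT//; exact: cons_seq_measurable.
Qed.

Lemma cylinder_continuous_bounded (h : (nat -> T) -> R) : cylinder_continuous h ->
  exists M : R, forall a, `|h a| <= M.
Proof.
move=> hc; have [n hn] := hc 1 ltr01.
have [N HN] : exists N, forall a, forall b, cylinder N a b -> `|h b| <= N%:R.
  apply: (koenig tsP (G := fun N a => forall b, cylinder N a b -> `|h b| <= N%:R)).
  - by move=> N a b ab H c bc; apply: H; exact: cylinder_trans bc.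
  - move=> N a H b ab; apply: le_trans (H b _) _; last by rewrite ler_nat.
    exact: cylinderW ab.
  move=> a; have /archi_boundP := addr_ge0 (normr_ge0 (h a)) ler01.
  set N := Num.Def.archi_bound _ => aN; exists (maxn n N) => b ab.
  apply: (@le_trans _ _ N%:R); last by rewrite ler_nat leq_maxr.
  apply/ltW; apply: le_lt_trans aN.
  rewrite -[h b](subrK (h a)) addrC; apply: le_trans (ler_normD _ _) _; rewrite lerD2l.
  by apply/ltW/hn; apply: cylinderW (cylinder_sym ab); exact: leq_maxl.
by exists N%:R => a; apply: (HN a).
Qed.

Lemma bounded_integrable (h : SS -> R) (M : R) : measurable_fun [set: SS] h ->
  (forall a, `|h a| <= M) -> P.-integrable setT (EFin \o h).
Proof.
move=> mh hM; apply: measurable_bounded_integrable => //.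
  by change (P setT < +oo)%E; rewrite probability_setT ltry.
by exists M; split; [exact: num_real|move=> x Mx y _]; apply: le_trans (hM _) (ltW Mx).
Qed.

Lemma cylinder_continuous_integrable (h : SS -> R) : cylinder_continuous h ->
  P.-integrable setT (EFin \o h).
Proof.
move=> hc; have [M hM] := cylinder_continuous_bounded hc.
exact: bounded_integrable (measurable_cylinder_continuous hc) hM.
Qed.

Lemma cylinder_continuous_cons (h : SS -> R) t : cylinder_continuous h ->
  cylinder_continuous (h \o cons_seq t).
Proof.
move=> hc e e0; have [n hn] := hc e e0; exists n => a b ab; apply: hn.
by move=> [//|i] iN /=; apply: ab; exact: ltnW.
Qed.

Lemma cylinder_continuousB (h : SS -> R) c : cylinder_continuous h ->
  cylinder_continuous (fun a => h a - c).
Proof.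
move=> hc e e0; have [n hn] := hc e e0; exists n => a b /hn.
by rewrite opprB addrA subrK.
Qed.

Lemma Rintegral_prob_cst (c : R) : \int[P]_a c = c.
Proof.
rewrite Rintegral_cst//; change (c * fine (P setT) = c).
by rewrite probability_setT mulr1.
Qed.

Lemma Rintegral_shift (h : SS -> R) : cylinder_continuous h ->
  \int[P]_a h a = \sum_(t <- ts) w t * \int[P]_a h (cons_seq t a).
Proof.
move=> hc; have [M hM] := cylinder_continuous_bounded hc.
have subM (g : SS -> R) : cylinder_continuous g -> \int[P]_a (g a - - M) = \int[P]_a g a + M.
  move=> gc; rewrite RintegralB//; last 2 first.
  - exact: cylinder_continuous_integrable.
  - by apply: (@bounded_integrable _ `|M|) => // _; rewrite normrN.
  by rewrite Rintegral_prob_cst opprK.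
(* Adding the bound [M] makes the integrand nonnegative, as [product_measure_shift] requires. *)
suff : \int[P]_a (h a - - M) = \sum_(t <- ts) w t * \int[P]_a (h (cons_seq t a) - - M).
  rewrite subM// => e; apply: (addIr M); rewrite e -[X in _ + X]mul1r -w1 mulr_suml -big_split /=.
  apply: eq_bigr => t _; rewrite -mulrDr; congr (_ * _).
  by rewrite -(subM (h \o cons_seq t))//; exact: cylinder_continuous_cons.
have h0 a : 0 <= h a - - M by rewrite opprK -lerBlDr sub0r; have := hM a; rewrite ler_norml => /andP[].
have mh := measurable_cylinder_continuous (cylinder_continuousB (- M) hc).
rewrite {1}/Rintegral product_measure_shift//; last first.
  exact: (measurable_EFinP setT (fun a : SS => h a - - M)).2.
rewrite -sum_fine => [|t _]; last first.
  rewrite fin_numM//; apply: integrable_fin_num => //.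
  exact: (cylinder_continuous_integrable (h := fun a => h (cons_seq t a) - - M)) (cylinder_continuous_cons t (cylinder_continuousB (- M) hc)).
apply: eq_bigr => t _; rewrite fineM//; apply: integrable_fin_num => //.
exact: (cylinder_continuous_integrable (h := fun a => h (cons_seq t a) - - M)) (cylinder_continuous_cons t (cylinder_continuousB (- M) hc)).
Qed.

Lemma Rintegral_near (h : SS -> R) (c M : R) : cylinder_continuous h ->
  (forall a, `|h a - c| <= M) -> `|\int[P]_a h a - c| <= M.
Proof.
move=> hc hM; rewrite -[X in _ - X]Rintegral_prob_cst -RintegralB//; first last.
- by apply: (@bounded_integrable _ `|c|).
- exact: cylinder_continuous_integrable.
have ih := cylinder_continuous_integrable (cylinder_continuousB c hc).
apply: le_trans (le_normr_Rintegral _ ih) _ => //.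
rewrite -[leRHS]Rintegral_prob_cst; apply: le_Rintegral => //.
- exact: integrable_norm ih.
- by apply: (@bounded_integrable _ `|M|).
Qed.
End SequenceSpace.

Lemma card_letter (S : doubling_igs) : #|{: letter S}| = #|{: edge (gen S)}|.
Proof. by apply: (@bij_eq_card _ _ (fun x : letter S => x : edge (gen S))); exists id. Qed.

Lemma big_wordS (S : doubling_igs) (V : nmodType) n (H : word S n.+1 -> V) :
  \sum_(e : word S n.+1) H e = \sum_(e : word S n) \sum_(x : letter S) H (e, x).
Proof. by rewrite pair_bigA; apply: eq_bigr => -[]. Qed.

(** * The self-similar measure on the limit space *)

Section LimitMeasure.
Context (R : realType) (S : doubling_igs).
Hypothesis hnd : non_degenerate S.
Local Notation X := (limspace R S).
Local Notation chi := (chi R (S := S)).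
Local Notation mu := (mu R S).
Local Notation K := (#|{: letter S}|%:R : R).
Local Notation P := (product_measure (fun _ : letter S => (#|{: letter S}|%:R^-1 : R))).

Lemma card_letter_gt0 : 0 < K.
Proof. by rewrite ltr0n; apply/card_gt0P; exists (letter0 S). Qed.

Let K0 := card_letter_gt0.

Let wK0 (t : letter S) : 0 <= K^-1. Proof. by rewrite invr_ge0 ltW. Qed.

Let wK1 : \sum_(t <- index_enum (letter S)) K^-1 = 1.
Proof. by rewrite sumr_const -[LHS]mulr_natr mulVf// gt_eqF. Qed.

Let uts : uniq (index_enum (letter S)) := index_enum_uniq _.

Lemma chi_measurable : measurable_fun [set: seqspace (letter S)] (chi : seqspace (letter S) -> X).
Proof.
apply: (@measurability _ _ (seqspace (letter S)) X setT chi (@open X)) => //.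
move=> _ [A oA <-]; rewrite setTI.
apply: (measurable_cylinder_open (@letters_all S)) => w /= Aw.
by have [n hn] := open_cylinder hnd oA Aw; exists n => w' /hn.
Qed.

Lemma continuous_measurable (f : X -> R) : continuous f -> measurable_fun [set: X] f.
Proof.
move=> cf; apply: (measurability _ (RGenOInfty.measurableE R)).
move=> _ [_ [y ->] <-]; rewrite setTI; apply: sub_sigma_algebra.
by move/continuousP : cf; apply; exact: interval_open.
Qed.

Lemma Fmap_measurable n (e : word S n) : measurable_fun [set: X] (Fmap R e : X -> X).
Proof.
apply: (@measurability _ _ X X setT _ (@open X)) => //.
move=> _ [A oA <-]; rewrite setTI; apply: sub_sigma_algebra.
apply: (open_quotient hnd) => w /= Aw.
have [m hm] := open_cylinder hnd oA (w := prepend e w) (ltac:(by rewrite -Fmap_chi)).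
exists m => w' ww'; rewrite Fmap_chi//; apply: hm.
by apply: cylinderW (cylinder_prepend e ww'); exact: leq_addr.
Qed.

Lemma integral_mu (F : X -> \bar R) : measurable_fun [set: X] F -> (forall x, 0 <= F x)%E ->
  (\int[mu]_x F x = \int[P]_w F (chi w))%E.
Proof.
by move=> mF F0; rewrite [LHS]ge0_integral_pushforward//; exact: chi_measurable.
Qed.

(** [mu] is a plain set function. This version carries the measure structure that the integration
    lemmas require, and is convertible to it. *)
Definition mu_measure : {measure set X -> \bar R} :=
  measure_function_pushforward__canonical__measure_function_Measure P chi_measurable.

Lemma mu_setT : mu setT = 1%E.
Proof. by rewrite /mu /pushforward preimage_setT probability_setT. Qed.

Lemma chi_cons_seq (x : letter S) w : chi (cons_seq x w) = Fmap R (n := 1) (tt, x) (chi w).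
Proof. by rewrite Fmap_chi//; congr chi; apply/funext => -[]. Qed.

Lemma integral_self_similar1 (F : X -> \bar R) : measurable_fun [set: X] F -> (forall x, 0 <= F x)%E ->
  (\int[mu]_x F x = K^-1%:E * \sum_(x : letter S) \int[mu]_z F (Fmap R (n := 1) (tt, x) z))%E.
Proof.
move=> mF F0; rewrite integral_mu//.
rewrite (product_measure_shift uts (@letters_all S) wK0 wK1)//; last first.
  by apply: measurableT_comp => //; exact: chi_measurable.
rewrite ge0_sume_distrr => [|x _]; last by apply: (integral_ge0 mu_measure) => z _; exact: F0.
apply: eq_bigr => x _; rewrite integral_mu//; last first.
  by apply: measurableT_comp => //; exact: Fmap_measurable.
by congr (_ * _)%E; apply: eq_integral => w _; rewrite chi_cons_seq.
Qed.

Lemma integral_self_similar n (F : X -> \bar R) : measurable_fun [set: X] F -> (forall x, 0 <= F x)%E ->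
  (\int[mu]_x F x = (K ^- n)%:E * \sum_(e : word S n) \int[mu]_z F (Fmap R e z))%E.
Proof.
move=> mF F0; elim: n => [|n IH].
  rewrite expr0 invr1 mul1e (big_pred1 (tt : word S 0)) => [|[]//].
  by congr (integral _ _ _); apply/funext => x; rewrite Fmap0.
rewrite IH exprSr invfM EFinM -muleA; congr (_ * _)%E.
rewrite big_wordS.
rewrite ge0_sume_distrr => [|e _]; last by apply: sume_ge0 => x _; apply: (integral_ge0 mu_measure) => z _; exact: F0.
apply: eq_bigr => e _; rewrite integral_self_similar1//.
  congr (_ * _)%E; apply: eq_bigr => x _.
  by congr (integral _ _ _); apply/funext => z; rewrite (FmapS hnd e).
by apply: measurableT_comp => //; exact: Fmap_measurable.
Qed.

Definition bdry_set (s : bool) : set (seqspace (letter S)) := [set v | forall k, on_bdry s k v].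

Lemma bdry_set_measurable s : measurable (bdry_set s).
Proof.
have -> : bdry_set s = \bigcap_k [set v | on_bdry s k v].
  by apply/seteqP; split => v h; [move=> k _|move=> k]; exact: h.
apply: bigcapT_measurable => k; apply: (measurable_cylinder_open (@letters_all S)) => v /= h.
by exists k => v' /prefix_cylinder; rewrite /on_bdry /= => <-.
Qed.

(** A boundary sequence starts with one of the |I| edges on its side and continues as a boundary
    sequence. As 2 |I| <= |E_1|, each of the two masses is at most half of the larger one. *)
Lemma bdry_set_null s : P (bdry_set s) = 0%E.
Proof.
have fP t : P (bdry_set t) = (fine (P (bdry_set t)))%:E by rewrite fineK// fin_num_measure//; exact: bdry_set_measurable.
have bound t : fine (P (bdry_set t)) <= K^-1 * \sum_(b : label S) fine (P (bdry_set (bsign t b))).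
  rewrite -lee_fin -fP EFinM -sumEFin; under [X in (_ * X)%E]eq_bigr do rewrite -fP.
  have mA := bdry_set_measurable t.
  rewrite -[X in (P X <= _)%E](setIT (bdry_set t)) -integral_indic//.
  rewrite (product_measure_shift uts (@letters_all S) wK0 wK1)//; last first.
    exact/measurable_EFinP.
  rewrite ge0_sume_distrr// [leRHS](partition_big (bedge t : label S -> letter S) xpredT)//=.
  apply: lee_sum => x _; rewrite -ge0_sume_distrr//; apply: lee_wpmul2l; first by rewrite lee_fin invr_ge0 ltW.
  have mx : measurable (cons_seq x @^-1` bdry_set t : set (seqspace (letter S))).
    by rewrite -[X in measurable X]setTI; exact: (cons_seq_measurable (@letters_all S)).
  have -> : (\int[P]_v (\1_(bdry_set t) (cons_seq x v))%:E = P (cons_seq x @^-1` bdry_set t))%E.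
    by rewrite -[X in P X]setIT -integral_indic.
  have cE v : cons_seq x v = scons x v by apply/funext => -[].
  have [[b xb]|nb] := pselect (exists b, x = bedge t b); last first.
    rewrite (_ : _ @^-1` _ = set0) ?measure0 ?sume_ge0//.
    apply/seteqP; split => // v /= /(_ 1%N); rewrite cE => /on_bdry_scons[b [xb _]].
    by apply: nb; exists b.
  rewrite (bigD1 b) ?xb ?eqxx//=; apply: le_trans (_ : P (bdry_set (bsign t b)) <= _)%E.
    apply: le_measure; rewrite ?inE//; first by rewrite -xb.
      exact: bdry_set_measurable.
    move=> v /= vb k; have := vb k.+1; rewrite -xb cE => /on_bdry_scons[c [xc]].
    by have [_ ->] : t = t /\ b = c by apply: (bedge_inj hnd); rewrite -xb.
  by rewrite leeDl// sume_ge0.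
pose M := Num.max (fine (P (bdry_set true))) (fine (P (bdry_set false))).
have M0 : 0 <= M by rewrite le_max fine_ge0.
have le_M t : fine (P (bdry_set t)) <= M by rewrite /M le_max; case: t; rewrite lexx ?orbT.
have half t : fine (P (bdry_set t)) <= M / 2.
  apply: le_trans (bound t) _; apply: le_trans (_ : K^-1 * \sum_(b : label S) M <= _).
    by apply: ler_wpM2l; [rewrite invr_ge0 ltW|apply: ler_sum => b _; exact: le_M].
  rewrite sumr_const -[X in _ * X](mulr_natr M) mulrCA ler_wpM2l// ler_pdivrMl// ler_pdivlMr//.
  have := card_boundary_edges hnd; rewrite -(ler_nat R) natrM mulrC => h.
  have -> : #|(xpredT : pred (label S))| = #|label S| by exact: eq_card.
  by rewrite card_letter.
have : M <= M / 2 by rewrite {1}/M ge_max !half.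
move=> MM; rewrite fP; congr EFin; apply/eqP; rewrite eq_le fine_ge0// andbT.
by apply: le_trans (le_M s) _; lra.
Qed.

Lemma Xcell_measurable n (e : word S n) : measurable (Xcell R e).
Proof.
rewrite -[Xcell R e]setCK; apply: measurableC; apply: sub_sigma_algebra => /=.
rewrite openC.
have -> : Xcell R e = [set chi (prepend e a) | a in setT].
  apply/seteqP; split => [_ [z _ <-]|_ [a _ <-]].
    by exists (repr z).
  by exists (chi a) => //; rewrite Fmap_chi.
apply: (closed_chi_image hnd (@letters_all S)) => [m a b ab|a []//].
by apply: cylinderW (cylinder_prepend e ab); exact: leq_addr.
Qed.

(** Cells overlap, but a sequence in another cell of level [n] whose point lies in X_e continues as
    a boundary sequence, and those form a null set. *)
Lemma integral_Xcell n (e : word S n) (F : X -> \bar R) : measurable_fun [set: X] F -> (forall x, 0 <= F x)%E ->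
  (\int[mu]_(x in Xcell R e) F x = (K ^- n)%:E * \int[mu]_z F (Fmap R e z))%E.
Proof.
move=> mF F0; rewrite (@integral_mkcond _ _ _ mu_measure).
have mFe : measurable_fun [set: X] (F \_ (Xcell R e)).
  by apply/(measurable_restrictT _ _).1 => //; [exact: Xcell_measurable|exact: measurable_funTS].
have Fe0 x : (0 <= (F \_ (Xcell R e)) x)%E by rewrite patchE; case: ifP.
rewrite [LHS](integral_self_similar n)//; congr (_ * _)%E.
rewrite (bigD1 e)//= [X in (_ + X)%E]big1 ?adde0 => [|f fe].
  by congr (integral _ _ _); apply/funext => z; rewrite patchE mem_set//; exists z.
rewrite integral_mu//; last by apply: measurableT_comp => //; exact: Fmap_measurable.
pose N := bdry_set true `|` bdry_set false.
have mN : measurable N by apply: measurableU; exact: bdry_set_measurable.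
rewrite (@ae_eq_integral _ _ _ P setT (cst 0%E)) ?integral0//.
  have mm : measurable_fun [set: X] (fun z => (F \_ (Xcell R e)) (Fmap R f z)).
    by apply: measurableT_comp => //; exact: Fmap_measurable.
  exact: (measurableT_comp mm chi_measurable).
exists N; split => //.
  apply/eqP; rewrite eq_le measure_ge0 andbT; apply: le_trans (measureU2 _ _ _) _; do 1?exact: bdry_set_measurable.
  by rewrite -[X in (_ <= X)%E]adde0; apply: leeD; rewrite le_eqVlt; apply/orP; left; apply/eqP; exact: bdry_set_null.
move=> v /= nv; apply: contrapT => Nv; apply: nv => _; rewrite patchE; case: ifPn => //.
rewrite inE => -[z _]; rewrite Fmap_chi// -(chi_repr z) Fmap_chi// => /chi_eq.
rewrite symb_eq_sym => /(symb_eq_prepend_neq hnd)[].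
  by apply/eqP.
by move=> s hs; exfalso; apply: Nv; case: s hs; [left|right].
Qed.
End LimitMeasure.

Lemma big_lab (S : doubling_igs) (V : nmodType) (F : lab S -> V) :
  \sum_(t : lab S) F t = \sum_(a : label S) F a.
Proof. by apply: (reindex (fun a : label S => a : lab S)); apply: onW_bij; exists id. Qed.

Lemma big_letter (S : doubling_igs) (V : nmodType) (F : letter S -> V) :
  \sum_(x : letter S) F x = \sum_(x : edge (gen S)) F x.
Proof. by apply: (reindex (fun x : edge (gen S) => x : letter S)); apply: onW_bij; exists id. Qed.

(** * Energy of continuous functions *)

Section ContinuousEnergy.
Context (R : realType) (S : doubling_igs) (p : R).
Hypothesis hnd : non_degenerate S.
Hypothesis hcu : conductively_uniform R S.
Hypothesis p1 : 1 < p.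
Local Notation X := (limspace R S).
Local Notation chi := (chi R (S := S)).
Local Notation mu := (mu R S).
Local Notation K := (#|{: letter S}|%:R : R).
Local Notation M := (Mp S p).
Local Notation J := (@Jlab R S p).
Local Notation PJ := (product_measure J).
Implicit Types f g : X -> R.

Let p0 : 0 < p. Proof. exact: lt_trans p1. Qed.

Lemma cylinder_theta s n (a b : nat -> lab S) : cylinder n a b ->
  cylinder n (theta s a) (theta s b).
Proof.
elim: n s a b => [//|n IH] s a b ab; rewrite [theta s a]theta_shift [theta s b]theta_shift (ab 0%N)//.
by apply: cylinder_scons; apply: IH => i iN; exact: ab.
Qed.

Lemma lab_all (t : lab S) : t \in index_enum (lab S).
Proof. exact: mem_index_enum. Qed.

Lemma cylinder_continuous_causal f (g : (nat -> lab S) -> symb S) : continuous f ->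
  (forall n a b, cylinder n a b -> cylinder n (g a) (g b)) ->
  cylinder_continuous (fun a => f (chi (g a))).
Proof.
move=> cf gc e e0; have [n hn] := continuous_uniform hnd cf e0.
by exists n => a b ab; apply: hn; exact: gc.
Qed.

Definition fibre_mean s f : R := \int[PJ]_a f (chi (theta s a)).

Let tau_cont s f : continuous f -> cylinder_continuous (fun a => f (chi (theta s a))).
Proof. by move=> cf; apply: cylinder_continuous_causal => // n a b; exact: cylinder_theta. Qed.

Let Jlab_ge0' (t : lab S) : 0 <= J t. Proof. exact: Jlab_ge0. Qed.

Let Jlab_sum' : \sum_(t <- index_enum (lab S)) J t = 1. Proof. by rewrite big_lab Jlab_sum. Qed.

Local Notation tau := fibre_mean.

Lemma fibre_mean_shift s f : continuous f ->
  tau s f = \sum_(a : label S) J a * tau (bsign s a) (f \o Fmap R (n := 1) (tt, bedge s a)).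
Proof.
move=> cf; rewrite /fibre_mean (Rintegral_shift (index_enum_uniq (lab S)) lab_all Jlab_ge0' Jlab_sum')//; last exact: tau_cont.
rewrite big_lab; apply: eq_bigr => t _; congr (_ * _); apply: eq_Rintegral => a _ /=.
rewrite Fmap_chi//=; congr (f (chi _)); rewrite theta_shift; congr (scons _ _).
Qed.

Lemma fibre_mean_near s f c D : continuous f -> (forall x, `|f x - c| <= D) -> `|tau s f - c| <= D.
Proof. by move=> cf fD; apply: (Rintegral_near _ lab_all); [exact: tau_cont|move=> a; exact: fD]. Qed.

Lemma fibre_meanD s f g : continuous f -> continuous g -> tau s (f \+ g) = tau s f + tau s g.
Proof.
move=> cf cg; rewrite /fibre_mean -RintegralD//; apply: (cylinder_continuous_integrable _ lab_all).
  exact: tau_cont cf.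
exact: tau_cont cg.
Qed.

Lemma fibre_meanB s f g : continuous f -> continuous g -> tau s (f \- g) = tau s f - tau s g.
Proof.
move=> cf cg; rewrite /fibre_mean -RintegralB//; apply: (cylinder_continuous_integrable _ lab_all).
  exact: tau_cont cf.
exact: tau_cont cg.
Qed.

Lemma fibre_mean_cst s c : tau s (fun=> c) = c.
Proof. exact: Rintegral_prob_cst. Qed.

(** [edge_at] may return an edge other than [e]; both address the same fibre by [symb_eq_theta]. The
    fibre is closed, hence measurable, as the integral over it requires. *)
Lemma Vavg_fibre_mean n s (e : word S n) f : continuous f -> Vavg p f (lpole s e) = tau s (f \o Fmap R e).
Proof.
move=> cf; rewrite /Vavg /Jfib /Fib; set v := lpole s e.
have : v \in lends (edge_at v).
  by apply: (@xgetPex _ _ [set e | v \in lends e]); exists e; apply/lendsP; exists s.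
move: (edge_at v) => e' /lendsP[t ve'].
have TE : Tfib v e' = (fun a => prepend e' (theta t a)).
  by apply/funext => a; rewrite ve' TfibE.
set phi := chi \o Tfib v e'.
have gc m a b : cylinder m a b -> cylinder m (prepend e' (theta t a)) (prepend e' (theta t b)).
  by move=> /(cylinder_theta t)/(cylinder_prepend e'); apply: cylinderW; exact: leq_addr.
have mphi : measurable_fun [set: seqspace (lab S)] (phi : seqspace (lab S) -> X).
  apply: (@measurability _ _ (seqspace (lab S)) X setT phi (@open X)) => //.
  move=> _ [A oA <-]; rewrite setTI; apply: (measurable_cylinder_open lab_all) => a /= Aa.
  have [m hm] := open_cylinder hnd oA Aa; exists m => b ab; apply: hm.
  by rewrite TE; exact: gc.
have mD : measurable (range phi : set X).
  rewrite -[range _]setCK; apply: measurableC; apply: sub_sigma_algebra => /=.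
  rewrite openC /phi TE.
  by apply: (closed_chi_image hnd (K := setT) lab_all) => // a [].
have phiT : phi @^-1` range phi = setT by apply/seteqP; split => // a _; exists a.
have fphi : f \o phi = (fun a => (f \o Fmap R e) (chi (theta s a))).
  apply/funext => a; rewrite /phi TE /= Fmap_chi//; congr f; apply/chi_eq.
  by rewrite symb_eq_sym; exact: symb_eq_theta.
rewrite integral_pushforward//=.
- rewrite phiT /fibre_mean /Rintegral; congr fine; apply: eq_integral => a _.
  by rewrite -[X in X%:E]/((f \o phi) a) fphi.
- by apply/measurable_EFinP; exact: continuous_measurable.
- rewrite phiT; apply: (cylinder_continuous_integrable _ lab_all).
  by rewrite -/(f \o phi) fphi; apply: tau_cont; exact: continuous_Fmap.
Qed.

Definition level_energy n f : R :=
  M ^- n * \sum_(e : word S n) `|tau false (f \o Fmap R e) - tau true (f \o Fmap R e)| `^ p.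

Local Notation en := level_energy.

Lemma level_energyE n f : continuous f -> M ^- n * energy (lpole (n := n)) p (Vavg p f) = en n f.
Proof.
by move=> cf; congr (_ * _); apply: eq_bigr => e _; rewrite !Vavg_fibre_mean.
Qed.

Let M0 : 0 < M := Mp_gt0 S p1.

Lemma level_energy_ge0 n f : 0 <= en n f.
Proof. by rewrite mulr_ge0 ?invr_ge0 ?exprn_ge0 ?(ltW M0)// sumr_ge0// => e _; exact: powR_ge0. Qed.

Lemma level_energy0 f : en 0 f = `|tau false f - tau true f| `^ p.
Proof.
rewrite /level_energy expr0 invr1 mul1r (big_pred1 (tt : word S 0)) => [|[]//].
by have -> : f \o Fmap R (tt : word S 0) = f by apply/funext => x /=; rewrite Fmap0.
Qed.

(** [big_wordS] separates the last letter, whereas self-similarity concerns the first one. The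
    functional [H] is arbitrary so as to serve for limit energies as well as for differences of
    fibre means. *)
Lemma big_word_cons n (H : (X -> R) -> R) f :
  \sum_(e : word S n.+1) H (f \o Fmap R e) =
  \sum_(x : letter S) \sum_(e : word S n) H ((f \o Fmap R (n := 1) (tt, x)) \o Fmap R e).
Proof.
elim: n H f => [|n IH] H f.
  rewrite big_wordS (big_pred1 (tt : word S 0)) => [|[]//].
  apply: eq_bigr => x _; rewrite (big_pred1 (tt : word S 0)) => [|[]//].
  by congr H; apply/funext => z /=; rewrite Fmap0.
pose H1 g := \sum_(y : letter S) H (g \o Fmap R (n := 1) (tt, y)).
have HE m g : \sum_(e : word S m.+1) H (g \o Fmap R e) = \sum_(e : word S m) H1 (g \o Fmap R e).
  rewrite big_wordS; apply: eq_bigr => e _; apply: eq_bigr => x _.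
  by congr H; apply/funext => z /=; rewrite (FmapS hnd e).
by rewrite HE IH; apply: eq_bigr => x _; rewrite HE.
Qed.

Lemma level_energy_letters n f : en n.+1 f = M^-1 * \sum_(x : letter S) en n (f \o Fmap R (n := 1) (tt, x)).
Proof.
rewrite /level_energy (big_word_cons n (fun g => `|tau false g - tau true g| `^ p)).
by rewrite exprS invfM -mulrA -mulr_sumr.
Qed.

Lemma level_energy1E f : continuous f ->
  en 1 f = M^-1 * energy (@gpole S) p (fun z => Vavg p f (vclass z (tt : word S 0))).
Proof.
move=> cf; rewrite level_energy_letters big_letter; congr (_ * _); apply: eq_bigr => x _.
by rewrite level_energy0 -!Vavg_fibre_mean// !lpoleS.
Qed.

Lemma fibre_mean_vertices s f : continuous f ->
  tau s f = \sum_(a : label S) J a * Vavg p f (vclass (phipm S s a) (tt : word S 0)).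
Proof.
move=> cf; rewrite fibre_mean_shift//; apply: eq_bigr => a _; congr (_ * _).
by rewrite -Vavg_fibre_mean// lpoleS/= bedgeP.
Qed.

Lemma level_energy_le01 f : continuous f -> en 0 f <= en 1 f.
Proof.
move=> cf; rewrite level_energy0 level_energy1E// distrC !fibre_mean_vertices// -sumrB.
apply: le_trans (Jlab_energy p1 hcu _); under eq_bigr do rewrite -mulrBr.
exact: lexx.
Qed.

Lemma level_energy_leS n f : continuous f -> en n f <= en n.+1 f.
Proof.
elim: n f => [|n IH] f cf; first exact: level_energy_le01.
rewrite level_energy_letters [leRHS]level_energy_letters ler_wpM2l ?invr_ge0 ?(ltW M0)//.
by apply: ler_sum => x _; apply: IH; exact: continuous_Fmap.
Qed.

Lemma level_energy_homo m n f : continuous f -> (m <= n)%N -> en m f <= en n f.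
Proof.
move=> cf /subnK <-; elim: (n - m)%N => // k IH; exact: le_trans IH (level_energy_leS _ cf).
Qed.

Lemma Ects_cvg f : continuous f -> (en n f)%:E @[n --> \oo] --> Ects p f.
Proof.
move=> cf; rewrite /Ects.
have -> : (fun n => (M ^- n * energy (lpole (n := n)) p (Vavg p f))%:E) = (fun n => (en n f)%:E).
  by apply/funext => n; rewrite level_energyE.
apply: ereal_nondecreasing_is_cvgn => m n mn; rewrite lee_fin; exact: level_energy_homo.
Qed.

Lemma level_energy_le_Ects n f : continuous f -> ((en n f)%:E <= Ects p f)%E.
Proof.
move=> cf; have h := Ects_cvg cf; rewrite -(cvg_lim _ h)//.
apply: lime_ge; first by apply/cvg_ex; exists (Ects p f).
by exists n => // m /= nm; rewrite lee_fin; exact: level_energy_homo.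
Qed.

Lemma Ects_le f (c : \bar R) : continuous f -> (forall n, ((en n f)%:E <= c)%E) -> (Ects p f <= c)%E.
Proof.
move=> cf h; have hc := Ects_cvg cf; rewrite -(cvg_lim _ hc)//.
by apply: lime_le; [apply/cvg_ex; exists (Ects p f)|exact: nearW].
Qed.

Lemma Ects_ge0 f : continuous f -> (0 <= Ects p f)%E.
Proof. by move=> cf; apply: le_trans (level_energy_le_Ects 0 cf); rewrite lee_fin level_energy_ge0. Qed.

Lemma Ccts_fin f : Ccts p f -> Ects p f = (fine (Ects p f))%:E.
Proof. by move=> [cf fo]; rewrite fineK// ge0_fin_numE// Ects_ge0. Qed.

Lemma level_energy_le f n : Ccts p f -> en n f <= fine (Ects p f).
Proof. by move=> Cf; rewrite -lee_fin -(Ccts_fin Cf); apply: level_energy_le_Ects; case: Cf. Qed.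

Lemma level_energy_cvg f : Ccts p f -> en n f @[n --> \oo] --> fine (Ects p f).
Proof.
move=> Cf; have : (en n f)%:E @[n --> \oo] --> (fine (Ects p f))%:E.
  by rewrite -(Ccts_fin Cf); apply: Ects_cvg; case: Cf.
by move/fine_cvg.
Qed.


Lemma sum_cst_card (T : finType) (c : R) : \sum_(i : T) c = #|{: T}|%:R * c.
Proof. by rewrite sumr_const -[LHS]mulr_natl; congr (_%:R * _); exact: eq_card. Qed.

Lemma card_word n : #|{: word S n}|%:R = K ^+ n.
Proof.
elim: n => [|n IH]; first by rewrite card_unit.
by rewrite exprSr -IH -natrM; congr (_%:R); rewrite /= card_prod.
Qed.

Local Notation C0 := (#|vert (gen S)|%:R `^ p * M).

Let C0_ge0 : 0 <= C0. Proof. by rewrite mulr_ge0 ?powR_ge0 ?(ltW M0). Qed.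

(** Both means come from the values of V_1[f] on the generator: tau_+ f is an average of them, and
    tau_+ (f o F_x) is the value at x^+. These values differ by at most the number of vertices times
    the largest gradient, whose [p]-th power is at most [M * en 1 f]. *)
Lemma fibre_mean_oscillation f x : continuous f ->
  `|tau true (f \o Fmap R (n := 1) (tt, x)) - tau true f| `^ p <= C0 * en 1 f.
Proof.
move=> cf; pose V z := Vavg p f (vclass z (tt : word S 0)).
set D := (M * en 1 f) `^ p^-1.
have D0 : 0 <= D by exact: powR_ge0.
have Me0 : 0 <= M * en 1 f by rewrite mulr_ge0 ?level_energy_ge0 ?(ltW M0).
have DE : D `^ p = M * en 1 f by rewrite /D -powRrM mulVf ?gt_eqF// powRr1.
have VD y : `|V (gpole false y) - V (gpole true y)| <= D.
  rewrite leNgt; apply/negP => lt; have : D `^ p < `|V (gpole false y) - V (gpole true y)| `^ p.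
    by rewrite gt0_ltr_powR// nnegrE.
  rewrite DE level_energy1E// mulrA mulfV ?gt_eqF// mul1r ltNge => /negP; apply.
  by rewrite /energy (bigD1 y)//= lerDl sumr_ge0// => z _; exact: powR_ge0.
have osc v w : `|V v - V w| <= #|vert (gen S)|%:R * D by exact: generator_oscillation.
have le : `|tau true (f \o Fmap R (n := 1) (tt, x)) - tau true f| <= #|vert (gen S)|%:R * D.
  rewrite -Vavg_fibre_mean// lpoleS/= -/(V _) fibre_mean_vertices//.
  have -> : V (gpole true x) = \sum_(a : label S) J a * V (gpole true x).
    by rewrite -mulr_suml Jlab_sum// mul1r.
  rewrite -sumrB; apply: le_trans (ler_norm_sum _ _ _) _.
  have -> : #|vert (gen S)|%:R * D = \sum_(a : label S) J a * (#|vert (gen S)|%:R * D).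
    by rewrite -mulr_suml Jlab_sum// mul1r.
  apply: ler_sum => a _.
  rewrite -mulrBr normrM ger0_norm ?Jlab_ge0'//; apply: ler_wpM2l; first exact: Jlab_ge0'.
  exact: osc.
rewrite -mulrA -DE -powRM//; apply: ge0_ler_powR => //; rewrite ?nnegrE ?mulr_ge0//.
exact: ltW.
Qed.

Lemma Mp_le_card : K^-1 * M <= 2 `^ (- p).
Proof.
rewrite ler_pdivrMl ?card_letter_gt0//; apply: le_trans (Mp_le hnd p1) _.
by rewrite card_letter.
Qed.

(** The constant is the one that reproduces itself: with a = 2^(p-1), a step leads to the bound a C0
    (2^p (M/K) en_(N+1) + en_1), which is at most 2 a C0 en_(N+1) because 2^p M/K <= 1 and the level
    energies increase. *)
Lemma fibre_mean_cells N f : continuous f ->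
  K ^- N * \sum_(e : word S N) `|tau true (f \o Fmap R e) - tau true f| `^ p
    <= 2 `^ p * C0 * en N f.
Proof.
have K0 := card_letter_gt0 R S; have p0' : p != 0 by rewrite gt_eqF.
elim: N f => [|N IH] f cf.
  rewrite (big_pred1 (tt : word S 0)) => [|[]//].
  have -> : f \o Fmap R (tt : word S 0) = f by apply/funext => x /=; rewrite Fmap0.
  rewrite subrr normr0 powR0// mulr0; apply: mulr_ge0; last exact: level_energy_ge0.
  by apply: mulr_ge0 => //; exact: powR_ge0.
set c := tau true f; pose fx (x : letter S) := f \o Fmap R (n := 1) (tt, x).
have cfx x : continuous (fx x) by exact: continuous_Fmap.
rewrite (big_word_cons N (fun g => `|tau true g - c| `^ p)).
set a := (2 : R) `^ (p - 1); have a0 : 0 <= a by exact: powR_ge0.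
have aE : 2 `^ p = 2 * a.
  by rewrite /a -[X in X * _](powRr1 (ltW (ltr0Sn R 1))) -powRD ?subrKC// pnatr_eq0 implybT.
have step1 x : \sum_(e : word S N) `|tau true (fx x \o Fmap R e) - c| `^ p <=
    a * (K ^+ N * (2 `^ p * C0 * en N (fx x)) + K ^+ N * (C0 * en 1 f)).
  apply: le_trans (_ : \sum_(e : word S N) a * (`|tau true (fx x \o Fmap R e) - tau true (fx x)| `^ p
     + C0 * en 1 f) <= _).
    apply: ler_sum => e _; rewrite -(subrKA (tau true (fx x))).
    apply: le_trans (normD_powR _ _ (ltW p1)) _; rewrite ler_wpM2l// lerD2l.
    exact: fibre_mean_oscillation.
  rewrite -mulr_sumr ler_wpM2l// big_split /= sum_cst_card card_word lerD2r.
  by have := IH _ (cfx x); rewrite ler_pdivrMl ?exprn_gt0// card_word.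
apply: le_trans (_ : K ^- N.+1 * \sum_(x : letter S)
   a * (K ^+ N * (2 `^ p * C0 * en N (fx x)) + K ^+ N * (C0 * en 1 f)) <= _).
  by rewrite ler_wpM2l ?invr_ge0 ?exprn_ge0 ?(ltW K0)//; apply: ler_sum => x _; exact: step1.
rewrite -mulr_sumr big_split /= -[X in X + _]mulr_sumr -[X in _ * X + _]mulr_sumr.
have -> : \sum_(x : letter S) K ^+ N * (C0 * en 1 f) = K * (K ^+ N * (C0 * en 1 f)) by exact: sum_cst_card.
have -> : \sum_(x : letter S) en N (fx x) = M * en N.+1 f.
  by rewrite level_energy_letters mulrA mulfV ?gt_eqF// mul1r.
have e1 : en 1 f <= en N.+1 f by exact: level_energy_homo.
have e0 := level_energy_ge0 N.+1 f.
have KN : K ^+ N != 0 by rewrite expf_neq0// gt_eqF.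
have K0' : K != 0 by rewrite gt_eqF.
have -> : K ^- N.+1 * (a * (K ^+ N * (2 `^ p * C0 * (M * en N.+1 f)) + K * (K ^+ N * (C0 * en 1 f)))) =
  a * C0 * (2 `^ p * (K^-1 * M) * en N.+1 f + en 1 f).
  by rewrite exprS; field; rewrite KN K0'.
have -> : 2 `^ p * C0 * en N.+1 f = a * C0 * (en N.+1 f + en N.+1 f) by rewrite aE; ring.
apply: ler_wpM2l; first by rewrite mulr_ge0.
apply: lerD => //; rewrite -[leRHS]mul1r; apply: ler_wpM2r => //.
apply: le_trans (_ : 2 `^ p * 2 `^ (- p) <= _).
  by apply: ler_wpM2l; [exact: powR_ge0|exact: Mp_le_card].
by rewrite -powRD ?subrr ?powRr0// pnatr_eq0 implybT.
Qed.

Lemma measurable_norm_powR f c : measurable_fun [set: X] f ->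
  measurable_fun [set: X] (fun x => (`|f x - c| `^ p)%:E).
Proof.
move=> mf; apply/measurable_EFinP.
apply: (measurableT_comp (measurable_powR p)); apply: measurableT_comp => //.
exact: measurable_funB.
Qed.

Lemma integral_le_cst (F : X -> \bar R) (c : R) : measurable_fun [set: X] F ->
  (forall x, 0 <= F x)%E -> (forall x, F x <= c%:E)%E -> (\int[mu]_x F x <= c%:E)%E.
Proof.
move=> mF F0 Fc; have h : (\int[mu_measure R hnd]_x F x <= \int[mu_measure R hnd]_x (cst c%:E) x)%E.
  by apply: ge0_le_integral => //; move=> x _; exact: le_trans (Fc x).
apply: le_trans h _; rewrite integral_cst//.
rewrite -[X in (_ * X)%E]/(mu setT).
by rewrite mu_setT mule1.
Qed.

Lemma cylinder_word n (e : word S n) (u w : symb S) : cylinder n (prepend e u) (prepend e w).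
Proof. by rewrite -[X in cylinder X]add0n; apply: cylinder_prepend. Qed.

Lemma poincare_cts f (c : R) : continuous f -> (forall n, en n f <= c) ->
  (\int[mu]_x (`|f x - tau true f| `^ p)%:E <= (2 `^ (p - 1) * (2 `^ p * C0 * c))%:E)%E.
Proof.
move=> cf fc; have K0 := card_letter_gt0 R S; set a := (2 : R) `^ (p - 1); have a0 : 0 <= a by exact: powR_ge0.
have c0 : 0 <= c by exact: le_trans (level_energy_ge0 0 f) (fc 0%N).
apply/lee_addgt0Pr => eps e0.
(* [d] is the oscillation allowed on the cells of level [N]; its [p]-th power [eps / (1 + a)]
   absorbs the factor [a] of the convexity inequality. *)
have [d [d0 dE _]] := powR_root (divr_gt0 e0 (ltr_pwDl ltr01 a0)) p0.
have ad : a * d `^ p <= eps.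
  rewrite dE mulrCA ler_piMr ?(ltW e0)// ler_pdivrMr ?ltr_pwDl// mul1r.
  by rewrite lerDr.
have [N hN] := continuous_uniform hnd cf d0.
have mF : measurable_fun [set: X] (fun x => (`|f x - tau true f| `^ p)%:E).
  by apply: measurable_norm_powR; exact: continuous_measurable.
rewrite (integral_self_similar hnd N)//.
have bnd (e : word S N) z : `|f (Fmap R e z) - tau true f| `^ p <=
   a * (d `^ p + `|tau true (f \o Fmap R e) - tau true f| `^ p).
  rewrite -(subrKA (tau true (f \o Fmap R e))); apply: le_trans (normD_powR _ _ (ltW p1)) _.
  rewrite ler_wpM2l// lerD2r; apply: ge0_ler_powR; rewrite ?nnegrE ?(ltW p0) ?(ltW d0)//.
  rewrite distrC; apply: fibre_mean_near; first exact: continuous_Fmap.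
  move=> x /=; apply/ltW; rewrite -(chi_repr x) -(chi_repr z) !Fmap_chi//; apply: hN.
  exact: cylinder_word.
apply: le_trans (_ : (K ^- N)%:E * \sum_(e : word S N) (a * (d `^ p + `|tau true (f \o Fmap R e) - tau true f| `^ p))%:E <= _)%E.
  apply: lee_wpmul2l; first by rewrite lee_fin invr_ge0 exprn_ge0// ltW.
  apply: lee_sum => e _; apply: integral_le_cst => [|x|x]; rewrite ?lee_fin ?powR_ge0//.
  exact: (measurableT_comp mF (Fmap_measurable hnd e)).
rewrite sumEFin -EFinM -EFinD lee_fin -mulr_sumr big_split /= sum_cst_card card_word.
have := fibre_mean_cells N cf.
set T := \sum_(e : word S N) _ => TN.
have KN : K ^+ N != 0 by rewrite expf_neq0// gt_eqF.
have -> : K ^- N * (a * (K ^+ N * d `^ p + T)) = a * (d `^ p) + a * (K ^- N * T) by field.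
rewrite addrC lerD// ler_wpM2l//; apply: le_trans TN _.
by rewrite ler_wpM2l// mulr_ge0// powR_ge0.
Qed.

End ContinuousEnergy.

#[local] Opaque powR Ects fibre_mean.

(** * Self-similarity, trace estimates and closability of the energy *)

Section EnergySpace.
Context (R : realType) (S : doubling_igs) (p : R).
Hypothesis hnd : non_degenerate S.
Hypothesis hcu : conductively_uniform R S.
Hypothesis p1 : 1 < p.
Local Notation X := (limspace R S).
Local Notation chi := (chi R (S := S)).
Local Notation mu := (mu R S).
Local Notation K := (#|{: letter S}|%:R : R).
Local Notation M := (Mp S p).
Local Notation tau := (@fibre_mean R S p).
Local Notation en := (@level_energy R S p).
Local Notation a := (2 `^ (p - 1) : R).
Implicit Types f g : X -> R.

Let p0 : 0 < p. Proof. exact: lt_trans p1. Qed.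
Let a0 : 0 <= a. Proof. exact: powR_ge0. Qed.
Let M0 : 0 < M := Mp_gt0 S p1.
Let K0 : 0 < K := card_letter_gt0 R S.

Lemma powR_root_add (u v : R) : 0 <= u -> 0 <= v ->
  (u `^ p^-1 + v `^ p^-1) `^ p <= a * (u + v).
Proof.
move=> u0 v0; have uE : (u `^ p^-1) `^ p = u by rewrite -powRrM mulVf ?gt_eqF// powRr1.
have vE : (v `^ p^-1) `^ p = v by rewrite -powRrM mulVf ?gt_eqF// powRr1.
suff : (u `^ p^-1 + v `^ p^-1) `^ p <= a * ((u `^ p^-1) `^ p + (v `^ p^-1) `^ p) by rewrite uE vE.
have := normD_powR (u `^ p^-1) (v `^ p^-1) (ltW p1).
have := powR_ge0 u p^-1; have := powR_ge0 v p^-1.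
move: (u `^ p^-1) (v `^ p^-1) => x y y0 x0.
by rewrite (ger0_norm (addr_ge0 x0 y0)) (ger0_norm x0) (ger0_norm y0).
Qed.

Lemma frac_le (x y : R) : 0 <= x -> 0 <= y -> x / (y + 1) * y <= x.
Proof.
move=> x0 y0; rewrite -mulrA ler_piMr// mulrC ler_pdivrMr ?ltr_wpDl// mul1r.
by rewrite lerDl.
Qed.

Definition cts_energy f : R := fine (Ects p f).
Definition Lp_pow f : \bar R := (\int[mu]_x (`|f x| `^ p)%:E)%E.
Definition Lp_pow_fine f : R := fine (Lp_pow f).

Local Notation E := cts_energy.
Local Notation Np := Lp_pow.
Local Notation N := Lp_pow_fine.

Lemma cts_energy_ge0 f : continuous f -> 0 <= E f.
Proof. by move=> cf; rewrite fine_ge0// Ects_ge0. Qed.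

Lemma Ccts_cont f : Ccts p f -> continuous f. Proof. by case. Qed.

Lemma cts_energy_bound f c : continuous f -> (forall n, en n f <= c) -> Ccts p f /\ E f <= c.
Proof.
move=> cf fc; have h : (Ects p f <= c%:E)%E by apply: Ects_le => // n; rewrite lee_fin.
have Cf : Ccts p f by split => //; exact: le_lt_trans h (ltry _).
by split => //; rewrite -lee_fin /cts_energy -(Ccts_fin hnd hcu p1 Cf).
Qed.

Lemma continuous_funD f g : continuous f -> continuous g -> continuous (f \+ g).
Proof. by move=> cf cg x; apply: continuousD; [exact: cf|exact: cg]. Qed.

Lemma continuous_funB f g : continuous f -> continuous g -> continuous (f \- g).
Proof. by move=> cf cg x; apply: continuousB; [exact: cf|exact: cg]. Qed.

(** With the factor [M ^- n] moved inside, the level energy is the [p]-th power of an l^p norm, to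
    which the inequalities for finite sums apply. *)
Lemma level_energy_scaled n f : continuous f ->
  en n f = \sum_(e : word S n) `|(M ^- n) `^ p^-1 * (tau false (f \o Fmap R e) - tau true (f \o Fmap R e))| `^ p.
Proof.
move=> cf; rewrite /level_energy mulr_sumr; apply: eq_bigr => e _.
have h : 0 <= M ^- n by rewrite invr_ge0 exprn_ge0 ?(ltW M0).
by rewrite normrM ger0_norm ?powR_ge0// powRM ?powR_ge0// -powRrM mulVf ?gt_eqF// powRr1.
Qed.

Lemma fibre_mean_cellD s n (e : word S n) f g : continuous f -> continuous g ->
  tau s ((f \+ g) \o Fmap R e) = tau s (f \o Fmap R e) + tau s (g \o Fmap R e).
Proof. by move=> cf cg; rewrite -fibre_meanD//; exact: continuous_Fmap. Qed.

Lemma fibre_mean_cellB s n (e : word S n) f g : continuous f -> continuous g ->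
  tau s ((f \- g) \o Fmap R e) = tau s (f \o Fmap R e) - tau s (g \o Fmap R e).
Proof. by move=> cf cg; rewrite -fibre_meanB//; exact: continuous_Fmap. Qed.

Lemma level_energy_minkowski n f g : continuous f -> continuous g ->
  en n (f \+ g) <= (en n f `^ p^-1 + en n g `^ p^-1) `^ p.
Proof.
move=> cf cg; rewrite !level_energy_scaled//; last exact: continuous_funD.
apply: le_trans (minkowski_sum (ltW p1) (fun e => normr_ge0 _) (fun e => normr_ge0 _)).
apply: ler_sum => e _; apply: ge0_ler_powR; rewrite ?nnegrE ?addr_ge0 ?(ltW p0)//.
rewrite !fibre_mean_cellD//; apply: le_trans (ler_normD _ _); rewrite -mulrDr.
move: (tau false (f \o Fmap R e)) (tau true (f \o Fmap R e)) => x1 x2.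
by move: (tau false (g \o Fmap R e)) (tau true (g \o Fmap R e)) => y1 y2; rewrite addrACA opprD.
Qed.

Lemma level_energyBC n f g : continuous f -> continuous g -> en n (f \- g) = en n (g \- f).
Proof.
move=> cf cg; rewrite /level_energy; congr (_ * _); apply: eq_bigr => e _.
have -> : tau false ((f \- g) \o Fmap R e) - tau true ((f \- g) \o Fmap R e) =
   - (tau false ((g \- f) \o Fmap R e) - tau true ((g \- f) \o Fmap R e)).
  rewrite !fibre_mean_cellB//.
  move: (tau false (f \o Fmap R e)) (tau true (f \o Fmap R e)) => x1 x2.
  by move: (tau false (g \o Fmap R e)) (tau true (g \o Fmap R e)) => y1 y2; ring.
by rewrite normrN.
Qed.

Lemma cts_energyBC f g : continuous f -> continuous g -> E (f \- g) = E (g \- f).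
Proof.
move=> cf cg; apply: (congr1 fine).
have cfg := continuous_funB cf cg; have cgf := continuous_funB cg cf.
apply/eqP; rewrite eq_le; apply/andP; split; apply: Ects_le => // n.
  by rewrite level_energyBC//; exact: level_energy_le_Ects.
by rewrite level_energyBC//; exact: level_energy_le_Ects.
Qed.

Lemma cts_energy_minkowski f g : Ccts p f -> Ccts p g ->
  Ccts p (f \+ g) /\ E (f \+ g) <= (E f `^ p^-1 + E g `^ p^-1) `^ p.
Proof.
move=> Cf Cg; have [cf cg] := (Ccts_cont Cf, Ccts_cont Cg).
apply: cts_energy_bound; first exact: continuous_funD.
move=> n; apply: le_trans (level_energy_minkowski n cf cg) _.
apply: ge0_ler_powR; rewrite ?nnegrE ?addr_ge0 ?powR_ge0 ?(ltW p0)//.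
apply: lerD; apply: ge0_ler_powR; rewrite ?nnegrE ?invr_ge0 ?(ltW p0) ?level_energy_ge0 ?cts_energy_ge0//; exact: level_energy_le.
Qed.

Lemma Ccts0 : Ccts p (fun _ : X => 0) /\ E (fun=> 0) = 0.
Proof.
have c0 : continuous (fun _ : X => 0 : R) by move=> x; exact: cst_continuous.
have [|C h] := @cts_energy_bound (fun=> 0) 0 c0.
  move=> n; rewrite /level_energy big1 ?mulr0// => e _.
  by rewrite [_ \o _](_ : _ = (fun=> 0))// !fibre_mean_cst subrr normr0 powR0// gt_eqF.
by split => //; apply/eqP; rewrite eq_le h cts_energy_ge0.
Qed.

Lemma CctsB f g : Ccts p f -> Ccts p g -> Ccts p (f \- g).
Proof.
move=> Cf Cg; have [C0 E0] := Ccts0.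
have [cf cg] := (Ccts_cont Cf, Ccts_cont Cg).
have [CN _] : Ccts p ((fun=> 0) \- g) /\ E ((fun=> 0) \- g) <= E (g \- (fun=> 0)).
  have c0 : continuous (fun _ : X => 0 : R) by case: C0.
  have gE : g \- (fun=> 0) = g by apply/funext => x /=; rewrite subr0.
  apply: cts_energy_bound => [|n]; first exact: continuous_funB.
  by rewrite level_energyBC// gE; exact: level_energy_le.
have -> : f \- g = f \+ ((fun=> 0) \- g) by apply/funext => x /=; rewrite sub0r.
by have [] := cts_energy_minkowski Cf CN.
Qed.

Lemma cts_energy_triangle f g : Ccts p f -> Ccts p g ->
  E f `^ p^-1 <= E (f \- g) `^ p^-1 + E g `^ p^-1.
Proof.
move=> Cf Cg; have Cfg := CctsB Cf Cg.
have [_] := cts_energy_minkowski Cfg Cg.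
have -> : (f \- g) \+ g = f by apply/funext => x /=; rewrite subrK.
move=> h; have {h} : E f `^ p^-1 <= ((E (f \- g) `^ p^-1 + E g `^ p^-1) `^ p) `^ p^-1.
  by apply: ge0_ler_powR; rewrite ?nnegrE ?invr_ge0 ?(ltW p0) ?powR_ge0 ?cts_energy_ge0//; exact: Ccts_cont.
by rewrite -powRrM mulfV ?gt_eqF// powRr1// addr_ge0 ?powR_ge0.
Qed.

Lemma cts_energyD_le f g : Ccts p f -> Ccts p g -> Ccts p (f \+ g) /\ E (f \+ g) <= a * (E f + E g).
Proof.
move=> Cf Cg; have [cf cg] := (Ccts_cont Cf, Ccts_cont Cg).
have [C h] := cts_energy_minkowski Cf Cg; split => //; apply: le_trans h _.
by apply: powR_root_add; exact: cts_energy_ge0.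
Qed.

Lemma cts_energy_le_sub f g : Ccts p f -> Ccts p g -> E f <= a * (E (f \- g) + E g).
Proof.
move=> Cf Cg; have [_] := cts_energyD_le (CctsB Cf Cg) Cg.
by have -> : (f \- g) \+ g = f by apply/funext => x /=; rewrite subrK.
Qed.

Lemma Ccts_cell1 f (x : letter S) : Ccts p f -> Ccts p (f \o Fmap R (n := 1) (tt, x)).
Proof.
move=> Cf; have cf := Ccts_cont Cf.
have [|//] := @cts_energy_bound (f \o Fmap R (n := 1) (tt, x)) (M * E f) (continuous_Fmap hnd (e := (tt, x) : word S 1) cf).
move=> n; rewrite -ler_pdivrMl//; apply: le_trans (level_energy_le hnd hcu p1 n.+1 Cf).
rewrite level_energy_letters// ler_wpM2l ?invr_ge0 ?(ltW M0)// (bigD1 x)//= lerDl sumr_ge0// => y _.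
exact: level_energy_ge0.
Qed.

Lemma cts_energy_letters f : Ccts p f -> \sum_(x : letter S) E (f \o Fmap R (n := 1) (tt, x)) = M * E f.
Proof.
move=> Cf; have h1 : \sum_(x : letter S) en n (f \o Fmap R (n := 1) (tt, x)) @[n --> \oo] -->
    \sum_(x : letter S) E (f \o Fmap R (n := 1) (tt, x)).
  have hx x := level_energy_cvg hnd hcu p1 (Ccts_cell1 x Cf).
  by apply: cvg_big => [|x _]; [exact: add_continuous|exact: hx].
have h2 : M * en n.+1 f @[n --> \oo] --> M * E f.
  by apply: cvgMl_tmp; rewrite (cvg_shiftS (fun n => en n f)); exact: level_energy_cvg.
have e : (fun n => \sum_(x : letter S) en n (f \o Fmap R (n := 1) (tt, x))) = (fun n => M * en n.+1 f).
  by apply/funext => n; rewrite level_energy_letters// mulrA mulfV ?gt_eqF// mul1r.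
by rewrite e in h1; exact: (cvg_unique _ h1 h2).
Qed.

Lemma Ccts_cell n (e : word S n) f : Ccts p f -> Ccts p (f \o Fmap R e).
Proof.
elim: n e f => [|n IH] e f Cf.
  by have -> : f \o Fmap R e = f by apply/funext => x /=; rewrite Fmap0.
case: e => e x; have -> : f \o Fmap R (n := n.+1) (e, x) = (f \o Fmap R e) \o Fmap R (n := 1) (tt, x).
  by apply/funext => z /=; rewrite (FmapS hnd e).
by apply: Ccts_cell1; exact: IH.
Qed.

Lemma cts_energy_words n f : Ccts p f -> \sum_(e : word S n) E (f \o Fmap R e) = M ^+ n * E f.
Proof.
elim: n f => [|n IH] f Cf.
  rewrite (big_pred1 (tt : word S 0)) => [|[]//].
  have -> : f \o Fmap R (tt : word S 0) = f by apply/funext => x /=; rewrite Fmap0.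
  by rewrite mul1r.
rewrite (big_word_cons hnd n E); rewrite exprSr -mulrA -cts_energy_letters// mulr_sumr.
by apply: eq_bigr => x _; rewrite (IH _ (Ccts_cell1 x Cf)).
Qed.

Lemma Lp_pow_ge0 f : (0 <= Np f)%E.
Proof. by apply: (integral_ge0 (mu_measure R hnd)) => x _; rewrite lee_fin powR_ge0. Qed.

Lemma measurable_powR_norm f : measurable_fun [set: X] f ->
  measurable_fun [set: X] (fun x => (`|f x| `^ p)%:E).
Proof. by move=> mf; have := measurable_norm_powR p 0 mf; under eq_fun do rewrite subr0. Qed.

Lemma continuous_bounded f : continuous f -> exists B : R, forall x, `|f x| <= B.
Proof.
move=> cf; have [B hB] : exists B : R, forall w : nat -> letter S, `|f (chi w)| <= B.
  apply: (cylinder_continuous_bounded (@letters_all S)).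
  by move=> e e0; have [n hn] := continuous_uniform hnd cf e0; exists n.
by exists B => x; rewrite -(chi_repr x).
Qed.

Lemma Lp_pow_fin f : continuous f -> Np f = (N f)%:E.
Proof.
move=> cf; rewrite /Lp_pow_fine fineK// ge0_fin_numE ?Lp_pow_ge0//.
have [B hB] := continuous_bounded cf.
apply: (le_lt_trans _ (ltry (B `^ p))); apply: integral_le_cst => // [|x].
  by apply: measurable_powR_norm; exact: continuous_measurable.
rewrite lee_fin; apply: ge0_ler_powR; rewrite ?nnegrE ?(ltW p0)//.
exact: le_trans (hB x).
Qed.

Lemma Lp_pow_fine_ge0 f : 0 <= N f.
Proof. by rewrite fine_ge0// Lp_pow_ge0. Qed.

Lemma Lp_pow_words n f : measurable_fun [set: X] f ->
  Np f = ((K ^- n)%:E * \sum_(e : word S n) Np (f \o Fmap R e))%E.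
Proof.
move=> mf; rewrite /Lp_pow (integral_self_similar hnd n)//; exact: measurable_powR_norm.
Qed.

Lemma Lp_pow_fine_words n f : continuous f -> \sum_(e : word S n) N (f \o Fmap R e) = K ^+ n * N f.
Proof.
move=> cf; apply: EFin_inj; rewrite -sumEFin.
have := Lp_pow_words n (continuous_measurable cf); rewrite Lp_pow_fin// => h.
rewrite EFinM h muleA -EFinM mulfV ?expf_neq0 ?gt_eqF// mul1e.
by apply: eq_bigr => e _; rewrite Lp_pow_fin//; exact: continuous_Fmap.
Qed.

Lemma Lp_powD_le f g : measurable_fun [set: X] f -> measurable_fun [set: X] g ->
  (Np (f \+ g)%R <= a%:E * (Np f + Np g))%E.
Proof.
move=> mf mg; have [mf' mg'] := (measurable_powR_norm mf, measurable_powR_norm mg).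
rewrite /Lp_pow -(@ge0_integralD _ _ _ (mu_measure R hnd))//; do ?by move=> x _; rewrite lee_fin powR_ge0.
rewrite -(@ge0_integralZl_EFin _ _ _ (mu_measure R hnd))//; first last.
- exact: emeasurable_funD.
- by move=> x _; rewrite -EFinD lee_fin addr_ge0 ?powR_ge0.
apply: (@ge0_le_integral _ _ _ (mu_measure R hnd)) => //.
- by apply: measurable_powR_norm; exact: measurable_funD.
- by apply: measurable_funeM; exact: emeasurable_funD.
by move=> x _; rewrite -EFinD -EFinM lee_fin; exact: normD_powR (ltW p1).
Qed.

Lemma Lp_pow_cst c : Np (fun=> c) = (`|c| `^ p)%:E.
Proof.
rewrite /Lp_pow (@integral_cst _ _ _ (mu_measure R hnd))//.
by rewrite -[X in (_ * X)%E]/(mu setT) mu_setT mule1.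
Qed.

Local Notation poinc := (2 `^ p * (#|vert (gen S)|%:R `^ p * M) : R).

Let poinc0 : 0 <= poinc.
Proof. by rewrite mulr_ge0 ?mulr_ge0 ?powR_ge0 ?(ltW M0). Qed.

Lemma poincare_Ccts f : Ccts p f -> (Np (fun x => f x - tau true f)%R <= (a * (poinc * E f))%:E)%E.
Proof.
move=> Cf; apply: (poincare_cts hnd hcu p1 (Ccts_cont Cf)) => n; exact: level_energy_le.
Qed.

(** tau_+ f is [f] minus [f - tau_+ f], so the L^p norm and the Poincare inequality control it;
    tau_- f is then reached through the level-0 energy. *)
Lemma trace_base : exists A B : R, [/\ 0 <= A, 0 <= B & forall f s, Ccts p f ->
  `|tau s f| `^ p <= A * N f + B * E f].
Proof.
exists (a + a * a), (a * (a * poinc) + a * (1 + a * (a * poinc))); split.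
- by rewrite addr_ge0// mulr_ge0.
- have h : 0 <= a * (a * poinc) := mulr_ge0 a0 (mulr_ge0 a0 poinc0).
  exact: addr_ge0 h (mulr_ge0 a0 (addr_ge0 ler01 h)).
move=> f s Cf; have cf := Ccts_cont Cf; have N0 := Lp_pow_fine_ge0 f; have E0 := cts_energy_ge0 cf.
have ht : `|tau true f| `^ p <= a * N f + a * (a * poinc) * E f.
  rewrite -lee_fin -Lp_pow_cst.
  have -> : (fun=> tau true f) = f \+ (fun x => - (f x - tau true f)).
    by apply/funext => x /=; rewrite opprB addrC subrK.
  have mf := continuous_measurable cf.
  apply: le_trans (Lp_powD_le mf _) _.
    by apply: measurableT_comp => //; exact: measurable_funB.
  have -> : Np (fun x => - (f x - tau true f)) = Np (fun x => f x - tau true f)%R.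
    by rewrite /Lp_pow; congr (integral _ _ _); apply/funext => x; rewrite normrN.
  apply: le_trans (_ : a%:E * ((N f)%:E + (a * (poinc * E f))%:E) <= _)%E.
    apply: lee_wpmul2l; first by rewrite lee_fin.
    by rewrite Lp_pow_fin//; apply: leeD => //; exact: poincare_Ccts.
  by rewrite -EFinD -EFinM lee_fin mulrDr !mulrA.
case: s; last first.
  have hf : `|tau false f| `^ p <= a * (E f + (a * N f + a * (a * poinc) * E f)).
    rewrite -[tau false f](subrK (tau true f)); apply: le_trans (normD_powR _ _ (ltW p1)) _.
    rewrite ler_wpM2l//; apply: lerD => //.
    by rewrite -level_energy0; exact: level_energy_le.
  apply: le_trans hf _.
  have h1 : 0 <= a * N f by rewrite mulr_ge0.
  have h2 : 0 <= a * (a * poinc) * E f := mulr_ge0 (mulr_ge0 a0 (mulr_ge0 a0 poinc0)) E0.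
  rewrite [leRHS](_ : _ = a * N f + a * (a * poinc) * E f + a * (E f + (a * N f + a * (a * poinc) * E f))).
    by rewrite lerDr addr_ge0.
  by ring.
apply: le_trans ht _; apply: lerD; apply: ler_wpM2r => //; rewrite lerDl mulr_ge0//.
by rewrite addr_ge0// mulr_ge0// mulr_ge0.
Qed.

(** tau_s f is a flow average of means over the boundary cells. Hoelder costs 2^(1-p) / M, and the
    energies of all cells add up to [M * E f], so that [M] cancels in the energy term alone. *)
Lemma trace_step A B : 0 <= A -> 0 <= B ->
  (forall f s, Ccts p f -> `|tau s f| `^ p <= A * N f + B * E f) ->
  forall f s, Ccts p f -> `|tau s f| `^ p <= 2 `^ (1 - p) * M^-1 * K * A * N f + 2 `^ (1 - p) * B * E f.
Proof.
move=> A0 B0 H f s Cf; have cf := Ccts_cont Cf.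
rewrite fibre_mean_shift//; apply: le_trans (hoelder_sum _ _ p1) _.
pose G (x : letter S) := A * N (f \o Fmap R (n := 1) (tt, x)) + B * E (f \o Fmap R (n := 1) (tt, x)).
have G0 x : 0 <= G x by rewrite addr_ge0 ?mulr_ge0 ?Lp_pow_fine_ge0 ?cts_energy_ge0//; exact: continuous_Fmap.
have k0 : 0 <= 2 `^ (1 - p) * M^-1 by rewrite mulr_ge0 ?powR_ge0 ?invr_ge0 ?(ltW M0).
have sumG : \sum_(x : letter S) G x = A * (K * N f) + B * (M * E f).
  rewrite big_split /= -!mulr_sumr cts_energy_letters//; congr (A * _ + _).
  by rewrite -(Lp_pow_fine_words 1 cf) big_wordS (big_pred1 (tt : word S 0)) => [|[]//].
apply: le_trans (_ : 2 `^ (1 - p) * M^-1 * \sum_(x : letter S) G x <= _).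
  apply: ler_pM; [exact: powR_ge0| |exact: (Jlab_sum_powR hnd p1 hcu)|].
    by apply: sumr_ge0 => b _; exact: powR_ge0.
  apply: le_trans (_ : \sum_(b : label S) G (bedge s b) <= _).
    apply: ler_sum => b _; apply: H; exact: Ccts_cell1.
  have -> : \sum_(b : label S) G (bedge s b) =
      \sum_(x in [set (bedge s b : letter S) | b : label S]%SET) G x.
    by rewrite big_imset// => b c _ _ /(bedge_inj hnd)[].
  rewrite [leRHS](bigID (mem [set (bedge s b : letter S) | b : label S]%SET))/=.
  by rewrite lerDl sumr_ge0.
rewrite sumG le_eqVlt; apply/orP; left; apply/eqP.
have M0' : M != 0 by rewrite gt_eqF.
by field.
Qed.

Lemma trace_eps (eps : R) : 0 < eps -> exists2 A, 0 <= A & forall f s, Ccts p f ->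
  `|tau s f| `^ p <= A * N f + eps * E f.
Proof.
move=> e0; have [A [B [A0 B0 H]]] := trace_base.
set k := 2 `^ (1 - p) : R; have k0 : 0 <= k by exact: powR_ge0.
have k1 : k < 1.
  rewrite /k -opprB powRN invf_lt1 ?powR_gt0//.
  have {1}<- : 1 `^ (p - 1) = 1 :> R by rewrite powR1.
  by apply: gt0_ltr_powR; rewrite ?nnegrE ?subr_gt0 ?ltr1n.
have iter n : exists2 A', 0 <= A' & forall f s, Ccts p f -> `|tau s f| `^ p <= A' * N f + k ^+ n * B * E f.
  elim: n => [|n [A' A0' H']]; first by exists A => // f s; rewrite mul1r; exact: H.
  exists (k * M^-1 * K * A'); first by rewrite !mulr_ge0 ?invr_ge0 ?(ltW M0) ?(ltW K0).
  move=> f s Cf; rewrite exprS -[k * _ * B]mulrA; apply: trace_step => //.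
  by rewrite mulr_ge0// exprn_ge0.
have [n kn] : exists n, k ^+ n * B <= eps.
  have : B * k ^+ n @[n --> \oo] --> (0 : R).
    by apply: cvg_geometric; rewrite ger0_norm.
  move/cvgrPdist_lt => /(_ _ e0)[n _ /(_ n (leqnn n))]; rewrite sub0r normrN mulrC => h.
  by exists n; apply/ltW; apply: le_lt_trans (ler_norm _) h.
have [A' A0' H'] := iter n; exists A' => // f s Cf; apply: le_trans (H' f s Cf) _.
by rewrite lerD2l ler_wpM2r// cts_energy_ge0//; exact: Ccts_cont.
Qed.

(** The cells contribute [K ^+ n * N f] and [M ^+ n * E f] in total; after division by [M ^+ n] only
    the first term still depends on [n]. *)
Lemma level_energy_trace n A (eps : R) : 0 <= A ->
  (forall f s, Ccts p f -> `|tau s f| `^ p <= A * N f + eps * E f) ->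
  forall f, Ccts p f -> en n f <= 2 * a * (A * (K / M) ^+ n * N f + eps * E f).
Proof.
move=> A0 H f Cf; have cf := Ccts_cont Cf.
apply: le_trans (_ : M ^- n * \sum_(e : word S n) a * (2 * (A * N (f \o Fmap R e) + eps * E (f \o Fmap R e))) <= _).
  apply: ler_wpM2l; first by rewrite invr_ge0 exprn_ge0// ltW.
  apply: ler_sum => e _; apply: le_trans (normD_powR _ _ (ltW p1)) _; rewrite normrN ler_wpM2l//.
  by rewrite mulr2n mulrDl mul1r; apply: lerD; apply: H; exact: Ccts_cell.
rewrite -!mulr_sumr big_split /= -!mulr_sumr Lp_pow_fine_words// cts_energy_words//.
have Mn : M ^+ n != 0 by rewrite expf_neq0// gt_eqF.
rewrite expr_div_n le_eqVlt; apply/orP; left; apply/eqP.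
by field.
Qed.

(** At a fixed level the energy of [fs j] becomes small, by [trace_eps] with a coefficient chosen
    against the bound [B] of the energies. Comparing [fs i] with such an [fs j] bounds all level
    energies of [fs i], hence its energy. *)
Lemma Ects_closable (fs : nat -> X -> R) : (forall i, Ccts p (fs i)) ->
  (forall eps : R, 0 < eps -> exists I, forall i j, (I <= i)%N -> (I <= j)%N -> E (fs i \- fs j) <= eps) ->
  (forall eps : R, 0 < eps -> exists I, forall i, (I <= i)%N -> N (fs i) <= eps) ->
  forall eps : R, 0 < eps -> exists I, forall i, (I <= i)%N -> E (fs i) <= eps.
Proof.
move=> Cfs Ec N0 eps e0.
have [I1 H1] := Ec 1 ltr01.
pose B := a * (1 + E (fs I1)).
have Bge i : (I1 <= i)%N -> E (fs i) <= B.
  move=> iI; apply: le_trans (cts_energy_le_sub (Cfs i) (Cfs I1)) _; rewrite ler_wpM2l// lerD2r.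
  exact: H1.
have B0 : 0 <= B by exact: le_trans (cts_energy_ge0 (Ccts_cont (Cfs I1))) (Bge _ (leqnn _)).
have level_energy0 n (d : R) : 0 < d -> exists I2, forall i, (I2 <= i)%N -> en n (fs i) <= d.
  move=> d0; have c0 : 0 < d / 2 / (2 * a + 1) / (B + 1).
    by rewrite !divr_gt0// ltr_wpDl// mulr_ge0.
  have [A A0 H] := trace_eps c0.
  have d1 : 0 < d / 2 / (2 * a + 1) / (A * (K / M) ^+ n + 1).
    rewrite !divr_gt0// ltr_wpDl// mulr_ge0//; first by rewrite exprn_ge0// divr_ge0 ?(ltW M0) ?(ltW K0).
  have [I2 H2] := N0 _ d1; exists (maxn I1 I2) => i; rewrite geq_max => /andP[i1 i2].
  apply: le_trans (level_energy_trace n A0 H (Cfs i)) _.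
  have hN := H2 _ i2; have hE := Bge _ i1.
  set u := A * (K / M) ^+ n in d1 hN *; have u0 : 0 <= u.
    by rewrite mulr_ge0// exprn_ge0// divr_ge0 ?(ltW M0) ?(ltW K0).
  have b0 : 0 <= 2 * a by rewrite mulr_ge0.
  have t1 : u * N (fs i) <= d / 2 / (2 * a + 1).
    rewrite mulrC; apply: le_trans (ler_wpM2r u0 hN) _; apply: frac_le => //.
    by rewrite !divr_ge0 ?addr_ge0// ltW.
  have t2 : d / 2 / (2 * a + 1) / (B + 1) * E (fs i) <= d / 2 / (2 * a + 1).
    apply: le_trans (ler_wpM2l (ltW c0) hE) _; apply: frac_le => //.
    by rewrite !divr_ge0 ?addr_ge0// ltW.
  apply: le_trans (ler_wpM2l b0 (lerD t1 t2)) _.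
  rewrite [leLHS](_ : _ = d / (2 * a + 1) * (2 * a)); first by apply: frac_le => //; exact: ltW.
  by field; rewrite gt_eqF// ltr_wpDl.
have e1 : 0 < eps / (a + 1) / 2 by rewrite !divr_gt0// ltr_wpDl.
have [I HI] := Ec _ e1; exists I => i iI.
suff h n : en n (fs i) <= eps by have [] := cts_energy_bound (Ccts_cont (Cfs i)) h.
 have [I2 H2] := level_energy0 n _ e1.
(* [j] may depend on the level [n], whereas [I] does not. *)
pose j := maxn I I2.
have cij := continuous_funB (Ccts_cont (Cfs i)) (Ccts_cont (Cfs j)).
have -> : fs i = (fs i \- fs j) \+ fs j by apply/funext => x /=; rewrite subrK.
apply: le_trans (level_energy_minkowski n cij (Ccts_cont (Cfs j))) _.
apply: le_trans (powR_root_add _ _) _; do ?exact: level_energy_ge0.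
have h1 : en n (fs i \- fs j) <= eps / (a + 1) / 2.
  apply: le_trans (level_energy_le hnd hcu p1 n (CctsB (Cfs i) (Cfs j))) _.
  by apply: HI => //; exact: leq_maxl.
have h2 : en n (fs j) <= eps / (a + 1) / 2 by apply: H2; exact: leq_maxr.
apply: le_trans (ler_wpM2l a0 (lerD h1 h2)) _; rewrite -splitr mulrC.
by apply: frac_le => //; exact: ltW.
Qed.
End EnergySpace.

(** * The closure of the energy *)

Section Limits.
Context (R : realType).

Lemma cvg_ereal0P (T : Type) (F : set_system T) (u : T -> \bar R) : Filter F ->
  (forall t, 0 <= u t)%E ->
  u x @[x --> F] --> 0%E <-> forall eps : R, 0 < eps -> F [set t | (u t <= eps%:E)%E].
Proof.
move=> FF u0; split=> [h eps e0|h A].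
  have nA : nbhs (0%:E : \bar R) [set x | (x <= eps%:E)%E].
    exists eps => // r /=; rewrite sub0r normrN lee_fin => /ltW; exact: le_trans (ler_norm _).
  exact: (h _ nA).
move=> [e /= e0 eA].
have e20 : 0 < e / 2 by rewrite divr_gt0.
rewrite nbhs_simpl/=; apply: filterS (h _ e20) => t /=.
have := u0 t; case: (u t) => [r| |]//=; rewrite !lee_fin => r0 re.
apply: (eA r); rewrite /= sub0r normrN ger0_norm//; apply: le_lt_trans re _.
by rewrite ltr_pdivrMr// ltr_pMr// ltr1n.
Qed.

Lemma cvg_seq_ereal0P (u : nat -> \bar R) : (forall i, 0 <= u i)%E ->
  u i @[i --> \oo] --> 0%E <->
  forall eps : R, 0 < eps -> exists I, forall i, (I <= i)%N -> (u i <= eps%:E)%E.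
Proof.
move=> u0; rewrite cvg_ereal0P//; split => h eps e0.
  by have [I _ hI] := h _ e0; exists I => i iI; exact: hI.
by have [I hI] := h _ e0; exists I.
Qed.

Lemma cvg_pair_ereal0P (u : nat * nat -> \bar R) : (forall i, 0 <= u i)%E ->
  u ij @[ij --> (\oo, \oo)] --> 0%E <->
  forall eps : R, 0 < eps ->
    exists I, forall i j, (I <= i)%N -> (I <= j)%N -> (u (i, j) <= eps%:E)%E.
Proof.
move=> u0; rewrite cvg_ereal0P//; split => h eps e0.
  have [[P Q] /= [[I _ hI] [I' _ hI']] PQ] := h _ e0.
  exists (maxn I I') => i j; rewrite !geq_max => /andP[i1 i2] /andP[j1 j2].
  by apply: (PQ (i, j)); split; [exact: hI|exact: hI'].
have [I hI] := h _ e0; exists ([set i | (I <= i)%N], [set i | (I <= i)%N]).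
  by split; exists I.
by move=> [i j] [/= iI jI]; exact: hI.
Qed.

Lemma cauchy_seq_cvg (u : nat -> R) :
  (forall eps : R, 0 < eps -> exists I, forall i j, (I <= i)%N -> (I <= j)%N -> `|u i - u j| <= eps) ->
  exists l : R, u i @[i --> \oo] --> l.
Proof.
move=> h; apply/cvg_ex; apply: cauchy_cvg; apply: cauchy_exP => e e0.
have e20 : 0 < e / 2 by rewrite divr_gt0.
have [I hI] := h _ e20; exists (u I), I => // i iI.
apply: le_lt_trans (hI I i (leqnn _) iI) _.
by rewrite ltr_pdivrMr// ltr_pMr// ltr1n.
Qed.

Lemma cvg_seq0P (u : nat -> R) (l : R) :
  (forall eps : R, 0 < eps -> exists I, forall i, (I <= i)%N -> `|u i - l| <= eps) ->
  u i @[i --> \oo] --> l.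
Proof.
move=> h; apply/cvgrPdist_le => e e0; have [I hI] := h _ e0.
by exists I => // i /= iI; rewrite distrC; exact: hI.
Qed.

Lemma cvg_powR (u : nat -> R) (l r : R) : 0 < r -> (forall i, 0 <= u i) -> 0 <= l ->
  u i @[i --> \oo] --> l -> u i `^ r @[i --> \oo] --> l `^ r.
Proof.
move=> r0 u0 l0 ul; have h := cvg_comp _ _ ul (@continuous_norm_powR R r r0 l).
have e : (fun x : R => `|x| `^ r) \o u = (fun i => u i `^ r) by apply/funext => i /=; rewrite ger0_norm.
by rewrite e ger0_norm in h.
Qed.
End Limits.

(** * Approximating sequences and the energy on L^p *)

Section SobolevEnergy.
Context (R : realType) (S : doubling_igs) (p : R).
Hypothesis hnd : non_degenerate S.
Hypothesis hcu : conductively_uniform R S.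
Hypothesis p1 : 1 < p.
Local Notation X := (limspace R S).
Local Notation mu := (mu R S).
Local Notation K := (#|{: letter S}|%:R : R).
Local Notation M := (Mp S p).
Local Notation E := (@cts_energy R S p).
Local Notation Np := (@Lp_pow R S p).
Local Notation N := (@Lp_pow_fine R S p).
Local Notation a := (2 `^ (p - 1) : R).
Implicit Types (f g : X -> R) (fs gs : nat -> X -> R).

Let p0 : 0 < p. Proof. exact: lt_trans p1. Qed.
Let a0 : 0 <= a. Proof. exact: powR_ge0. Qed.
Let a1 : 0 < a + 1. Proof. by rewrite ltr_wpDl. Qed.
Let M0 : 0 < M := Mp_gt0 S p1.
Let K0 : 0 < K := card_letter_gt0 R S.

Lemma Ects_energy f : Ccts p f -> Ects p f = (E f)%:E.
Proof. exact: (Ccts_fin hnd hcu p1). Qed.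

Lemma Ccts_energy_ge0 f : Ccts p f -> 0 <= E f.
Proof. by move=> Cf; exact: (cts_energy_ge0 hnd hcu p1 (Ccts_cont Cf)). Qed.

Lemma approxP fs f : approximates p fs f <->
  [/\ forall i, Ccts p (fs i),
      forall eps : R, 0 < eps -> exists I, forall i j, (I <= i)%N -> (I <= j)%N ->
        E (fs i \- fs j) <= eps
    & forall eps : R, 0 < eps -> exists I, forall i, (I <= i)%N -> (Np (fs i \- f)%R <= eps%:E)%E].
Proof.
split => [[Cfs h1 h2]|[Cfs h1 h2]].
  have Cij i j := CctsB hnd hcu p1 (Cfs i) (Cfs j).
  split => // eps e0.
    move/cvg_pair_ereal0P : h1 => /(_ _ _ e0)[|I hI].
      by move=> ij; rewrite (Ects_energy (Cij _ _)) lee_fin cts_energy_ge0//; exact: Ccts_cont.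
    by exists I => i j iI jI; rewrite -lee_fin -(Ects_energy (Cij _ _)); exact: hI.
  by move/cvg_seq_ereal0P : h2 => /(_ _ _ e0)[|I hI]; [move=> i; exact: Lp_pow_ge0|exists I].
have Cij i j := CctsB hnd hcu p1 (Cfs i) (Cfs j).
split => //.
  apply/cvg_pair_ereal0P => [ij|eps e0].
    by rewrite (Ects_energy (Cij _ _)) lee_fin cts_energy_ge0//; exact: Ccts_cont.
  by have [I hI] := h1 _ e0; exists I => i j iI jI; rewrite (Ects_energy (Cij _ _)) lee_fin; exact: hI.
by apply/cvg_seq_ereal0P => [i|//]; exact: Lp_pow_ge0.
Qed.

Lemma cts_energy_lipschitz f g : Ccts p f -> Ccts p g -> `|E f `^ p^-1 - E g `^ p^-1| <= E (f \- g) `^ p^-1.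
Proof.
move=> Cf Cg; have [cf cg] := (Ccts_cont Cf, Ccts_cont Cg).
rewrite ler_norml lerBlDr cts_energy_triangle// andbT.
have := cts_energy_triangle hnd hcu p1 Cg Cf; rewrite (cts_energyBC hnd hcu p1 cg cf).
by rewrite -lerBlDr lerNl opprB.
Qed.

Lemma root_small (eps x : R) : 0 < eps -> 0 <= x -> x <= eps `^ p -> x `^ p^-1 <= eps.
Proof.
move=> e0 x0 xe; rewrite -[leRHS](powRr1 (ltW e0)) -(mulfV (lt0r_neq0 p0)) powRrM.
by apply: ge0_ler_powR; rewrite ?nnegrE ?powR_ge0 ?invr_ge0 ?(ltW p0).
Qed.

(** The power 1/p of the energy is a seminorm, so its values along the sequence form a Cauchy
    sequence. *)
Lemma approx_cvg fs f : approximates p fs f -> exists2 l : R, 0 <= l & E (fs i) @[i --> \oo] --> l.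
Proof.
move/approxP => [Cfs h1 _]; have E0 i : 0 <= E (fs i) by apply: cts_energy_ge0 => //; exact: Ccts_cont.
have [l hl] : exists l : R, E (fs i) `^ p^-1 @[i --> \oo] --> l.
  apply: cauchy_seq_cvg => eps e0; have [I hI] := h1 _ (powR_gt0 p e0).
  exists I => i j iI jI; apply: le_trans (cts_energy_lipschitz (Cfs i) (Cfs j)) _.
  apply: root_small => //; last exact: hI.
  exact: (Ccts_energy_ge0 (CctsB hnd hcu p1 (Cfs i) (Cfs j))).
have l0 : 0 <= l.
  rewrite -(cvg_lim _ hl)//; apply: limr_ge; first by apply/cvg_ex; exists l.
  by apply: nearW => i; exact: powR_ge0.
exists (l `^ p); first exact: powR_ge0.
have := cvg_powR p0 (fun i => powR_ge0 (E (fs i)) p^-1) l0 hl.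
by under eq_fun do rewrite -powRrM mulVf ?gt_eqF// powRr1//.
Qed.

(** The differences are Cauchy for the energy and tend to 0 in L^p, so closability applies to
    them. *)
Lemma approx_diff fs gs f : measurable_fun [set: X] f ->
  approximates p fs f -> approximates p gs f ->
  forall eps : R, 0 < eps -> exists I, forall i, (I <= i)%N -> E (fs i \- gs i) <= eps.
Proof.
move=> mf /approxP[Cf h1 h2] /approxP[Cg h1' h2'].
have half (e : R) : 0 < e -> 0 < e / (a + 1) / 2 by move=> e0; rewrite !divr_gt0.
have sumle (e x y : R) : 0 < e -> x <= e / (a + 1) / 2 -> y <= e / (a + 1) / 2 -> a * (x + y) <= e.
  move=> e0 hx hy; apply: le_trans (ler_wpM2l a0 (lerD hx hy)) _; rewrite -splitr mulrC.
  by apply: frac_le => //; exact: ltW.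
apply: (Ects_closable hnd hcu p1) => [i|eps e0|eps e0]; first exact: CctsB.
  have [I HI] := h1 _ (half _ e0); have [I' HI'] := h1' _ (half _ e0).
  exists (maxn I I') => i j; rewrite !geq_max => /andP[i1 i2] /andP[j1 j2].
  have -> : (fs i \- gs i) \- (fs j \- gs j) = (fs i \- fs j) \+ (gs j \- gs i).
    by apply/funext => x /=; ring.
  have [_ h] := cts_energyD_le hnd hcu p1 (CctsB hnd hcu p1 (Cf i) (Cf j)) (CctsB hnd hcu p1 (Cg j) (Cg i)).
  by apply: le_trans h _; apply: sumle => //; [exact: HI|exact: HI'].
have [I HI] := h2 _ (half _ e0); have [I' HI'] := h2' _ (half _ e0).
exists (maxn I I') => i; rewrite geq_max => /andP[i1 i2].
have [cf cg] := (Ccts_cont (Cf i), Ccts_cont (Cg i)).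
have [mfi mgi] := (continuous_measurable cf, continuous_measurable cg).
rewrite -lee_fin -(Lp_pow_fin hnd p1); last exact: continuous_funB.
have -> : fs i \- gs i = (fs i \- f) \+ (fun x => - (gs i x - f x)).
  by apply/funext => x /=; ring.
have mfi' : measurable_fun [set: X] (fs i \- f) by exact: measurable_funB.
have mgi' : measurable_fun [set: X] (fun x => - (gs i x - f x)).
  by apply: measurableT_comp => //; exact: measurable_funB.
apply: le_trans (Lp_powD_le hnd p1 mfi' mgi') _.
have -> : Np (fun x => - (gs i x - f x)) = Np (gs i \- f)%R.
  by rewrite /Lp_pow; congr (integral _ _ _); apply/funext => x; rewrite normrN.
apply: le_trans (_ : a%:E * ((eps / (a + 1) / 2)%:E + (eps / (a + 1) / 2)%:E) <= _)%E.
  apply: lee_wpmul2l; first by rewrite lee_fin.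
  by apply: leeD; [exact: HI|exact: HI'].
by rewrite -EFinD -EFinM lee_fin; exact: sumle.
Qed.

Lemma approx_unique fs gs f (l : R) : measurable_fun [set: X] f ->
  approximates p fs f -> approximates p gs f ->
  E (fs i) @[i --> \oo] --> l -> E (gs i) @[i --> \oo] --> l.
Proof.
move=> mf af ag fl; have [l' l'0 gl] := approx_cvg ag.
have [Cf _ _] := (approxP _ _).1 af; have [Cg _ _] := (approxP _ _).1 ag.
have l0 : 0 <= l.
  rewrite -(cvg_lim _ fl)//; apply: limr_ge; first by apply/cvg_ex; exists l.
  by apply: nearW => i; apply: cts_energy_ge0 => //; exact: Ccts_cont.
have E0 := Ccts_energy_ge0.
suff : l `^ p^-1 = l' `^ p^-1.
  have root (x : R) : 0 <= x -> (x `^ p^-1) `^ p = x.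
    by move=> x0; rewrite -powRrM mulVf ?gt_eqF// powRr1.
  by move=> e; have -> : l = l' by rewrite -(root _ l0) e root.
have ip0 : 0 < p^-1 by rewrite invr_gt0.
have h1 := cvg_powR ip0 (fun i => E0 _ (Cf i)) l0 fl.
have h2 := cvg_powR ip0 (fun i => E0 _ (Cg i)) l'0 gl.
have h3 : E (fs i) `^ p^-1 - E (gs i) `^ p^-1 @[i --> \oo] --> (0 : R).
  apply: cvg_seq0P => eps e0; have [I hI] := approx_diff mf af ag (powR_gt0 p e0).
  exists I => i iI; rewrite subr0; apply: le_trans (cts_energy_lipschitz (Cf i) (Cg i)) _.
  apply: root_small => //; last exact: hI.
  exact: (E0 _ (CctsB hnd hcu p1 (Cf i) (Cg i))).
have h4 : E (fs i) `^ p^-1 - E (gs i) `^ p^-1 @[i --> \oo] --> l `^ p^-1 - l' `^ p^-1.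
  by apply: cvgB.
by apply/eqP; rewrite -subr_eq0; apply/eqP; exact: (cvg_unique _ h4 h3).
Qed.

(** The value picked by [xget] is the limit along some approximating sequence, and all of these have
    the same limit. *)
Lemma EsobP fs f : measurable_fun [set: X] f -> approximates p fs f ->
  exists l : R, [/\ 0 <= l, Esob p f = l%:E & E (fs i) @[i --> \oo] --> l].
Proof.
move=> mf af; have [l l0 fl] := approx_cvg af; exists l; split => //.
have EE gs : approximates p gs f -> (fun i => Ects p (gs i)) = (fun i => (E (gs i))%:E).
  by move=> /approxP[Cg _ _]; apply/funext => i; exact: Ects_energy.
rewrite /Esob; set P := [set _ | _].
have [gs ag gl] : P (xget +oo%E P).
  apply: xgetPex; exists l%:E; exists fs => //.
  by rewrite EE//; apply: cvg_EFin => //; exact: nearW.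
rewrite EE// in gl.
have : (E (gs i))%:E @[i --> \oo] --> l%:E.
  by apply: cvg_EFin; [exact: nearW|exact: approx_unique af ag fl].
by move=> h; exact: (cvg_unique _ gl h).
Qed.

Lemma Fsob_approx f : Fsob p f ->
  [/\ measurable_fun [set: X] f, (Np f < +oo)%E & exists fs, approximates p fs f].
Proof.
move=> [[mf Nf] Ef]; split => //.
(* Without an approximating sequence [xget] returns its default value [+oo]. *)
apply: contrapT => h; move: Ef; rewrite /Esob xgetPN ?ltxx// => l [fs af _].
by apply: h; exists fs.
Qed.

Lemma approxD fs gs f g : measurable_fun [set: X] f -> measurable_fun [set: X] g ->
  approximates p fs f -> approximates p gs g -> approximates p (fun i => fs i \+ gs i) (f \+ g).
Proof.
move=> mf mg /approxP[Cf h1 h2] /approxP[Cg h1' h2'].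
have half (e : R) : 0 < e -> 0 < e / (a + 1) / 2 by move=> e0; rewrite !divr_gt0.
have sumle (e x y : R) : 0 < e -> x <= e / (a + 1) / 2 -> y <= e / (a + 1) / 2 -> a * (x + y) <= e.
  move=> e0 hx hy; apply: le_trans (ler_wpM2l a0 (lerD hx hy)) _; rewrite -splitr mulrC.
  by apply: frac_le => //; exact: ltW.
apply/approxP; split => [i|eps e0|eps e0].
- by have [] := cts_energyD_le hnd hcu p1 (Cf i) (Cg i).
- have [I HI] := h1 _ (half _ e0); have [I' HI'] := h1' _ (half _ e0).
  exists (maxn I I') => i j; rewrite !geq_max => /andP[i1 i2] /andP[j1 j2].
  have -> : (fs i \+ gs i) \- (fs j \+ gs j) = (fs i \- fs j) \+ (gs i \- gs j).
    by apply/funext => x /=; ring.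
  have [_ h] := cts_energyD_le hnd hcu p1 (CctsB hnd hcu p1 (Cf i) (Cf j)) (CctsB hnd hcu p1 (Cg i) (Cg j)).
  by apply: le_trans h _; apply: sumle => //; [exact: HI|exact: HI'].
have [I HI] := h2 _ (half _ e0); have [I' HI'] := h2' _ (half _ e0).
exists (maxn I I') => i; rewrite geq_max => /andP[i1 i2].
have [cf cg] := (Ccts_cont (Cf i), Ccts_cont (Cg i)).
have [mfi mgi] := (continuous_measurable cf, continuous_measurable cg).
have -> : (fs i \+ gs i) \- (f \+ g) = (fs i \- f) \+ (gs i \- g).
  by apply/funext => x /=; ring.
have mfi' : measurable_fun [set: X] (fs i \- f) by exact: measurable_funB.
have mgi' : measurable_fun [set: X] (gs i \- g) by exact: measurable_funB.
apply: le_trans (Lp_powD_le hnd p1 mfi' mgi') _.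
apply: le_trans (_ : a%:E * ((eps / (a + 1) / 2)%:E + (eps / (a + 1) / 2)%:E) <= _)%E.
  apply: lee_wpmul2l; first by rewrite lee_fin.
  by apply: leeD; [exact: HI|exact: HI'].
by rewrite -EFinD -EFinM lee_fin; exact: sumle.
Qed.

Lemma CctsN f : Ccts p f -> Ccts p (fun x => - f x).
Proof.
move=> Cf; have -> : (fun x => - f x) = (fun=> 0) \- f by apply/funext => x /=; rewrite sub0r.
exact: (CctsB hnd hcu p1 (proj1 (Ccts0 hnd hcu p1)) Cf).
Qed.

Lemma approxN gs g : approximates p gs g -> approximates p (fun i x => - gs i x) (fun x => - g x).
Proof.
move=> /approxP[Cg h1 h2]; apply/approxP; split => [i|eps e0|eps e0]; first exact: CctsN.
  have [I HI] := h1 _ e0; exists I => i j iI jI.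
  have -> : (fun x => - gs i x) \- (fun x => - gs j x) = gs j \- gs i.
    by apply/funext => x /=; ring.
  exact: HI.
have [I HI] := h2 _ e0; exists I => i iI; apply: le_trans (HI i iI).
rewrite le_eqVlt; apply/orP; left; apply/eqP.
rewrite /Lp_pow; congr (integral _ _ _); apply/funext => x /=.
by rewrite -opprD normrN.
Qed.

Lemma approxB fs gs f g : measurable_fun [set: X] f -> measurable_fun [set: X] g ->
  approximates p fs f -> approximates p gs g -> approximates p (fun i => fs i \- gs i) (f \- g).
Proof.
move=> mf mg af ag.
have mg' : measurable_fun [set: X] (fun x => - g x) by exact: measurableT_comp.
exact: approxD mf mg' af (approxN ag).
Qed.

Lemma approx_cell n (e : word S n) fs f : measurable_fun [set: X] f ->
  approximates p fs f -> approximates p (fun i => fs i \o Fmap R e) (f \o Fmap R e).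
Proof.
move=> mf /approxP[Cf h1 h2]; apply/approxP; split => [i|eps e0|eps e0].
- exact: Ccts_cell.
- have Mn : 0 < M ^+ n by rewrite exprn_gt0.
  have [I HI] := h1 _ (divr_gt0 e0 Mn); exists I => i j iI jI.
  have Cij := CctsB hnd hcu p1 (Cf i) (Cf j).
  have h := HI i j iI jI; rewrite (ler_pdivlMr _ _ Mn) mulrC in h; apply: le_trans h.
  apply: (@le_trans _ _ (\sum_(e : word S n) E ((fs i \- fs j) \o Fmap R e))); last first.
    by rewrite (cts_energy_words hnd hcu p1 n Cij).
  rewrite (bigD1 e)//= lerDl; apply: sumr_ge0 => f' _.
  exact: (Ccts_energy_ge0 (Ccts_cell hnd hcu p1 f' Cij)).
have Kn : 0 < K ^+ n by rewrite exprn_gt0.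
have [I HI] := h2 _ (divr_gt0 e0 Kn); exists I => i iI.
have mi : measurable_fun [set: X] (fs i \- f).
  by apply: measurable_funB => //; apply: continuous_measurable; exact: Ccts_cont.
have := HI i iI; rewrite (Lp_pow_words p hnd n mi) mulrC EFinM.
rewrite lee_pmul2l// ?lte_fin ?invr_gt0//; apply: le_trans.
by rewrite (bigD1 e)//= leeDl// sume_ge0// => f' _; exact: Lp_pow_ge0.
Qed.

Lemma approx_eq fs f g : Np (fun x => f x - g x) = 0%E ->
  measurable_fun [set: X] f -> measurable_fun [set: X] g ->
  approximates p fs f -> approximates p fs g.
Proof.
move=> fg mf mg /approxP[Cf h1 h2]; apply/approxP; split => // eps e0.
have e1 : 0 < eps / (a + 1) by rewrite divr_gt0.
have [I HI] := h2 _ e1; exists I => i iI.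
have -> : fs i \- g = (fs i \- f) \+ (fun x => f x - g x) by apply/funext => x /=; ring.
have mi : measurable_fun [set: X] (fs i \- f).
  by apply: measurable_funB => //; apply: continuous_measurable; exact: Ccts_cont.
apply: le_trans (Lp_powD_le hnd p1 mi (measurable_funB mf mg)) _; rewrite fg adde0.
apply: le_trans (lee_wpmul2l _ (HI i iI)) _; first by rewrite lee_fin.
rewrite -EFinM lee_fin mulrC; apply: frac_le => //; exact: ltW.
Qed.

Lemma Ccts_cst (c : R) : Ccts p (fun _ : X => c) /\ E (fun=> c) = 0.
Proof.
have cc : continuous (fun _ : X => c : R) by move=> x; exact: cst_continuous.
have [|C h] := @cts_energy_bound R S p hnd hcu p1 (fun=> c) 0 cc.
  move=> n; rewrite /level_energy big1 ?mulr0// => e _.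
  by rewrite [_ \o _](_ : _ = (fun=> c))// !fibre_mean_cst subrr normr0 powR0// gt_eqF.
by split => //; apply/eqP; rewrite eq_le h cts_energy_ge0.
Qed.

Lemma approx_cst c : approximates p (fun _ _ => c) (fun _ : X => c).
Proof.
have [Cc _] := Ccts_cst c; have [_ E00] := Ccts_cst 0.
apply/approxP; split => [//|eps e0|eps e0].
  by exists 0%N => i j _ _; rewrite [_ \- _](_ : _ = (fun=> 0)) ?E00 ?ltW//; apply/funext => x /=; rewrite subrr.
exists 0%N => i _; rewrite [(_ \- _)%R](_ : _ = (fun=> 0)).
  by rewrite Lp_pow_cst// normr0 powR0 ?gt_eqF// lee_fin ltW.
by apply/funext => x /=; rewrite subrr.
Qed.
End SobolevEnergy.

(** * Poincare inequality *)

Section Poincare.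
Context (R : realType) (S : doubling_igs) (p : R).
Hypothesis hnd : non_degenerate S.
Hypothesis hcu : conductively_uniform R S.
Hypothesis p1 : 1 < p.
Local Notation X := (limspace R S).
Local Notation mu := (mu R S).
Local Notation mu_measure := (mu_measure R hnd).
Local Notation K := (#|{: letter S}|%:R : R).
Local Notation M := (Mp S p).
Local Notation E := (@cts_energy R S p).
Local Notation Np := (@Lp_pow R S p).
Local Notation tau := (@fibre_mean R S p).
Local Notation a := (2 `^ (p - 1) : R).
Implicit Types (f g h : X -> R) (fs gs : nat -> X -> R).

Let p0 : 0 < p. Proof. exact: lt_trans p1. Qed.
Let a0 : 0 <= a. Proof. exact: powR_ge0. Qed.
Let K0 : 0 < K := card_letter_gt0 R S.

Lemma cst_integrable (c : R) : mu_measure.-integrable setT (EFin \o (fun=> c : R)).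
Proof.
apply: measurable_bounded_integrable => //.
  by change (mu setT < +oo)%E; rewrite mu_setT ltry.
by exists `|c|; split; [exact: num_real|move=> x cx y _]; exact: ltW.
Qed.

Lemma Lp_integrable h : measurable_fun [set: X] h -> (Np h < +oo)%E ->
  mu_measure.-integrable setT (EFin \o h) /\ mu_measure.-integrable setT (EFin \o (fun x => `|h x| `^ p)).
Proof.
move=> mh Nh; have mN : measurable_fun [set: X] (fun x => (`|h x| `^ p)%:E) by exact: measurable_powR_norm.
have iN : mu_measure.-integrable setT (EFin \o (fun x => `|h x| `^ p)).
  apply/integrableP; split => //; apply: le_lt_trans Nh.
  rewrite le_eqVlt; apply/orP; left; apply/eqP; congr (integral _ _ _).
  by apply/funext => x /=; rewrite ger0_norm// powR_ge0.
split => //.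
have i1 : mu_measure.-integrable setT (EFin \o (fun=> 1 : R)).
  exact: cst_integrable.
(* Domination of |h| by 1 + |h|^p, according to whether |h| is below or above 1. *)
apply: (le_integrable _ _ _ (integrableD _ i1 iN)) => //.
  exact/measurable_EFinP.
move=> x _ /=; rewrite lee_fin [leRHS]ger0_norm ?addr_ge0 ?powR_ge0//.
have [h1|/ltW h1] := leP `|h x| 1; first by apply: le_trans h1 _; rewrite lerDl powR_ge0.
apply: le_trans (_ : `|h x| `^ p <= _); last by rewrite lerDr.
by rewrite -[leLHS](powRr1 (normr_ge0 _)); apply: ler_powR => //; exact: ltW.
Qed.

(** The tangent inequality at the mean is integrated; its linear term has integral 0. *)
Lemma jensen_powR h : measurable_fun [set: X] h -> (Np h < +oo)%E ->
  ((`|\int[mu_measure]_x h x| `^ p)%:E <= Np h)%E.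
Proof.
move=> mh Nh; have [ih iN] := Lp_integrable mh Nh.
set m := \int[mu_measure]_x h x; pose s := p * spow (p - 1) m.
have i1 := cst_integrable.
have cst c : \int[mu_measure]_x c = c.
  by rewrite Rintegral_cst//= -[X in fine X]/(mu setT) mu_setT mulr1.
have -> : Np h = (\int[mu_measure]_x (`|h x| `^ p))%:E.
  by rewrite /Rintegral fineK//; exact: integrable_fin_num iN.
rewrite lee_fin.
have ihm : mu_measure.-integrable setT (EFin \o (fun x => h x - m)) by exact: (integrableB measurableT ih (i1 m)).
have ishm : mu_measure.-integrable setT (EFin \o (fun x => s * (h x - m))) by exact: (integrableZl measurableT s ihm).
have -> : `|m| `^ p = \int[mu_measure]_x (`|m| `^ p + s * (h x - m)).
  by rewrite RintegralD// RintegralZl// RintegralB// !cst subrr mulr0 addr0.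
apply: le_Rintegral => //; first exact: (integrableD measurableT (i1 _) ishm).
by move=> x _; exact: powR_tangent.
Qed.

Lemma Lp_powD_fin f g : measurable_fun [set: X] f -> measurable_fun [set: X] g ->
  (Np f < +oo)%E -> (Np g < +oo)%E -> (Np (f \+ g)%R < +oo)%E.
Proof.
move=> mf mg Nf Ng; apply: le_lt_trans (Lp_powD_le hnd p1 mf mg) _.
by rewrite lte_mul_pinfty ?lee_fin// lte_add_pinfty.
Qed.

(** The mean differs from [c] by the mean of [g - c], which Jensen's inequality bounds. So centering
    at the mean is optimal up to the factor [2 * a]. *)
Lemma Lp_pow_centered g c : measurable_fun [set: X] g -> (Np g < +oo)%E ->
  (Np (fun x => g x - \int[mu_measure]_y g y)%R <= (2 * a)%:E * Np (fun x => g x - c)%R)%E.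
Proof.
move=> mg Ng; set m := \int[mu_measure]_y g y.
have mgc : measurable_fun [set: X] (fun x => g x - c) by exact: measurable_funB.
have Ngc : (Np (fun x => g x - c)%R < +oo)%E.
  by apply: Lp_powD_fin => //; rewrite Lp_pow_cst// ltry.
have [ig _] := Lp_integrable mg Ng.
have cE : \int[mu_measure]_y (g y - c) = m - c.
  rewrite RintegralB//; last exact: cst_integrable.
  by rewrite Rintegral_cst//= -[X in fine X]/(mu setT) mu_setT mulr1.
have -> : (fun x => g x - m) = (fun x => g x - c) \+ (fun=> c - m).
  by apply/funext => x /=; ring.
apply: le_trans (Lp_powD_le hnd p1 mgc _) _ => //.
have J : (Np (fun=> c - m)%R <= Np (fun x => g x - c)%R)%E.
  by rewrite Lp_pow_cst// -normrN opprB -cE; exact: jensen_powR.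
rewrite [in leRHS]mulrC EFinM -muleA; apply: lee_wpmul2l; first by rewrite lee_fin.
by rewrite mule_natl mule2n; apply: leeD.
Qed.

Local Notation poinc := (2 `^ p * (#|vert (gen S)|%:R `^ p * M) : R).

(** In the constant, [2 * a] comes from replacing the fibre mean of [gs i] by the mean of [g], the
    next [a] from splitting off [gs i - g], and [a * poinc] from the inequality for continuous
    functions. *)
Lemma poincare_sobolev gs g (l : R) : measurable_fun [set: X] g -> (Np g < +oo)%E ->
  approximates p gs g -> E (gs i) @[i --> \oo] --> l ->
  (Np (fun x => g x - \int[mu_measure]_y g y)%R <= ((2 * a) * (a * (a * (poinc * l))))%:E)%E.
Proof.
move=> mg Ng ag gl; have [Cg _ h2] := (approxP hnd hcu p1 _ _).1 ag.
apply/lee_addgt0Pr => eps e0.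
have b0 : 0 <= poinc by rewrite mulr_ge0 ?mulr_ge0 ?powR_ge0 ?(ltW (Mp_gt0 S p1)).
have c0 : 0 <= 2 * a * (a * (a * poinc)) := mulr_ge0 (mulr_ge0 (ler0n R 2) a0) (mulr_ge0 a0 (mulr_ge0 a0 b0)).
have d0 : 0 <= 2 * a * a := mulr_ge0 (mulr_ge0 (ler0n R 2) a0) a0.
have hc : 0 < eps / 2 / (2 * a * (a * (a * poinc)) + 1) by rewrite !divr_gt0// ltr_wpDl.
have hd : 0 < eps / 2 / (2 * a * a + 1) by rewrite !divr_gt0// ltr_wpDl.
have [I1 H1] := h2 _ hd.
have [I2 _ H2] : \forall i \near \oo, `|l - E (gs i)| < eps / 2 / (2 * a * (a * (a * poinc)) + 1).
  by move/cvgrPdist_lt : gl; exact.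
pose i := maxn I1 I2.
have hN := H1 i (leq_maxl _ _).
have hE : E (gs i) <= l + eps / 2 / (2 * a * (a * (a * poinc)) + 1).
  have := H2 i (leq_maxr _ _); rewrite distrC => /ltW /(le_trans (ler_norm _)).
  by rewrite lerBlDl.
have mgi : measurable_fun [set: X] (gs i) by apply: continuous_measurable; exact: Ccts_cont.
set c := tau true (gs i).
apply: le_trans (Lp_pow_centered c mg Ng) _.
have step : (Np (fun x => g x - c)%R <=
    a%:E * ((eps / 2 / (2 * a * a + 1))%:E + (a * (poinc * E (gs i)))%:E))%E.
  have -> : (fun x => g x - c) = (fun x => - (gs i x - g x)) \+ (fun x => gs i x - c).
    by apply/funext => x /=; ring.
  apply: le_trans (Lp_powD_le hnd p1 _ _) _.
  - by apply: measurableT_comp => //; exact: measurable_funB.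
  - exact: measurable_funB.
  apply: lee_wpmul2l; first by rewrite lee_fin.
  apply: leeD; last exact: (poincare_Ccts hnd hcu p1 (Cg i)).
  have -> : Np (fun x => - (gs i x - g x)) = Np (gs i \- g)%R.
    by rewrite /Lp_pow; congr (integral _ _ _); apply/funext => x; rewrite normrN.
  exact: hN.
apply: le_trans (lee_wpmul2l _ step) _; first by rewrite lee_fin mulr_ge0.
rewrite -EFinD -!EFinM -EFinD lee_fin.
have f1 := frac_le (ltW (divr_gt0 e0 (ltr0Sn R 1))) c0.
have f2 := frac_le (ltW (divr_gt0 e0 (ltr0Sn R 1))) d0.
set P := poinc in b0 c0 hc hE f1 *.
have {hE}hE' := ler_wpM2l c0 hE.
move: a P a0 b0 c0 d0 hc hd hN hE' f1 f2 => A Q A0 Q0 C0' D0' Hc Hd HN hE' f1 f2.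
set u := eps / 2 / (2 * A * (A * (A * Q)) + 1) in hE' f1 *.
set v := eps / 2 / (2 * A * A + 1) in f2 *.
have -> : 2 * A * (A * (v + A * (Q * E (gs i)))) = v * (2 * A * A) + 2 * A * (A * (A * Q)) * E (gs i) by ring.
apply: le_trans (lerD f2 hE') _.
have -> : 2 * A * (A * (A * (Q * l))) + eps = eps / 2 + (2 * A * (A * (A * Q)) * l + eps / 2).
  by rewrite addrCA -splitr; ring.
by rewrite lerD2l mulrDr lerD2l mulrC.
Qed.

Lemma mu_Xcell n (e : word S n) : mu (Xcell R e) = (K ^- n)%:E.
Proof.
have mX : measurable (Xcell R e) by exact: Xcell_measurable.
have h : (\int[mu_measure]_(x in Xcell R e) (cst 1%E) x = (K ^- n)%:E * \int[mu_measure]_x (cst 1%E) x)%E.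
  exact: (@integral_Xcell R S hnd n e (cst 1%E)).
rewrite !integral_cst// !mul1e in h; rewrite -[LHS]/(mu_measure (Xcell R e)) h.
by rewrite -[X in (_ * X)%E]/(mu setT) mu_setT mule1.
Qed.

(** F_e carries mu to the normalised restriction of mu to X_e. The positive and negative parts may
    have infinite integrals here; [fine] sends infinite values to 0 on both sides. *)
Lemma cell_avgE n (e : word S n) f : measurable_fun [set: X] f ->
  cell_avg e f = \int[mu_measure]_z f (Fmap R e z).
Proof.
move=> mf; rewrite /cell_avg mu_Xcell /= invrK.
have mfE : measurable_fun [set: X] (EFin \o f) by exact/measurable_EFinP.
have Kn : K ^+ n != 0 by rewrite expf_neq0// gt_eqF.
have -> : (\int[mu]_(x in Xcell R e) (f x)%:E = (K ^- n)%:E * \int[mu]_z (f (Fmap R e z))%:E)%E.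
  rewrite (@integralE _ _ _ mu_measure) [in RHS](@integralE _ _ _ mu_measure).
  have pos : (\int[mu_measure]_(x in Xcell R e) (fun x => (f x)%:E)^\+ x =
     (K ^- n)%:E * \int[mu_measure]_z (fun z => (f (Fmap R e z))%:E)^\+ z)%E.
    apply: (etrans (@integral_Xcell R S hnd n e _ (measurable_funepos mfE) (fun x => funepos_ge0 _ x))).
    by congr (_ * integral _ _ _)%E; apply/funext => z; rewrite !funeposE.
  have neg : (\int[mu_measure]_(x in Xcell R e) (fun x => (f x)%:E)^\- x =
     (K ^- n)%:E * \int[mu_measure]_z (fun z => (f (Fmap R e z))%:E)^\- z)%E.
    apply: (etrans (@integral_Xcell R S hnd n e _ (measurable_funeneg mfE) (fun x => funeneg_ge0 _ x))).
    by congr (_ * integral _ _ _)%E; apply/funext => z; rewrite !funenegE.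
  rewrite pos neg.
  have Kp : 0 < K ^- n by rewrite invr_gt0 exprn_gt0.
  set u := (\int[mu_measure]_z _)%E; set v := (\int[mu_measure]_z _)%E.
  by case: u v => [u| |] [v| |]; rewrite /= ?gt0_muley ?gt0_muleNy ?lte_fin//=
    -?EFinM -?EFinB -?EFinM ?mulrBr//.
rewrite /Rintegral -[X in _ * fine (_ * X)%E]/(\int[mu_measure]_z (f (Fmap R e z))%:E)%E.
case: (\int[mu_measure]_z _)%E => [r| |] /=; first by rewrite mulrA mulfV// mul1r.
  by rewrite gt0_muley ?lte_fin ?invr_gt0 ?exprn_gt0// mulr0.
by rewrite gt0_muleNy ?lte_fin ?invr_gt0 ?exprn_gt0// mulr0.
Qed.

Lemma cell_oscillation n (e : word S n) f : measurable_fun [set: X] f ->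
  ((fine (mu (Xcell R e)))^-1%:E * \int[mu]_(x in Xcell R e) (`|f x - cell_avg e f| `^ p)%:E =
   Np (fun z => f (Fmap R e z) - \int[mu_measure]_y f (Fmap R e y))%R)%E.
Proof.
move=> mf; rewrite cell_avgE// mu_Xcell /= invrK (integral_Xcell hnd)//; last exact: measurable_norm_powR.
by rewrite muleA -EFinM mulfV ?expf_neq0 ?gt_eqF// mul1e.
Qed.

Lemma Lp_pow_eq0 h : measurable_fun [set: X] h -> Np h = 0%E <-> {ae mu, forall x, h x = 0}.
Proof.
move=> mh; have mN : measurable_fun [set: X] (fun x => (`|h x| `^ p)%:E) by exact: measurable_powR_norm.
have := @ae_eq_integral_abs _ _ _ mu_measure setT measurableT (fun x => (`|h x| `^ p)%:E) mN.
have -> : (\int[mu_measure]_x `|(`|h x| `^ p)%:E| = Np h)%E.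
  by congr (integral _ _ _); apply/funext => x /=; rewrite ger0_norm// powR_ge0.
move=> H; rewrite H; split.
  move=> [A [mA A0 hA]]; exists A; split => // x /= hx; apply: hA => /= H'; apply: hx.
  by have [] := H' I => /powR_eq0_eq0/normr0_eq0.
move=> [A [mA A0 hA]]; exists A; split => // x /= hx; apply: hA => /= H'; apply: hx => _.
by rewrite H' normr0 powR0// gt_eqF.
Qed.
End Poincare.

(** * Clarkson inequalities and strong locality *)

Section ClarksonLocality.
Context (R : realType) (S : doubling_igs) (p : R).
Hypothesis hnd : non_degenerate S.
Hypothesis hcu : conductively_uniform R S.
Hypothesis p1 : 1 < p.
Local Notation X := (limspace R S).
Local Notation mu := (mu R S).
Local Notation mu_measure := (mu_measure R hnd).
Local Notation K := (#|{: letter S}|%:R : R).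
Local Notation M := (Mp S p).
Local Notation E := (@cts_energy R S p).
Local Notation Np := (@Lp_pow R S p).
Local Notation tau := (@fibre_mean R S p).
Local Notation en := (@level_energy R S p).
Implicit Types (f g h : X -> R) (fs gs : nat -> X -> R).

Let p0 : 0 < p. Proof. exact: lt_trans p1. Qed.
Let r0 : 0 < (p - 1)^-1. Proof. by rewrite invr_gt0 subr_gt0. Qed.
Let M0 : 0 < M := Mp_gt0 S p1.
Let K0 : 0 < K := card_letter_gt0 R S.

Definition clarkson_rhs (u v : R) : R := 2 * (u `^ (p - 1)^-1 + v `^ (p - 1)^-1) `^ (p - 1).

Lemma cvg_clarkson_rhs (u v : nat -> R) (l l' : R) :
  (forall i, 0 <= u i) -> (forall i, 0 <= v i) -> 0 <= l -> 0 <= l' ->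
  u i @[i --> \oo] --> l -> v i @[i --> \oo] --> l' ->
  clarkson_rhs (u i) (v i) @[i --> \oo] --> clarkson_rhs l l'.
Proof.
move=> u0 v0 l0 l'0 ul vl; apply: cvgMl_tmp; apply: cvg_powR.
- by rewrite subr_gt0.
- by move=> i; rewrite addr_ge0 ?powR_ge0.
- by rewrite addr_ge0 ?powR_ge0.
by apply: cvgD; exact: cvg_powR.
Qed.

Lemma level_energy_clarkson_le2 n f g : p <= 2 -> continuous f -> continuous g ->
  clarkson_rhs (en n f) (en n g) <= en n (f \+ g) + en n (f \- g).
Proof.
move=> p2 cf cg; rewrite !level_energy_scaled//; [|exact: continuous_funB|exact: continuous_funD].
apply: le_trans (clarkson_sum_le2 _ _ p1 p2) _.
rewrite le_eqVlt; apply/orP; left; apply/eqP; congr (_ + _); apply: eq_bigr => e _.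
  by rewrite !fibre_mean_cellD// -mulrDr addrACA -opprD.
rewrite !fibre_mean_cellB// -mulrBr; congr (`|_ * _| `^ _).
move: (tau false (f \o Fmap R e)) (tau true (f \o Fmap R e)) => x1 x2.
by move: (tau false (g \o Fmap R e)) (tau true (g \o Fmap R e)) => y1 y2; ring.
Qed.

Lemma level_energy_clarkson_ge2 n f g : 2 <= p -> continuous f -> continuous g ->
  en n (f \+ g) + en n (f \- g) <= clarkson_rhs (en n f) (en n g).
Proof.
move=> p2 cf cg; rewrite !level_energy_scaled//; [|exact: continuous_funB|exact: continuous_funD].
apply: le_trans (clarkson_sum_ge2 _ _ p2).
rewrite le_eqVlt; apply/orP; left; apply/eqP; congr (_ + _); apply: eq_bigr => e _.
  by rewrite !fibre_mean_cellD// -mulrDr addrACA -opprD.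
rewrite !fibre_mean_cellB// -mulrBr; congr (`|_ * _| `^ _).
move: (tau false (f \o Fmap R e)) (tau true (f \o Fmap R e)) => x1 x2.
by move: (tau false (g \o Fmap R e)) (tau true (g \o Fmap R e)) => y1 y2; ring.
Qed.

Lemma level_energy_limits f g : Ccts p f -> Ccts p g ->
  clarkson_rhs (en n f) (en n g) @[n --> \oo] --> clarkson_rhs (E f) (E g) /\
  en n (f \+ g) + en n (f \- g) @[n --> \oo] --> E (f \+ g) + E (f \- g).
Proof.
move=> Cf Cg; have [Cfg _] := cts_energyD_le hnd hcu p1 Cf Cg; have Cfg' := CctsB hnd hcu p1 Cf Cg.
split; last by apply: cvgD; [exact: (level_energy_cvg hnd hcu p1 Cfg)|exact: (level_energy_cvg hnd hcu p1 Cfg')].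
apply: cvg_clarkson_rhs.
- by move=> i; exact: level_energy_ge0.
- by move=> i; exact: level_energy_ge0.
- exact: (Ccts_energy_ge0 hnd hcu p1 Cf).
- exact: (Ccts_energy_ge0 hnd hcu p1 Cg).
- exact: (level_energy_cvg hnd hcu p1 Cf).
- exact: (level_energy_cvg hnd hcu p1 Cg).
Qed.

Lemma cts_energy_clarkson_le2 f g : p <= 2 -> Ccts p f -> Ccts p g ->
  clarkson_rhs (E f) (E g) <= E (f \+ g) + E (f \- g).
Proof.
move=> p2 Cf Cg; have [h1 h2] := level_energy_limits Cf Cg; apply: (ler_cvg_to h1 h2).
by apply: nearW => n; apply: level_energy_clarkson_le2 => //; [exact: (Ccts_cont Cf)|exact: (Ccts_cont Cg)].
Qed.

Lemma cts_energy_clarkson_ge2 f g : 2 <= p -> Ccts p f -> Ccts p g ->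
  E (f \+ g) + E (f \- g) <= clarkson_rhs (E f) (E g).
Proof.
move=> p2 Cf Cg; have [h1 h2] := level_energy_limits Cf Cg; apply: (ler_cvg_to h2 h1).
by apply: nearW => n; apply: level_energy_clarkson_ge2 => //; [exact: (Ccts_cont Cf)|exact: (Ccts_cont Cg)].
Qed.

Lemma sobolev_limits f g : Fsob p f -> Fsob p g -> exists (lf lg ls ld : R) (fs gs : nat -> X -> R),
  [/\ [/\ 0 <= lf, 0 <= lg, Esob p f = lf%:E & Esob p g = lg%:E],
      Esob p (f \+ g) = ls%:E /\ Esob p (f \- g) = ld%:E,
      forall i, Ccts p (fs i) /\ Ccts p (gs i),
      clarkson_rhs (E (fs i)) (E (gs i)) @[i --> \oo] --> clarkson_rhs lf lg
    & E (fs i \+ gs i) + E (fs i \- gs i) @[i --> \oo] --> ls + ld].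
Proof.
move=> /(Fsob_approx)[mf _ [fs af]] /(Fsob_approx)[mg _ [gs ag]].
have [Cf _ _] := (approxP hnd hcu p1 _ _).1 af; have [Cg _ _] := (approxP hnd hcu p1 _ _).1 ag.
have [lf [lf0 fE fl]] := EsobP hnd hcu p1 mf af.
have [lg [lg0 gE gl]] := EsobP hnd hcu p1 mg ag.
have [ls [_ sE sl]] := EsobP hnd hcu p1 (measurable_funD mf mg) (approxD hnd hcu p1 mf mg af ag).
have [ld [_ dE dl]] := EsobP hnd hcu p1 (measurable_funB mf mg) (approxB hnd hcu p1 mf mg af ag).
exists lf, lg, ls, ld, fs, gs; split => //; last exact: cvgD.
apply: cvg_clarkson_rhs => // i; [exact: (Ccts_energy_ge0 hnd hcu p1 (Cf i))|exact: (Ccts_energy_ge0 hnd hcu p1 (Cg i))].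
Qed.

(** What strong locality uses of [Fsob]: by [EsobP] the energy of such a function is a finite
    number, and the class is stable under sums and under restriction to cells. *)
Definition approximable f := measurable_fun [set: X] f /\ exists fs, approximates p fs f.

Definition sobolev_energy f : R := fine (Esob p f).

Lemma Fsob_approximable f : Fsob p f -> approximable f.
Proof. by move=> /Fsob_approx[mf _ af]. Qed.

Lemma EsobE f : approximable f -> Esob p f = (sobolev_energy f)%:E.
Proof. by move=> [mf [fs af]]; have [l [_ h _]] := EsobP hnd hcu p1 mf af; rewrite /sobolev_energy h. Qed.

Lemma sobolev_energy_lim f fs : measurable_fun [set: X] f -> approximates p fs f -> E (fs i) @[i --> \oo] --> sobolev_energy f.
Proof. by move=> mf af; have [l [_ h fl]] := EsobP hnd hcu p1 mf af; rewrite /sobolev_energy h. Qed.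

Lemma approximableD f g : approximable f -> approximable g -> approximable (f \+ g).
Proof.
move=> [mf [fs af]] [mg [gs ag]]; split; first exact: measurable_funD.
by exists (fun i => fs i \+ gs i); exact: approxD.
Qed.

Lemma approximable_cell n (e : word S n) f : approximable f -> approximable (f \o Fmap R e).
Proof.
move=> [mf [fs af]]; split; first exact: (measurableT_comp mf (Fmap_measurable hnd e)).
by exists (fun i => fs i \o Fmap R e); exact: approx_cell.
Qed.

Lemma sobolev_energy_words n f : approximable f -> \sum_(e : word S n) sobolev_energy (f \o Fmap R e) = M ^+ n * sobolev_energy f.
Proof.
move=> [mf [fs af]]; have [Cf _ _] := (approxP hnd hcu p1 _ _).1 af.
have h1 : \sum_(e : word S n) E (fs i \o Fmap R e) @[i --> \oo] --> \sum_(e : word S n) sobolev_energy (f \o Fmap R e).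
  have he (e : word S n) : E (fs i \o Fmap R e) @[i --> \oo] --> sobolev_energy (f \o Fmap R e).
    apply: (sobolev_energy_lim (measurableT_comp mf (Fmap_measurable hnd e))).
    exact: (approx_cell hnd hcu p1 e mf af).
  by apply: cvg_big => [|e _]; [exact: add_continuous|exact: he].
have h2 : M ^+ n * E (fs i) @[i --> \oo] --> M ^+ n * sobolev_energy f.
  by apply: cvgMl_tmp; exact: sobolev_energy_lim.
have e : (fun i => \sum_(e : word S n) E (fs i \o Fmap R e)) = (fun i => M ^+ n * E (fs i)).
  by apply/funext => i; rewrite (cts_energy_words hnd hcu p1 n (Cf i)).
by rewrite e in h1; exact: (cvg_unique _ h1 h2).
Qed.

Lemma cts_energy_shift f c : continuous f -> E (f \+ (fun=> c)) = E f.
Proof.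
move=> cf; have cc : continuous (fun _ : X => c : R) by move=> x; exact: cst_continuous.
apply: (congr1 fine); have cfc := continuous_funD cf cc.
have ee n : en n (f \+ (fun=> c)) = en n f.
  rewrite /level_energy; congr (_ * _); apply: eq_bigr => e _.
  rewrite !fibre_mean_cellD//.
  have -> : (fun _ : X => c) \o Fmap R e = (fun=> c) by [].
  by rewrite !fibre_mean_cst opprD addrACA subrr addr0.
apply/eqP; rewrite eq_le; apply/andP; split; apply: (Ects_le hnd hcu p1) => // n.
  by rewrite ee; exact: level_energy_le_Ects.
by rewrite -ee; exact: level_energy_le_Ects.
Qed.

(** Neither constants nor null sets are seen by the energy. On a cell where a summand is almost
    everywhere constant, this removes it from the energy of the sum. *)
Lemma sobolev_energy_ae f g c : approximable f -> measurable_fun [set: X] g ->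
  Np (fun x => f x + c - g x)%R = 0%E -> approximable g /\ sobolev_energy g = sobolev_energy f.
Proof.
move=> [mf [fs af]] mg h.
have mfc : measurable_fun [set: X] (f \+ (fun=> c)) by exact: measurable_funD.
have ac : approximates p (fun i => fs i \+ (fun=> c)) (f \+ (fun=> c)).
  exact: (approxD hnd hcu p1 mf (measurable_cst c) af (approx_cst hnd hcu p1 c)).
have ag := approx_eq hnd hcu p1 h mfc mg ac.
split; first by split => //; exists (fun i => fs i \+ (fun=> c)).
have [Cf _ _] := (approxP hnd hcu p1 _ _).1 af.
have h1 := sobolev_energy_lim mg ag; have h2 := sobolev_energy_lim mf af.
have e : (fun i => E (fs i \+ (fun=> c))) = (fun i => E (fs i)).
  by apply/funext => i; rewrite cts_energy_shift//; exact: (Ccts_cont (Cf i)).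
by rewrite e in h1; exact: (cvg_unique _ h1 h2).
Qed.

(** Some closed set off which [f - b] vanishes almost everywhere misses the point, hence a whole
    cell around it. The restriction of [f - b] to the complement of that set has zero norm; by
    self-similarity its norm on this cell is zero too, and there it coincides with [f - b]. *)
Lemma supp_mu_cell f (b : R) w : measurable_fun [set: X] f ->
  ~ supp_mu (fun x => f x - b) (chi R w) ->
  exists n, Np (fun x => f (Fmap R (prefix_word n w) x) - b) = 0%E.
Proof.
move=> mf /existsNP[A /not_implyP[[cA [B [mB B0 hB]]] nA]].
have oA : open (~` A) by rewrite openC.
have [n hn] := open_cylinder hnd oA (w := w) nA.
have mA : measurable (~` A) by exact: sub_sigma_algebra.
exists n; pose hA := (fun x => f x - b) \_ (~` A).
have mh : measurable_fun [set: X] hA.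
  by apply/(measurable_restrictT _ _).1 => //; apply: measurable_funTS; exact: measurable_funB.
have hA0 : Np hA = 0%E.
  apply/(Lp_pow_eq0 hnd p1 mh); exists B; split => // x /= hx; apply: hB => /= H; apply: hx.
  by rewrite /hA patchE; case: ifPn => //; rewrite inE => /H.
have := Lp_pow_words p hnd n mh; rewrite hA0 => /esym/eqP; rewrite mule_eq0 eqe.
rewrite invr_eq0 expf_eq0 (gt_eqF K0) andbF/= => H.
have H0 : (\sum_(e : word S n) Np (hA \o Fmap R e) <= 0)%E by rewrite (eqP H).
have NE : Np (hA \o Fmap R (prefix_word n w)) = 0%E.
  apply/eqP; rewrite eq_le Lp_pow_ge0// andbT; apply: le_trans H0.
  by rewrite (bigD1 (prefix_word n w))//= leeDl// sume_ge0// => e _; exact: Lp_pow_ge0.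
rewrite -NE; congr Np; apply/funext => x /=; rewrite /hA patchE mem_set//.
rewrite -(chi_repr x) Fmap_chi//; apply: hn.
apply/prefix_cylinder; by rewrite (prefix_prepend _ _ 0).
Qed.

Lemma Lp_pow_prefixS f (b : R) n w : measurable_fun [set: X] f ->
  Np (fun x => f (Fmap R (prefix_word n w) x) - b) = 0%E ->
  Np (fun x => f (Fmap R (prefix_word n.+1 w) x) - b) = 0%E.
Proof.
move=> mf h; pose g := fun x => f (Fmap R (prefix_word n w) x) - b.
have mg : measurable_fun [set: X] g.
  by apply: measurable_funB => //; exact: (measurableT_comp mf (Fmap_measurable hnd _)).
have := Lp_pow_words p hnd 1 mg; rewrite -/g in h; rewrite h => /esym/eqP; rewrite mule_eq0 eqe.
rewrite invr_eq0 expf_eq0 (gt_eqF K0) andbF/= => H.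
have H0 : (\sum_(e : word S 1) Np (g \o Fmap R e) <= 0)%E by rewrite (eqP H).
have NE : Np (g \o Fmap R (n := 1) (tt, w n)) = 0%E.
  apply/eqP; rewrite eq_le Lp_pow_ge0// andbT; apply: le_trans H0.
  by rewrite (bigD1 ((tt, w n) : word S 1))//= leeDl// sume_ge0// => e _; exact: Lp_pow_ge0.
by rewrite -NE; congr Np; apply/funext => x; rewrite /g /= (FmapS hnd (prefix_word n w)).
Qed.

Lemma supp_disjoint_words f g (b c : R) : measurable_fun [set: X] f -> measurable_fun [set: X] g ->
  supp_mu (fun x => f x - b) `&` supp_mu (fun x => g x - c) = set0 ->
  exists n, forall e : word S n, Np (fun x => f (Fmap R e x) - b) = 0%E \/
                                 Np (fun x => g (Fmap R e x) - c) = 0%E.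
Proof.
move=> mf mg fg0.
pose G n (w : nat -> letter S) := Np (fun x => f (Fmap R (prefix_word n w) x) - b) = 0%E \/
  Np (fun x => g (Fmap R (prefix_word n w) x) - c) = 0%E.
have [N HN] : exists N, forall w, G N w.
  apply: (koenig (@letters_all S)).
  - by move=> n u v /prefix_cylinder uv; rewrite /G uv.
  - by move=> n w [h|h]; [left|right]; exact: Lp_pow_prefixS.
  move=> w; have [sf|nf] := pselect (supp_mu (fun x => f x - b) (chi R w)).
    have [|n hn] := @supp_mu_cell g c w mg; last by exists n; right.
    by move=> sg; have : set0 (chi R w) by rewrite -fg0.
  by have [n hn] := supp_mu_cell mf nf; exists n; left.
exists N => e; have := HN (prepend e point).
by rewrite /G (prefix_prepend e point 0).
Qed.

Opaque sobolev_energy.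

Lemma strong_locality f g h (b c : R) : approximable f -> approximable g -> approximable h ->
  supp_mu (fun x => f x - b) `&` supp_mu (fun x => g x - c) = set0 ->
  sobolev_energy (f \+ g \+ h) + sobolev_energy h = sobolev_energy (f \+ h) + sobolev_energy (g \+ h).
Proof.
move=> Gf Gg Gh fg0; have [n hn] := supp_disjoint_words Gf.1 Gg.1 fg0.
have Mn : M ^+ n != 0 by rewrite expf_neq0// gt_eqF.
have Gfgh := approximableD (approximableD Gf Gg) Gh; have Gfh := approximableD Gf Gh; have Ggh := approximableD Gg Gh.
have split u v : approximable u -> approximable v ->
    \sum_(e : word S n) (sobolev_energy (u \o Fmap R e) + sobolev_energy (v \o Fmap R e)) = M ^+ n * (sobolev_energy u + sobolev_energy v).
  by move=> Gu Gv; rewrite big_split /= mulrDr; congr (_ + _); exact: sobolev_energy_words.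
apply: (mulfI Mn); apply: (etrans (esym (split _ _ Gfgh Gh))).
apply: (etrans _ (split _ _ Gfh Ggh)).
apply: eq_bigr => e _.
have cell u : approximable u -> approximable (u \o Fmap R e) by exact: approximable_cell.
(* Where [u] is almost everywhere equal to [d], the function [w = u + v] differs from [v] by a
   constant. *)
have key u v w (d : R) : approximable u -> approximable v -> approximable w -> Np (fun x => u (Fmap R e x) - d) = 0%E ->
   (forall x, w x = u x + v x) -> sobolev_energy (w \o Fmap R e) = sobolev_energy (v \o Fmap R e).
  move=> Gu Gv Gw ud wE.
  have [|_ //] := @sobolev_energy_ae (v \o Fmap R e) (w \o Fmap R e) d (cell _ Gv) (cell _ Gw).1.
  rewrite -ud /Lp_pow; congr (integral _ _ _); apply/funext => x /=; rewrite wE.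
  by rewrite -normrN; congr (`|_| `^ _)%:E; ring.
case: (hn e) => H.
  have k1 := key f (g \+ h) (f \+ g \+ h) b Gf Ggh Gfgh H (fun x => esym (addrA _ _ _)).
  have k2 := key f h (f \+ h) b Gf Gh Gfh H (fun x => erefl).
  exact: (etrans (f_equal2 +%R k1 (esym k2)) (addrC _ _)).
have k1 := key g (f \+ h) (f \+ g \+ h) c Gg Gfh Gfgh H (fun x => etrans (esym (addrA _ _ _)) (addrCA _ _ _)).
have k2 := key g h (g \+ h) c Gg Gh Ggh H (fun x => erefl).
exact: (f_equal2 +%R k1 (esym k2)).
Qed.
End ClarksonLocality.

Theorem theorem6p8 (R : realType) (S : doubling_igs)
    (hnd : non_degenerate S) (hcu : conductively_uniform R S)
    (p : R) (hp : 1 < p) :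
  (* Poincare inequality *)
  (exists2 C : R, 0 < C &
    forall (n : nat) (e : word S n) (f : limspace R S -> R), Fsob p f ->
      ((fine (mu R S (Xcell R e)))^-1%:E *
         (\int[mu R S]_(x in Xcell R e)
             (`|f x - cell_avg e f| `^ p)%:E)
        <= C%:E * Esob p (f \o Fmap R e))%E) /\
  (forall f : limspace R S -> R, Fsob p f ->
    (Esob p f = 0%E <->
     exists c : R, {ae mu R S, forall x, f x = c})) /\
  (* Clarkson's inequality *)
  (forall f g : limspace R S -> R, Fsob p f -> Fsob p g ->
    (p <= 2 ->
      (2%:E * (Esob p f `^ (p - 1)^-1 + Esob p g `^ (p - 1)^-1) `^ (p - 1)
        <= Esob p (f \+ g)%R + Esob p (f \- g)%R)%E) /\
    (2 <= p ->
      (Esob p (f \+ g)%R + Esob p (f \- g)%R <=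
        2%:E * (Esob p f `^ (p - 1)^-1 + Esob p g `^ (p - 1)^-1) `^ (p - 1))%E))
  /\
  (* Strong locality *)
  (forall f g : limspace R S -> R, Fsob p f -> Fsob p g ->
    (exists a b : R, supp_mu (fun x => f x - a) `&` supp_mu (fun x => g x - b)
                     = set0) ->
    forall h : limspace R S -> R, Fsob p h ->
      (Esob p (f \+ g \+ h)%R + Esob p h
         = Esob p (f \+ h)%R + Esob p (g \+ h)%R)%E).
Proof.
pose a := (2 : R) `^ (p - 1); pose Q := 2 `^ p * (#|vert (gen S)|%:R `^ p * Mp S p) : R.
pose C := 2 * a * (a * (a * Q)).
have C0 : 0 <= C.
  by rewrite !mulr_ge0 ?powR_ge0// ltW// Mp_gt0.
have poincare n (e : word S n) (f : limspace R S -> R) : Fsob p f -> exists2 l : R, 0 <= l &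
    Esob p (f \o Fmap R e) = l%:E /\
    (Lp_pow p (fun z => f (Fmap R e z) - \int[mu_measure R hnd]_y f (Fmap R e y))%R <= (C * l)%:E)%E.
  move=> /Fsob_approx[mf Nf [fs af]].
  have mfe : measurable_fun [set: limspace R S] (f \o Fmap R e).
    exact: (measurableT_comp mf (Fmap_measurable hnd e)).
  have ae := approx_cell hnd hcu hp e mf af.
  have [l [l0 lE el]] := EsobP hnd hcu hp mfe ae.
  exists l => //; split => //.
  have Nfe : (Lp_pow p (f \o Fmap R e) < +oo)%E.
    have := Nf; rewrite (Lp_pow_words p hnd n mf) => h; apply: contraT; rewrite -leNgt leye_eq => /eqP eoo.
    move: h; rewrite (bigD1 e)//= eoo addye ?gt0_muley ?ltxx// ?lte_fin ?invr_gt0 ?exprn_gt0 ?card_letter_gt0//.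
    by rewrite esum_eqNy; apply/existsPn => e'; rewrite negb_and; apply/orP; right; rewrite gt_eqF// (lt_le_trans _ (Lp_pow_ge0 p hnd _))// ltNyr.
  have := poincare_sobolev hnd hcu hp mfe Nfe ae el.
  by rewrite [2 * a * _](_ : _ = C * l)//; rewrite /C /Q /a; ring.
split; [|split; [|split]].
(* Adding 1 turns the nonnegative [C] into a positive constant. *)
- exists (C + 1); first by rewrite ltr_wpDl.
  move=> n e f Ff; have [l l0 [lE h]] := poincare n e f Ff.
  have [mf _ _] := Fsob_approx Ff.
  rewrite (cell_oscillation p hnd e mf) lE; apply: le_trans h _.
  by rewrite -EFinM lee_fin ler_wpM2r// lerDl.
- move=> f Ff; have [mf Nf [fs af]] := Fsob_approx Ff; split.
    (* The word of length 0 has the whole space as its cell, so the inequality at level 0 yields the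
       constant. *)
    move=> E0; have [l l0 [lE h]] := poincare 0%N tt f Ff.
    have fE : f \o Fmap R (n := 0) (S := S) tt = f by apply/funext => x /=; rewrite Fmap0.
    rewrite fE E0 in lE; move: h; rewrite -(EFin_inj lE) mulr0 => h.
    exists (\int[mu_measure R hnd]_y f (Fmap R (n := 0) (S := S) tt y)).
    have mfc : measurable_fun [set: limspace R S] (fun x => f x - \int[mu_measure R hnd]_y f (Fmap R (n := 0) (S := S) tt y)).
      exact: measurable_funB.
    have /(Lp_pow_eq0 hnd hp mfc)[A [mA A0 hA]] : Lp_pow p (fun x => f x - \int[mu_measure R hnd]_y f (Fmap R (n := 0) (S := S) tt y)) = 0%E.
      apply/eqP; rewrite eq_le Lp_pow_ge0// andbT; apply: le_trans h.
      rewrite le_eqVlt; apply/orP; left; apply/eqP; congr (Lp_pow p _).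
      by apply/funext => x; rewrite Fmap0.
    exists A; split => // x nx; apply: hA => /= /eqP; rewrite subr_eq0 => /eqP; exact: nx.
  move=> [c [A [mA A0 hA]]].
  have mc : measurable_fun [set: limspace R S] (fun x => f x + - c - 0).
    by apply: measurable_funB => //; exact: measurable_funD.
  have z : Lp_pow p (fun x => f x + - c - 0) = 0%E.
    apply/(Lp_pow_eq0 hnd hp mc); exists A; split => // x /= nx; apply: hA => /= fc; apply: nx.
    by rewrite fc subrr subr0.
  have m0 : measurable_fun [set: limspace R S] (fun=> 0 : R) by exact: measurable_cst.
  have [G0 e0] := sobolev_energy_ae hnd hcu hp (Fsob_approximable Ff) m0 z.
  rewrite (EsobE hnd hcu hp (Fsob_approximable Ff)) -e0 -(EsobE hnd hcu hp G0).
  have [l [_ -> hl]] := EsobP hnd hcu hp m0 (approx_cst hnd hcu hp 0).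
  have [_ E00] := Ccts_cst hnd hcu hp 0.
  have h0 : (fun _ : nat => cts_energy p (fun _ : limspace R S => 0)) @ \oo --> cts_energy p (fun _ : limspace R S => 0).
    exact: cvg_cst.
  by congr EFin; apply: (etrans (cvg_unique _ hl h0) E00).
- move=> f g Ff Fg.
  have [lf [lg [ls [ld [fs [gs [[lf0 lg0 -> ->] [-> ->] Cfg h1 h2]]]]]]] := sobolev_limits hnd hcu hp Ff Fg.
  split => p2.
    change ((clarkson_rhs p lf lg)%:E <= (ls + ld)%:E)%E; rewrite lee_fin; apply: (ler_cvg_to h1 h2); apply: nearW => i.
    exact: (cts_energy_clarkson_le2 hnd hcu hp p2 (Cfg i).1 (Cfg i).2).
  change ((ls + ld)%:E <= (clarkson_rhs p lf lg)%:E)%E; rewrite lee_fin; apply: (ler_cvg_to h2 h1); apply: nearW => i.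
  exact: (cts_energy_clarkson_ge2 hnd hcu hp p2 (Cfg i).1 (Cfg i).2).
move=> f g Ff Fg [b [c fg0]] h Fh.
have [Gf Gg Gh] := And3 (Fsob_approximable Ff) (Fsob_approximable Fg) (Fsob_approximable Fh).
have Gfg := approximableD hnd hcu hp Gf Gg.
rewrite (EsobE hnd hcu hp (approximableD hnd hcu hp Gfg Gh)) (EsobE hnd hcu hp Gh).
rewrite (EsobE hnd hcu hp (approximableD hnd hcu hp Gf Gh)) (EsobE hnd hcu hp (approximableD hnd hcu hp Gg Gh)).
exact: (congr1 EFin (strong_locality hnd hcu hp Gf Gg Gh fg0)).
Qed.
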